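(* Let $0<\alpha\le 1$. Let $q,\tilde q$ be real-valued continuous functions on $[0,\pi]$ and $h,H,\tilde h,\tilde H\in\mathbb{R}$. Let $\{\lambda_n\}_{n\ge0}$ be the eigenvalues of the problem $L_\alpha(q,h,H)$: $$-D_x^\alpha D_x^\alpha y+q(x)y=\lambda y,\ 0<x<\pi,\qquad D_x^\alpha y(0)-hy(0)=0,\qquad D_x^\alpha y(\pi)+Hy(\pi)=0,$$ and let $\{\xi_n\}_{n\ge0}$ be the eigenvalues of the problem $L_{\alpha,1}(q,H)$: $$-D_x^\alpha D_x^\alpha y+q(x)y=\lambda y,\ 0<x<\pi,\qquad y(0)=0,\qquad D_x^\alpha y(\pi)+Hy(\pi)=0.$$ Let $\{\tilde\lambda_n\}_{n\ge0}$, $\{\tilde\xi_n\}_{n\ge0}$ be the corresponding eigenvalues for the coefficients $\tilde q,\tilde h,\tilde H$. If $\lambda_n=\tilde\lambda_n$ and $\xi_n=\tilde\xi_n$ for all $n\ge0$, then $q(x)=\tilde q(x)$ a.e. on $[0,\pi]$, $h=\tilde h$ and $H=\tilde H$.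
   Context: $D_x^\alpha$ denotes the conformable fractional derivative of order $\alpha$: for $x>0$, $D^\alpha f(x)=\lim_{\varepsilon\to 0}\frac{f(x+\varepsilon x^{1-\alpha})-f(x)}{\varepsilon}$, and $D^\alpha f(0)=\lim_{x\to0^+}D^\alpha f(x)$ (for differentiable $f$, $D^\alpha f(x)=x^{1-\alpha}f'(x)$). $\lambda$ is a complex spectral parameter. The eigenvalues of each problem are real and simple, and are enumerated in increasing order. *)

(* Defs.v *)
From Stdlib Require Import Reals Lra.
From Coquelicot Require Import Coquelicot.
Open Scope R_scope.

(* Conformable fractional derivative of order al at x > 0 (complex-valued f):
   d = lim_{eps -> 0} (f (x + eps x^(1-al)) - f x) / eps. *)
Definition conf_deriv (al : R) (f : R -> C) (x : R) (d : C) : Prop :=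
  filterlim (fun eps : R => Cdiv (Cminus (f (x + eps * Rpower x (1 - al))) (f x)) (RtoC eps))
            (locally' 0) (locally d).

(* lambda is an eigenvalue of  -D^a D^a y + q y = lambda y  on (0,pi) with
   boundary conditions given by [bc0] (at 0) and [bcpi] (at pi);
   bc0 (y 0) (D^a y (0)) and bcpi (y pi) (D^a y (pi)), where
   D^a y (0) = lim_{x->0+} D^a y (x) and D^a y (pi) = lim_{x->pi-} D^a y (x). *)
Definition is_eigenvalue (al : R) (q : R -> R) (bc0 bcpi : C -> C -> Prop)
  (lambda : C) : Prop :=
  exists (y y1 : R -> C) (d0 dpi : C),
    (forall x, 0 < x < PI ->
       conf_deriv al y x (y1 x) /\
       exists y2x : C, conf_deriv al y1 x y2x /\
         Cplus (Copp y2x) (Cmult (RtoC (q x)) (y x)) = Cmult lambda (y x)) /\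
    filterlim y (at_right 0) (locally (y 0)) /\
    filterlim y (at_left PI) (locally (y PI)) /\
    filterlim y1 (at_right 0) (locally d0) /\
    filterlim y1 (at_left PI) (locally dpi) /\
    bc0 (y 0) d0 /\ bcpi (y PI) dpi /\
    (exists x, 0 < x < PI /\ y x <> RtoC 0).

Definition eig_L (al : R) (q : R -> R) (h H : R) (lambda : C) : Prop :=
  is_eigenvalue al q
    (fun y0 d0 => Cminus d0 (Cmult (RtoC h) y0) = RtoC 0)
    (fun ypi dpi => Cplus dpi (Cmult (RtoC H) ypi) = RtoC 0) lambda.

Definition eig_L1 (al : R) (q : R -> R) (H : R) (lambda : C) : Prop :=
  is_eigenvalue al q
    (fun y0 d0 => y0 = RtoC 0)
    (fun ypi dpi => Cplus dpi (Cmult (RtoC H) ypi) = RtoC 0) lambda.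

Definition enumerates_spectrum (P : C -> Prop) (mu : nat -> R) : Prop :=
  (forall n, mu n < mu (S n)) /\ (forall z : C, P z <-> exists n, z = RtoC (mu n)).

Definition continuous_on_0pi (q : R -> R) : Prop :=
  forall x, 0 <= x <= PI ->
    filterlim q (within (fun t => 0 <= t <= PI) (locally x)) (locally (q x)).

Definition lebesgue_null (N : R -> Prop) : Prop :=
  forall eps, 0 < eps ->
    exists a b : nat -> R,
      (forall k, a k <= b k) /\
      (forall x, N x -> exists k, a k <= x <= b k) /\
      (forall n, sum_f_R0 (fun k => b k - a k) n < eps).

Definition ae_eq_0pi (f g : R -> R) : Prop :=
  exists N, lebesgue_null N /\ forall x, 0 <= x <= PI -> ~ N x -> f x = g x.

(* Main.v *)
Require Import Defs.
From Stdlib Require Import Reals Lra Lia Classical ClassicalEpsilon List Wf_nat.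
From Coquelicot Require Import Coquelicot.
Open Scope R_scope.

(** In the variable [t = x^al / al] the problems become classical Sturm-Liouville
    problems on [[0, T]].  Let [C], [S] be the solutions with initial data [(1, h)] and
    [(0, 1)]; the two spectra are the zeros of [D = C'(T) + H C(T)] and
    [D1 = S'(T) + H S(T)].  These are entire functions of [lam] with simple real zeros,
    and on large squares in the [rho]-plane, [lam = rho^2], two such functions with
    different coefficients have a quotient tending to [1].  If they have the same zeros,
    the maximum principle makes the quotient equal to [1], so both spectra determine [D]
    and [D1].  Then, writing [psi = D1 C - D S] (the solution normalised at [T]) and
    marking the second problem by a tilde,
    [D (S C~ - C S~) = C psi~ - psi C~],
    whose right-hand side is [O(exp(|Im rho| T))] while [D] is of exact order
    [|rho| exp(|Im rho| T)] on the squares.  The entire function [S C~ - C S~] thus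
    vanishes, again by the maximum principle; differentiating [S / C] gives
    [C^2 = C~^2], hence [C = C~] for very negative [lam], and the coefficients agree. *)

(** * Complex-valued functions of a real variable *)

(** The maximum principle replaces Hadamard factorisation and contour integrals. The functions are
    entire in [lam] but their growth is measured in [rho], so one bounds [g (rho * rho)] for [rho]
    on squares centred at 0. Squares fit the leading terms, [-rho sin (rho T)] for [D] and
    [cos (rho T)] for [D1]: on horizontal sides one exponential dominates, and on vertical sides the
    trigonometric factor has modulus 1 once [R0 * T] is a zero of the cosine for [D], of the sine
    for [D1]. These leading terms do not involve the coefficients, which is why the quotients tend
    to 1. A quotient extends across the zeros of its denominator because they are simple. At a real
    zero this follows from the positivity of the integral of [y^2]; the zeros are real because real
    numbers enumerate the spectra. In the last estimate [C] grows at [t] at most like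
    [exp (|Im rho| t)] and [psi] like [exp (|Im rho| (T - t))]. Their product matches the
    exponential in [D], and the extra factor [rho] of [D] makes the kernel tend to 0 on the
    squares. *)

Definition Cd (f : R -> C) (t : R) (d : C) : Prop :=
  is_derive (fun s => fst (f s)) t (fst d) /\
  is_derive (fun s => snd (f s)) t (snd d).

Definition Ccont (f : R -> C) (t : R) : Prop :=
  continuous (fun s => fst (f s)) t /\ continuous (fun s => snd (f s)) t.

Lemma is_derive_val (f : R -> R) (t d d' : R) :
  is_derive f t d -> d = d' -> is_derive f t d'.
Proof. now intros H <-. Qed.

Lemma Cd_val f t d d' : Cd f t d -> d = d' -> Cd f t d'.
Proof. now intros H <-. Qed.

Lemma Cd_ext f g t d : (forall s, f s = g s) -> Cd f t d -> Cd g t d.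
Proof.
intros E [H1 H2]; split; eapply is_derive_ext; try eassumption;
  intros s; simpl; now rewrite E.
Qed.

Lemma Cd_cont f t d : Cd f t d -> Ccont f t.
Proof.
intros [H1 H2]; split.
- apply (ex_derive_continuous (fun s => fst (f s))); eexists; eassumption.
- apply (ex_derive_continuous (fun s => snd (f s))); eexists; eassumption.
Qed.

Lemma Cd_const c t : Cd (fun _ => c) t 0.
Proof.
split; simpl.
- exact (is_derive_const (fst c) t).
- exact (is_derive_const (snd c) t).
Qed.

Lemma Cd_plus f g t df dg :
  Cd f t df -> Cd g t dg -> Cd (fun s => f s + g s)%C t (df + dg)%C.
Proof.
intros [F1 F2] [G1 G2]; split; simpl.
- exact (is_derive_plus _ _ _ _ _ F1 G1).
- exact (is_derive_plus _ _ _ _ _ F2 G2).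
Qed.

Lemma Cd_mult f g t df dg :
  Cd f t df -> Cd g t dg ->
  Cd (fun s => f s * g s)%C t (df * g t + f t * dg)%C.
Proof.
intros [F1 F2] [G1 G2]; split; simpl.
- eapply is_derive_val.
  + exact (is_derive_minus _ _ _ _ _ (Derive.is_derive_mult _ _ _ _ _ F1 G1)
             (Derive.is_derive_mult _ _ _ _ _ F2 G2)).
  + unfold minus, plus, opp; simpl; ring.
- eapply is_derive_val.
  + exact (is_derive_plus _ _ _ _ _ (Derive.is_derive_mult _ _ _ _ _ F1 G2)
             (Derive.is_derive_mult _ _ _ _ _ F2 G1)).
  + unfold plus; simpl; ring.
Qed.

Lemma Cd_scal c f t df : Cd f t df -> Cd (fun s => c * f s)%C t (c * df)%C.
Proof.
intros F; eapply Cd_val; [exact (Cd_mult _ _ _ _ _ (Cd_const c t) F)|cbv beta; ring].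
Qed.

Lemma Cd_opp f t df : Cd f t df -> Cd (fun s => - f s)%C t (- df)%C.
Proof.
intros F; apply Cd_ext with (fun s => (RtoC (-1)) * f s)%C.
- intros s; apply injective_projections; simpl; ring.
- eapply Cd_val; [exact (Cd_scal _ _ _ _ F)|].
  apply injective_projections; simpl; ring.
Qed.

Lemma Cd_minus f g t df dg :
  Cd f t df -> Cd g t dg -> Cd (fun s => f s - g s)%C t (df - dg)%C.
Proof. intros F G; exact (Cd_plus _ _ _ _ _ F (Cd_opp _ _ _ G)). Qed.

Lemma Cd_comp f (g : R -> R) t df dg :
  Cd f (g t) df -> is_derive g t dg -> Cd (fun s => f (g s)) t (RtoC dg * df)%C.
Proof.
intros [F1 F2] G; split; simpl; eapply is_derive_val.
- exact (is_derive_comp _ _ _ _ _ F1 G).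
- unfold scal; simpl; unfold mult; simpl; ring.
- exact (is_derive_comp _ _ _ _ _ F2 G).
- unfold scal; simpl; unfold mult; simpl; ring.
Qed.

Lemma Cd_unique f t d d' : Cd f t d -> Cd f t d' -> d = d'.
Proof.
intros [F1 F2] [G1 G2]; apply injective_projections.
- now rewrite <- (is_derive_unique _ _ _ F1), <- (is_derive_unique _ _ _ G1).
- now rewrite <- (is_derive_unique _ _ _ F2), <- (is_derive_unique _ _ _ G2).
Qed.

Lemma Ccont_const c t : Ccont (fun _ => c) t.
Proof. split; apply continuous_const. Qed.

Lemma Ccont_plus f g t : Ccont f t -> Ccont g t -> Ccont (fun s => f s + g s)%C t.
Proof.
intros [F1 F2] [G1 G2]; split; simpl.
- exact (continuous_plus _ _ _ F1 G1).
- exact (continuous_plus _ _ _ F2 G2).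
Qed.

Lemma Ccont_mult f g t : Ccont f t -> Ccont g t -> Ccont (fun s => f s * g s)%C t.
Proof.
intros [F1 F2] [G1 G2]; split; simpl.
- exact (continuous_minus _ _ _ (continuous_mult _ _ _ F1 G1) (continuous_mult _ _ _ F2 G2)).
- exact (continuous_plus _ _ _ (continuous_mult _ _ _ F1 G2) (continuous_mult _ _ _ F2 G1)).
Qed.

Lemma Ccont_opp f t : Ccont f t -> Ccont (fun s => - f s)%C t.
Proof.
intros [F1 F2]; split; simpl.
- exact (continuous_opp _ _ F1).
- exact (continuous_opp _ _ F2).
Qed.

Lemma Ccont_Cmod f t : Ccont f t -> continuous (fun s => Cmod (f s)) t.
Proof.
intros [F1 F2]; unfold Cmod.
apply (continuous_comp (fun s => fst (f s) ^ 2 + snd (f s) ^ 2) sqrt).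
- apply (continuous_plus (fun s => fst (f s) ^ 2) (fun s => snd (f s) ^ 2)).
  + apply continuous_ext with (fun s => fst (f s) * fst (f s)).
    * intros s; simpl; ring.
    * exact (continuous_mult _ _ _ F1 F1).
  + apply continuous_ext with (fun s => snd (f s) * snd (f s)).
    * intros s; simpl; ring.
    * exact (continuous_mult _ _ _ F2 F2).
- apply continuous_sqrt.
Qed.

Lemma fst_le_Cmod z : Rabs (fst z) <= Cmod z.
Proof. eapply Rle_trans; [apply Rmax_l|apply Rmax_Cmod]. Qed.

Lemma snd_le_Cmod z : Rabs (snd z) <= Cmod z.
Proof. eapply Rle_trans; [apply Rmax_r|apply Rmax_Cmod]. Qed.

Lemma Cmod_le_abs z : Cmod z <= Rabs (fst z) + Rabs (snd z).
Proof.
replace z with (RtoC (fst z) + Ci * RtoC (snd z))%C at 1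
  by (apply injective_projections; simpl; ring).
eapply Rle_trans; [apply Cmod_triangle|].
rewrite Cmod_mult, !Cmod_R, Cmod_Ci; lra.
Qed.

Lemma Cmod_minus_sym a b : Cmod (a - b) = Cmod (b - a).
Proof. rewrite <- Cmod_opp; f_equal; ring. Qed.

Lemma Cmod_minus_le a b : Cmod (a - b) <= Cmod a + Cmod b.
Proof.
unfold Cminus; eapply Rle_trans; [apply Cmod_triangle|]; rewrite Cmod_opp; lra.
Qed.

Lemma Cmod_minus_ge a b : Cmod a - Cmod b <= Cmod (a - b).
Proof.
assert (H := Cmod_triangle (a - b) b).
replace (a - b + b)%C with a in H by ring; lra.
Qed.

(* Project the increment on its own direction and apply the real mean value theorem. *)
Lemma Cd_mean_value (f f' : R -> C) (G G' : R -> R) (a b : R) :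
  a <= b ->
  (forall s, a <= s <= b -> Cd f s (f' s)) ->
  (forall s, a <= s <= b -> is_derive G s (G' s)) ->
  (forall s, a <= s <= b -> Cmod (f' s) <= G' s) ->
  Cmod (f b - f a) <= G b - G a.
Proof.
intros Hab Hf HG Hb.
set (v := (f b - f a)%C).
set (p := fun s => Cmod v * G s - (fst v * fst (f s) + snd v * snd (f s))).
set (p' := fun s => Cmod v * G' s - (fst v * fst (f' s) + snd v * snd (f' s))).
assert (Hp : forall s, a <= s <= b -> is_derive p s (p' s)).
{ intros s Hs; destruct (Hf s Hs) as [F1 F2].
  apply (is_derive_minus (fun s => Cmod v * G s)
    (fun s => fst v * fst (f s) + snd v * snd (f s))).
  - apply is_derive_scal, HG, Hs.
  - apply (is_derive_plus (fun s => fst v * fst (f s)) (fun s => snd v * snd (f s)));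
      now apply is_derive_scal. }
destruct (MVT_gen p a b p') as [c [Hc E]].
- intros x Hx; apply Hp; rewrite Rmin_left, Rmax_right in Hx; lra.
- intros x Hx; apply continuity_pt_filterlim.
  apply (ex_derive_continuous p); eexists; apply Hp;
    rewrite Rmin_left, Rmax_right in Hx; lra.
- rewrite Rmin_left, Rmax_right in Hc by lra.
  assert (Hpc : 0 <= p' c).
  { unfold p'.
    assert (fst v * fst (f' c) + snd v * snd (f' c) <= Cmod v * Cmod (f' c)).
    { rewrite <- (Cmod_conj v), <- Cmod_mult.
      replace (fst v * fst (f' c) + snd v * snd (f' c)) with (fst (Cconj v * f' c)%C)
        by (simpl; ring).
      eapply Rle_trans; [apply Rle_abs|apply fst_le_Cmod]. }
    assert (Cmod v * Cmod (f' c) <= Cmod v * G' c)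
      by (apply Rmult_le_compat_l; [apply Cmod_ge_0|now apply Hb]).
    lra. }
  assert (Hd : 0 <= p b - p a) by (rewrite E; apply Rmult_le_pos; lra).
  unfold p in Hd.
  assert (E2 : fst v * fst (f b) + snd v * snd (f b)
     - (fst v * fst (f a) + snd v * snd (f a)) = Cmod v ^ 2).
  { rewrite Cmod2_alt; unfold v, Re, Im; simpl; ring. }
  destruct (Rle_lt_or_eq_dec 0 (Cmod v) (Cmod_ge_0 v)) as [P|Z].
  + apply Rmult_le_reg_l with (Cmod v); [assumption|]; lra.
  (* When [f b = f a] there is no factor to cancel; what remains is that [G] increases, since [G']
     dominates a modulus. *)
  + rewrite <- Z.
    destruct (MVT_gen G a b G') as [e [He E3]].
    * intros x Hx; apply HG; rewrite Rmin_left, Rmax_right in Hx; lra.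
    * intros x Hx; apply continuity_pt_filterlim.
      apply (ex_derive_continuous G); eexists; apply HG;
        rewrite Rmin_left, Rmax_right in Hx; lra.
    * rewrite Rmin_left, Rmax_right in He by lra.
      rewrite E3; apply Rmult_le_pos; [|lra].
      eapply Rle_trans; [apply Cmod_ge_0|now apply Hb].
Qed.

Lemma Cd_zero_const (f : R -> C) a b :
  a <= b -> (forall s, a <= s <= b -> Cd f s 0) -> f b = f a.
Proof.
intros Hab Hf.
assert (H : Cmod (f b - f a) <= 0 - 0).
{ apply (Cd_mean_value f (fun _ => RtoC 0) (fun _ => 0) (fun _ => 0)); trivial.
  - intros s _; exact (is_derive_const 0 s).
  - intros s _; rewrite Cmod_0; lra. }
assert (E : (f b - f a)%C = 0) by (apply Cmod_eq_0; generalize (Cmod_ge_0 (f b - f a)); lra).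
replace (f b) with (f b - f a + f a)%C by ring; rewrite E; ring.
Qed.

(** Integration gains a factor [1 / K] in the norm weighted by [exp (K |t|)]. Taking [K] large makes
    the Picard map contract on the whole line at once. Negative times reduce to positive ones by
    reflection. *)
Lemma Cd_exp_bound (f f' : R -> C) (m K : R) :
  0 < K ->
  (forall s, Cd f s (f' s)) ->
  (forall s, Cmod (f' s) <= m * exp (K * Rabs s)) ->
  forall t, Cmod (f t - f 0) <= m / K * exp (K * Rabs t).
Proof.
intros HK Hf Hb.
assert (Hm : 0 <= m).
{ generalize (Hb 0) (Cmod_ge_0 (f' 0)); rewrite Rabs_R0, Rmult_0_r, exp_0; lra. }
assert (HmK : 0 <= m / K) by (apply Rdiv_le_0_compat; lra).
assert (pos : forall (g g' : R -> C),
  (forall s, Cd g s (g' s)) -> (forall s, Cmod (g' s) <= m * exp (K * Rabs s)) ->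
  forall t, 0 <= t -> Cmod (g t - g 0) <= m / K * exp (K * Rabs t)).
{ intros g g' Hg Hgb t Ht.
  assert (B : Cmod (g t - g 0) <= m / K * exp (K * t) - m / K * exp (K * 0)).
  { apply (Cd_mean_value g g' (fun s => m / K * exp (K * s)) (fun s => m * exp (K * s)));
      trivial.
    - intros s _; auto_derive; trivial; field; lra.
    - intros s Hs; specialize (Hgb s); rewrite Rabs_pos_eq in Hgb; lra. }
  rewrite (Rabs_pos_eq t Ht); rewrite Rmult_0_r, exp_0 in B; lra. }
intros t; destruct (Rle_dec 0 t) as [Ht|Ht]; [now apply (pos f f')|].
assert (P := pos (fun s => f (- s)) (fun s => RtoC (-1) * f' (- s)%R)%C).
rewrite <- (Rabs_Ropp t).
replace (Cmod (f t - f 0)) with (Cmod (f (- - t) - f (- 0)))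
  by now rewrite Ropp_involutive, Ropp_0.
apply P; [| |lra].
- intros s; apply (Cd_comp f (fun s => - s)); [apply Hf|].
  auto_derive; trivial.
- intros s; rewrite Cmod_mult, Cmod_R, Rabs_left, <- (Rabs_Ropp s) by lra.
  generalize (Hb (- s)); lra.
Qed.

Definition CI (f : R -> C) (t : R) : C :=
  (RInt (fun s => fst (f s)) 0 t, RInt (fun s => snd (f s)) 0 t).

Lemma RInt_derive_cont (f : R -> R) t :
  (forall s, continuous f s) -> is_derive (fun t => RInt f 0 t) t (f t).
Proof.
intros Hf; apply (is_derive_RInt f (fun t => RInt f 0 t) 0 t); [|apply Hf].
apply filter_forall; intros x; apply (RInt_correct f).
apply (ex_RInt_continuous f); intros; apply Hf.
Qed.

Lemma CI_deriv f t : (forall s, Ccont f s) -> Cd (CI f) t (f t).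
Proof.
intros Hf; split; simpl.
- apply (RInt_derive_cont (fun s => fst (f s))); intros s; apply Hf.
- apply (RInt_derive_cont (fun s => snd (f s))); intros s; apply Hf.
Qed.

Lemma CI_0 f : CI f 0 = 0.
Proof. unfold CI; rewrite !RInt_point; reflexivity. Qed.

(** * Linear second order equations *)

Lemma pow_half_small (c eps : R) : 0 < eps -> exists n, c * (1 / 2) ^ n < eps.
Proof.
intros He.
assert (Hc : 0 < Rabs c + 1) by (generalize (Rabs_pos c); lra).
destruct (pow_lt_1_zero (1 / 2)) with (y := eps / (Rabs c + 1)) as [N HN].
- rewrite Rabs_pos_eq; lra.
- now apply Rdiv_lt_0_compat.
- exists N; specialize (HN N (le_n N)).
  rewrite Rabs_pos_eq in HN by (apply pow_le; lra).
  apply Rmult_lt_compat_l with (r := Rabs c + 1) in HN; [|assumption].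
  replace ((Rabs c + 1) * (eps / (Rabs c + 1))) with eps in HN by (field; lra).
  eapply Rle_lt_trans; [|exact HN].
  apply Rmult_le_compat_r; [apply pow_le; lra|].
  generalize (Rle_abs c); lra.
Qed.

Lemma le_0_of_pow_half (x c : R) : (forall n, x <= c * (1 / 2) ^ n) -> x <= 0.
Proof.
intros H; apply Rnot_lt_le; intros Hx.
destruct (pow_half_small c x Hx) as [n Hn]; specialize (H n); lra.
Qed.

Lemma Lim_seq_geometric (u : nat -> R) (M : R) :
  (forall n, Rabs (u (S n) - u n) <= M * (1 / 2) ^ n) ->
  forall n, Rabs (u n - real (Lim_seq u)) <= 2 * M * (1 / 2) ^ n.
Proof.
intros Hu.
(* The subtracted tail of the geometric series makes the induction on [p] close; it is dropped in
   [S2]. *)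
assert (S1 : forall n p, Rabs (u (n + p)%nat - u n)
    <= 2 * M * (1 / 2) ^ n - 2 * M * (1 / 2) ^ (n + p)).
{ intros n p; induction p as [|p IH].
  - rewrite Nat.add_0_r, Rminus_diag, Rabs_R0; lra.
  - rewrite Nat.add_succ_r.
    replace (u (S (n + p)) - u n) with
      ((u (S (n + p)) - u (n + p)%nat) + (u (n + p)%nat - u n)) by ring.
    eapply Rle_trans; [apply Rabs_triang|].
    specialize (Hu (n + p)%nat); simpl; lra. }
assert (HM : 0 <= M) by (generalize (Hu 0%nat) (Rabs_pos (u 1%nat - u 0%nat)); simpl; lra).
assert (S2 : forall n p, Rabs (u (n + p)%nat - u n) <= 2 * M * (1 / 2) ^ n).
{ intros n p; eapply Rle_trans; [apply S1|].
  assert (0 <= 2 * M * (1 / 2) ^ (n + p))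
    by (apply Rmult_le_pos; [lra|apply pow_le; lra]); lra. }
assert (ex : ex_finite_lim_seq u).
{ apply ex_lim_seq_cauchy_corr; intros eps.
  destruct (pow_half_small (4 * M) eps (cond_pos eps)) as [N HN].
  exists N; intros n m Hn Hm.
  replace (u n - u m) with ((u n - u N) - (u m - u N)) by ring.
  assert (A1 := S2 N (n - N)%nat); assert (A2 := S2 N (m - N)%nat).
  replace (N + (n - N))%nat with n in A1 by lia.
  replace (N + (m - N))%nat with m in A2 by lia.
  unfold Rminus at 1; eapply Rle_lt_trans; [apply Rabs_triang|].
  rewrite Rabs_Ropp; lra. }
apply Lim_seq_correct' in ex.
intros n; set (l := real (Lim_seq u)) in *.
assert (L : is_lim_seq (fun p => Rabs (u n - u (p + n)%nat)) (Rabs (u n - l))).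
{ apply (is_lim_seq_abs _ (u n - l)).
  apply is_lim_seq_minus'; [apply is_lim_seq_const|].
  now apply -> is_lim_seq_incr_n. }
apply (is_lim_seq_le (fun p => Rabs (u n - u (p + n)%nat)) (fun _ => 2 * M * (1 / 2) ^ n)
  (Rabs (u n - l)) (2 * M * (1 / 2) ^ n)); trivial.
- intros p; rewrite Rabs_minus_sym, Nat.add_comm; apply S2.
- apply is_lim_seq_const.
Qed.

(** Iteration on the derivative [z = y'] alone, with [y = y0 + CI z]: the equation [y'' = a y + b]
    becomes the fixed point problem [z = z0 + CI (b + a y)]. *)
Fixpoint picard (a b : R -> C) (y0 z0 : C) (n : nat) : R -> C :=
  match n with
  | O => fun _ => RtoC 0
  | S n => fun t =>
      (z0 + CI (fun s => b s + a s * (y0 + CI (picard a b y0 z0 n) s)) t)%C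
  end.

Definition sol_z a b y0 z0 (t : R) : C :=
  (real (Lim_seq (fun n => fst (picard a b y0 z0 n t))),
   real (Lim_seq (fun n => snd (picard a b y0 z0 n t)))).

Definition sol_y a b y0 z0 (t : R) : C := (y0 + CI (sol_z a b y0 z0) t)%C.

Lemma Ccont_CI f t : (forall s, Ccont f s) -> Ccont (CI f) t.
Proof. intros Hf; eapply Cd_cont, CI_deriv, Hf. Qed.

Lemma picard_integrand_cont (a b f : R -> C) y0 :
  (forall t, Ccont a t) -> (forall t, Ccont b t) -> (forall t, Ccont f t) ->
  forall t, Ccont (fun s => b s + a s * (y0 + CI f s))%C t.
Proof.
intros Ha Hb Hf t; apply Ccont_plus; [apply Hb|].
apply Ccont_mult; [apply Ha|].
apply Ccont_plus; [apply Ccont_const|now apply Ccont_CI].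
Qed.

Lemma picard_cont a b y0 z0 :
  (forall t, Ccont a t) -> (forall t, Ccont b t) ->
  forall n t, Ccont (picard a b y0 z0 n) t.
Proof.
intros Ha Hb n; induction n as [|n IH]; intros t.
- apply Ccont_const.
- simpl; apply Ccont_plus; [apply Ccont_const|].
  apply Ccont_CI; now apply picard_integrand_cont.
Qed.

Lemma exp_le_mono x y : x <= y -> exp x <= exp y.
Proof. intros [H| ->]; [left; now apply exp_increasing|lra]. Qed.

Lemma exp_Rabs_ge1 K t : 0 < K -> 1 <= exp (K * Rabs t).
Proof.
intros HK; rewrite <- exp_0; apply exp_le_mono.
apply Rmult_le_pos; [lra|apply Rabs_pos].
Qed.

(* The weight [exp (K |t|)] turns the Picard map into a contraction of ratio [A / K ^ 2]. *)
Lemma picard_contract (a b f g : R -> C) y0 z0 A K m :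
  0 < K -> 2 * A <= K * K ->
  (forall t, Ccont a t) -> (forall t, Ccont b t) ->
  (forall t, Cmod (a t) <= A) ->
  (forall t, Ccont f t) -> (forall t, Ccont g t) ->
  (forall t, Cmod (f t - g t) <= m * exp (K * Rabs t)) ->
  forall t,
  Cmod ((z0 + CI (fun s => b s + a s * (y0 + CI f s)) t)
      - (z0 + CI (fun s => b s + a s * (y0 + CI g s)) t))%C
    <= m / 2 * exp (K * Rabs t).
Proof.
intros HK HA Ha Hb Hab Hf Hg Hfg.
assert (Hm : 0 <= m).
{ generalize (Hfg 0) (Cmod_ge_0 (f 0 - g 0)); rewrite Rabs_R0, Rmult_0_r, exp_0; lra. }
assert (HA0 : 0 <= A) by (generalize (Hab 0) (Cmod_ge_0 (a 0)); lra).
assert (H1 : forall s, Cmod (CI f s - CI g s) <= m / K * exp (K * Rabs s)).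
{ intros s.
  assert (E := Cd_exp_bound (fun s => CI f s - CI g s)%C (fun s => f s - g s)%C m K HK).
  cbv beta in E; rewrite !CI_0 in E.
  replace (CI f s - CI g s)%C with (CI f s - CI g s - (0 - 0))%C by ring.
  apply E; [|exact Hfg].
  intros t; apply Cd_minus; now apply CI_deriv. }
intros t.
set (Ff := fun s => (b s + a s * (y0 + CI f s))%C).
set (Fg := fun s => (b s + a s * (y0 + CI g s))%C).
assert (E := Cd_exp_bound (fun s => CI Ff s - CI Fg s)%C (fun s => Ff s - Fg s)%C (A * (m / K)) K HK).
cbv beta in E; rewrite !CI_0 in E.
replace (z0 + CI Ff t - (z0 + CI Fg t))%C with (CI Ff t - CI Fg t - (0 - 0))%C by ring.
eapply Rle_trans; [apply E|].
- intros s; apply Cd_minus; apply CI_deriv; now apply picard_integrand_cont.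
- intros s; unfold Ff, Fg.
  replace (b s + a s * (y0 + CI f s) - (b s + a s * (y0 + CI g s)))%C
    with (a s * (CI f s - CI g s))%C by ring.
  rewrite Cmod_mult, Rmult_assoc.
  apply Rmult_le_compat; [apply Cmod_ge_0|apply Cmod_ge_0|apply Hab|apply H1].
- apply Rmult_le_compat_r; [left; apply exp_pos|].
  replace (A * (m / K) / K) with (2 * A * (m / 2) / (K * K)) by (field; lra).
  apply Rmult_le_reg_r with (K * K); [nra|].
  replace (2 * A * (m / 2) / (K * K) * (K * K)) with (2 * A * (m / 2)) by (field; nra).
  nra.
Qed.

Lemma picard_first (a b : R -> C) y0 z0 A K be :
  0 < K ->
  (forall t, Ccont a t) -> (forall t, Ccont b t) ->
  (forall t, Cmod (a t) <= A) ->
  (forall t, Cmod (b t) <= be * exp (K * Rabs t)) ->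
  forall t, Cmod (picard a b y0 z0 1 t - picard a b y0 z0 0 t)
    <= (Cmod z0 + (be + A * Cmod y0) / K) * exp (K * Rabs t).
Proof.
intros HK Ha Hb HA Hbe t; simpl.
assert (HA0 : 0 <= A) by (generalize (HA 0) (Cmod_ge_0 (a 0)); lra).
set (F := fun s => (b s + a s * (y0 + CI (fun _ => 0) s))%C).
assert (Z : forall s, CI (fun _ => RtoC 0) s = 0).
{ intros s; unfold CI; simpl; rewrite RInt_const; unfold scal; simpl; unfold mult; simpl.
  now rewrite Rmult_0_r. }
assert (E := Cd_exp_bound (CI F) F (be + A * Cmod y0) K HK).
replace (z0 + CI F t - 0)%C with (z0 + (CI F t - CI F 0))%C by (rewrite CI_0; ring).
eapply Rle_trans; [apply Cmod_triangle|].
rewrite Rmult_plus_distr_r; apply Rplus_le_compat.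
- rewrite <- (Rmult_1_r (Cmod z0)) at 1.
  apply Rmult_le_compat_l; [apply Cmod_ge_0|now apply exp_Rabs_ge1].
- apply E.
  + intros s; apply CI_deriv; intros; apply picard_integrand_cont; trivial.
    intros; apply Ccont_const.
  + intros s; unfold F; rewrite Z.
    eapply Rle_trans; [apply Cmod_triangle|].
    rewrite Rmult_plus_distr_r; apply Rplus_le_compat; [apply Hbe|].
    replace (y0 + 0)%C with y0 by ring; rewrite Cmod_mult.
    rewrite <- (Rmult_1_r (Cmod (a s) * Cmod y0)).
    apply Rmult_le_compat; [apply Rmult_le_pos; apply Cmod_ge_0|lra| |now apply exp_Rabs_ge1].
    apply Rmult_le_compat_r; [apply Cmod_ge_0|apply HA].
Qed.

(** The 4 is the geometric sum 2, once for the real and once for the imaginary part. *)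
Lemma picard_limit (a b : R -> C) y0 z0 A K be :
  0 < K -> 2 * A <= K * K ->
  (forall t, Ccont a t) -> (forall t, Ccont b t) ->
  (forall t, Cmod (a t) <= A) ->
  (forall t, Cmod (b t) <= be * exp (K * Rabs t)) ->
  forall n t, Cmod (picard a b y0 z0 n t - sol_z a b y0 z0 t)
    <= 4 * (Cmod z0 + (be + A * Cmod y0) / K) * (1 / 2) ^ n * exp (K * Rabs t).
Proof.
intros HK HAK Ha Hb HA Hbe.
set (M := Cmod z0 + (be + A * Cmod y0) / K).
assert (step : forall n t, Cmod (picard a b y0 z0 (S n) t - picard a b y0 z0 n t)
   <= M * (1 / 2) ^ n * exp (K * Rabs t)).
{ induction n as [|n IH]; intros t.
  - rewrite pow_O, Rmult_1_r; now apply picard_first.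
  - replace (M * (1 / 2) ^ S n) with (M * (1 / 2) ^ n / 2) by (simpl; field).
    apply (picard_contract a b (picard a b y0 z0 (S n)) (picard a b y0 z0 n) y0 z0 A);
      trivial; apply picard_cont; trivial. }
intros n t.
eapply Rle_trans; [apply Cmod_le_abs|].
assert (L1 := Lim_seq_geometric (fun n => fst (picard a b y0 z0 n t)) (M * exp (K * Rabs t))).
assert (L2 := Lim_seq_geometric (fun n => snd (picard a b y0 z0 n t)) (M * exp (K * Rabs t))).
cbv beta in L1, L2.
assert (forall n, Rabs (fst (picard a b y0 z0 (S n) t) - fst (picard a b y0 z0 n t))
  <= M * exp (K * Rabs t) * (1 / 2) ^ n).
{ intros k; replace (M * exp (K * Rabs t) * (1 / 2) ^ k)
    with (M * (1 / 2) ^ k * exp (K * Rabs t)) by ring.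
  eapply Rle_trans; [|apply step]; eapply Rle_trans; [|apply fst_le_Cmod].
  right; f_equal. }
assert (forall n, Rabs (snd (picard a b y0 z0 (S n) t) - snd (picard a b y0 z0 n t))
  <= M * exp (K * Rabs t) * (1 / 2) ^ n).
{ intros k; replace (M * exp (K * Rabs t) * (1 / 2) ^ k)
    with (M * (1 / 2) ^ k * exp (K * Rabs t)) by ring.
  eapply Rle_trans; [|apply step]; eapply Rle_trans; [|apply snd_le_Cmod].
  right; f_equal. }
specialize (L1 H n); specialize (L2 H0 n).
simpl; unfold Rminus in *; lra.
Qed.

Lemma continuous_locally_uniform_limit (f : nat -> R -> R) (g : R -> R) (t c : R) :
  (forall n s, continuous (f n) s) ->
  (forall n s, Rabs (s - t) < 1 -> Rabs (f n s - g s) <= c * (1 / 2) ^ n) ->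
  continuous g t.
Proof.
intros Hf Hfg; apply filterlim_locally; intros eps.
destruct (pow_half_small c (eps / 3)) as [n Hn]; [generalize (cond_pos eps); lra|].
assert (Hc := Hf n t); apply filterlim_locally with (eps := pos_div_2 (pos_div_2 eps)) in Hc.
generalize (filter_and _ _ Hc (locally_ball t (mkposreal 1 Rlt_0_1))); apply filter_imp.
intros s [B1 B2].
assert (Hs : Rabs (s - t) < 1) by exact B2.
assert (B3 : Rabs (f n s - f n t) < eps / 2 / 2) by exact B1.
change (Rabs (g s - g t) < eps).
assert (A1 := Hfg n s Hs); assert (A2 := Hfg n t).
rewrite Rminus_diag, Rabs_R0 in A2; specialize (A2 Rlt_0_1).
generalize (cond_pos eps).
apply Rabs_le_between in A1, A2; apply Rabs_lt_between in B3.
intros; apply Rabs_lt_between; lra.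
Qed.

Lemma sol_z_cont (a b : R -> C) y0 z0 A K be :
  0 < K -> 2 * A <= K * K ->
  (forall t, Ccont a t) -> (forall t, Ccont b t) ->
  (forall t, Cmod (a t) <= A) ->
  (forall t, Cmod (b t) <= be * exp (K * Rabs t)) ->
  forall t, Ccont (sol_z a b y0 z0) t.
Proof.
intros HK HAK Ha Hb HA Hbe t.
assert (L := picard_limit a b y0 z0 A K be HK HAK Ha Hb HA Hbe).
set (M := 4 * (Cmod z0 + (be + A * Cmod y0) / K)) in *.
assert (HM : 0 <= M).
{ generalize (L 0%nat 0) (Cmod_ge_0 (picard a b y0 z0 0 0 - sol_z a b y0 z0 0)).
  rewrite Rabs_R0, Rmult_0_r, exp_0, pow_O; lra. }
assert (L' : forall n s, Rabs (s - t) < 1 ->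
  Cmod (picard a b y0 z0 n s - sol_z a b y0 z0 s)
    <= M * exp (K * (Rabs t + 1)) * (1 / 2) ^ n).
{ intros n s Hs; eapply Rle_trans; [apply L|].
  replace (M * exp (K * (Rabs t + 1)) * (1 / 2) ^ n)
    with (M * (1 / 2) ^ n * exp (K * (Rabs t + 1))) by ring.
  apply Rmult_le_compat_l.
  - apply Rmult_le_pos; [assumption|apply pow_le; lra].
  - apply exp_le_mono, Rmult_le_compat_l; [lra|].
    replace s with (s - t + t) by ring.
    eapply Rle_trans; [apply Rabs_triang|]; lra. }
split.
- apply (continuous_locally_uniform_limit (fun n s => fst (picard a b y0 z0 n s)) _ t
    (M * exp (K * (Rabs t + 1)))).
  + intros n s; exact (proj1 (picard_cont a b y0 z0 Ha Hb n s)).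
  + intros n s Hs; eapply Rle_trans; [|exact (L' n s Hs)].
    eapply Rle_trans; [|apply fst_le_Cmod]; right; f_equal.
- apply (continuous_locally_uniform_limit (fun n s => snd (picard a b y0 z0 n s)) _ t
    (M * exp (K * (Rabs t + 1)))).
  + intros n s; exact (proj2 (picard_cont a b y0 z0 Ha Hb n s)).
  + intros n s Hs; eapply Rle_trans; [|exact (L' n s Hs)].
    eapply Rle_trans; [|apply snd_le_Cmod]; right; f_equal.
Qed.

(** Both sides lie within a multiple of [(1 / 2) ^ n] of the iterate of index [S n], the right-hand
    side because the Picard map contracts. *)
Lemma sol_z_eq (a b : R -> C) y0 z0 A K be :
  0 < K -> 2 * A <= K * K ->
  (forall t, Ccont a t) -> (forall t, Ccont b t) ->
  (forall t, Cmod (a t) <= A) ->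
  (forall t, Cmod (b t) <= be * exp (K * Rabs t)) ->
  forall t, sol_z a b y0 z0 t
    = (z0 + CI (fun s => b s + a s * sol_y a b y0 z0 s) t)%C.
Proof.
intros HK HAK Ha Hb HA Hbe t.
assert (L := picard_limit a b y0 z0 A K be HK HAK Ha Hb HA Hbe).
assert (Cz := sol_z_cont a b y0 z0 A K be HK HAK Ha Hb HA Hbe).
set (M := 4 * (Cmod z0 + (be + A * Cmod y0) / K)) in *.
set (rhs := (z0 + CI (fun s => b s + a s * sol_y a b y0 z0 s) t)%C).
assert (E : Cmod (sol_z a b y0 z0 t - rhs) <= 0).
{ apply le_0_of_pow_half with (M * exp (K * Rabs t)); intros n.
  replace (sol_z a b y0 z0 t - rhs)%C with
    ((picard a b y0 z0 (S n) t - rhs) - (picard a b y0 z0 (S n) t - sol_z a b y0 z0 t))%C by ring.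
  eapply Rle_trans; [apply Cmod_minus_le|].
  assert (P1 := L (S n) t).
  assert (P2 := picard_contract a b (picard a b y0 z0 n) (sol_z a b y0 z0) y0 z0 A K
    (M * (1 / 2) ^ n) HK HAK Ha Hb HA (picard_cont a b y0 z0 Ha Hb n) Cz (L n) t).
  change (Cmod (picard a b y0 z0 (S n) t - rhs) <= M * (1 / 2) ^ n / 2 * exp (K * Rabs t)) in P2.
  simpl pow in P1.
  eapply Rle_trans; [apply Rplus_le_compat; [exact P2|exact P1]|].
  right; field. }
assert (Z : (sol_z a b y0 z0 t - rhs)%C = 0)
  by (apply Cmod_eq_0; generalize (Cmod_ge_0 (sol_z a b y0 z0 t - rhs)); lra).
replace (sol_z a b y0 z0 t) with (sol_z a b y0 z0 t - rhs + rhs)%C by ring.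
rewrite Z; ring.
Qed.

(** The forcing [b] may grow like the weight that also bounds the solution, with the same [K]. A
    solution can therefore serve as the forcing of the next equation, which the Taylor coefficients
    in [lam] require. *)
Theorem linear_ode_exists (a b : R -> C) y0 z0 A K be :
  0 < K -> 2 * A <= K * K ->
  (forall t, Ccont a t) -> (forall t, Ccont b t) ->
  (forall t, Cmod (a t) <= A) ->
  (forall t, Cmod (b t) <= be * exp (K * Rabs t)) ->
  (forall t, Cd (sol_y a b y0 z0) t (sol_z a b y0 z0 t)) /\
  (forall t, Cd (sol_z a b y0 z0) t (a t * sol_y a b y0 z0 t + b t)%C) /\
  sol_y a b y0 z0 0 = y0 /\ sol_z a b y0 z0 0 = z0 /\
  (forall t, Cmod (sol_z a b y0 z0 t)
     <= 4 * (Cmod z0 + (be + A * Cmod y0) / K) * exp (K * Rabs t)) /\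
  (forall t, Cmod (sol_y a b y0 z0 t)
     <= (Cmod y0 + 4 * (Cmod z0 + (be + A * Cmod y0) / K) / K) * exp (K * Rabs t)).
Proof.
intros HK HAK Ha Hb HA Hbe.
assert (Cz := sol_z_cont a b y0 z0 A K be HK HAK Ha Hb HA Hbe).
assert (Ez := sol_z_eq a b y0 z0 A K be HK HAK Ha Hb HA Hbe).
assert (L := picard_limit a b y0 z0 A K be HK HAK Ha Hb HA Hbe).
assert (Dy : forall t, Cd (sol_y a b y0 z0) t (sol_z a b y0 z0 t)).
{ intros t; unfold sol_y; eapply Cd_val.
  - apply Cd_plus; [apply Cd_const|now apply CI_deriv].
  - ring. }
assert (Bz : forall t, Cmod (sol_z a b y0 z0 t)
     <= 4 * (Cmod z0 + (be + A * Cmod y0) / K) * exp (K * Rabs t)).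
{ intros t; specialize (L 0%nat t); simpl in L.
  rewrite Rmult_1_r in L; eapply Rle_trans; [|exact L].
  rewrite Cmod_minus_sym; right; f_equal; ring. }
assert (Dz : forall t, Cd (sol_z a b y0 z0) t (a t * sol_y a b y0 z0 t + b t)%C).
{ intros t; eapply Cd_ext; [intros s; symmetry; apply Ez|].
  apply (Cd_val _ _ (0 + (b t + a t * sol_y a b y0 z0 t))%C); [|ring].
  apply Cd_plus; [apply Cd_const|].
  apply (CI_deriv (fun s => b s + a s * sol_y a b y0 z0 s)%C).
  intros s; apply Ccont_plus; [apply Hb|apply Ccont_mult; [apply Ha|eapply Cd_cont, Dy]]. }
split; [exact Dy|]; split; [exact Dz|]; split; [|split; [|split; [exact Bz|]]].
- unfold sol_y; rewrite CI_0; ring.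
- rewrite Ez, CI_0; ring.
- intros t; assert (E := Cd_exp_bound _ _ _ K HK Dy Bz t).
  replace (sol_y a b y0 z0 t) with
    (y0 + (sol_y a b y0 z0 t - sol_y a b y0 z0 0))%C
    by (unfold sol_y at 2; rewrite CI_0; ring).
  eapply Rle_trans; [apply Cmod_triangle|].
  rewrite Rmult_plus_distr_r; apply Rplus_le_compat; [|exact E].
  rewrite <- (Rmult_1_r (Cmod y0)) at 1.
  apply Rmult_le_compat_l; [apply Cmod_ge_0|now apply exp_Rabs_ge1].
Qed.

(** Let [m] be the maximum of [|z| exp (- K s)] on the interval. Integrating twice from zero data
    gives [m <= A m / K^2], and [K^2 > A] forces [m = 0]. *)
Lemma linear_ode_unique (a y z : R -> C) A T :
  0 <= T ->
  (forall t, 0 <= t <= T -> Cmod (a t) <= A) ->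
  (forall t, 0 <= t <= T -> Cd y t (z t)) ->
  (forall t, 0 <= t <= T -> Cd z t (a t * y t)%C) ->
  y 0 = 0 -> z 0 = 0 -> forall t, 0 <= t <= T -> y t = 0 /\ z t = 0.
Proof.
intros HT HA Hy Hz Y0 Z0.
assert (HA0 : 0 <= A) by (generalize (HA 0 (conj (Rle_refl 0) HT)) (Cmod_ge_0 (a 0)); lra).
set (K := 1 + 2 * A).
assert (HK : 0 < K) by (unfold K; lra).
assert (HAK : 2 * A <= K * K) by (unfold K; nra).
destruct (continuity_ab_maj (fun s => Cmod (z s) * exp (- (K * s))) 0 T HT) as [p [Hp Hp2]].
{ intros s Hs; apply continuity_pt_filterlim.
  apply (continuous_mult (fun s => Cmod (z s)) (fun s => exp (- (K * s)))).
  - eapply Ccont_Cmod, Cd_cont, Hz, Hs.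
  - apply (ex_derive_continuous (fun s => exp (- (K * s)))); auto_derive; trivial. }
set (m := Cmod (z p) * exp (- (K * p))) in *.
assert (Ee : forall s, exp (- (K * s)) * exp (K * s) = 1).
{ intros s; rewrite <- exp_plus, <- exp_0; f_equal; ring. }
assert (B1 : forall s, 0 <= s <= T -> Cmod (z s) <= m * exp (K * s)).
{ intros s Hs; specialize (Hp s Hs).
  apply Rmult_le_compat_r with (r := exp (K * s)) in Hp; [|left; apply exp_pos].
  rewrite Rmult_assoc, Ee in Hp; lra. }
assert (Hm : 0 <= m) by (apply Rmult_le_pos; [apply Cmod_ge_0|left; apply exp_pos]).
assert (HmK : 0 <= m / K) by (apply Rdiv_le_0_compat; lra).
assert (B2 : forall s, 0 <= s <= T -> Cmod (y s) <= m / K * exp (K * s)).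
{ intros s Hs; replace (y s) with (y s - y 0)%C by (rewrite Y0; ring).
  assert (B : Cmod (y s - y 0) <= m / K * exp (K * s) - m / K * exp (K * 0)).
  { apply (Cd_mean_value y z (fun s => m / K * exp (K * s)) (fun s => m * exp (K * s))).
    - lra.
    - intros r Hr; apply Hy; lra.
    - intros r _; auto_derive; trivial; field; lra.
    - intros r Hr; apply B1; lra. }
  rewrite Rmult_0_r, exp_0 in B; lra. }
assert (B3 : Cmod (z p) <= A * (m / K) / K * exp (K * p)).
{ replace (z p) with (z p - z 0)%C by (rewrite Z0; ring).
  assert (HmKK : 0 <= A * (m / K) / K) by (apply Rdiv_le_0_compat; nra).
  assert (B : Cmod (z p - z 0) <= A * (m / K) / K * exp (K * p) - A * (m / K) / K * exp (K * 0)).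
  { apply (Cd_mean_value z (fun s => a s * y s)%C (fun s => A * (m / K) / K * exp (K * s))
      (fun s => A * (m / K) * exp (K * s))).
    - lra.
    - intros r Hr; apply Hz; lra.
    - intros r _; auto_derive; trivial; field; lra.
    - intros r Hr; rewrite Cmod_mult, Rmult_assoc.
      apply Rmult_le_compat; [apply Cmod_ge_0|apply Cmod_ge_0|apply HA; lra|apply B2; lra]. }
  rewrite Rmult_0_r, exp_0 in B; lra. }
assert (Em : m <= A * (m / K) / K).
{ unfold m at 1. apply Rmult_le_compat_r with (r := exp (- (K * p))) in B3; [|left; apply exp_pos].
  rewrite Rmult_assoc, (Rmult_comm (exp (K * p))), Ee in B3; lra. }
assert (m = 0).
{ apply Rmult_le_compat_r with (r := K * K) in Em; [|nra].
  replace (A * (m / K) / K * (K * K)) with (A * m) in Em by (field; lra).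
  unfold K in *; nra. }
intros t Ht; split; apply Cmod_eq_0.
- generalize (B2 t Ht) (Cmod_ge_0 (y t)); rewrite H; unfold Rdiv; rewrite !Rmult_0_l; lra.
- generalize (B1 t Ht) (Cmod_ge_0 (z t)); rewrite H; lra.
Qed.

(** * Local power series and the maximum principle *)

(* [F n] is the [n]-th Taylor quotient of [F 0], so that [F n 0] is the [n]-th
   Taylor coefficient; this encodes convergent power series without series. *)
Definition taylor_seq (d B M : R) (F : nat -> C -> C) : Prop :=
  forall n w, Cmod w <= d ->
    F n w = (F n (RtoC 0) + w * F (S n) w)%C /\ Cmod (F n w) <= M * B ^ n.

Definition analytic_at (f : C -> C) (z : C) : Prop :=
  exists d B M F, 0 < d /\ 0 <= B /\ taylor_seq d B M F /\
    forall w, Cmod w <= d -> f (z + w)%C = F O w.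

(** Holomorphy of [g] near [z], stated as [g = U / F] with [F] nonzero at the centre, so that no
    power series has to be inverted. *)
Definition local_quotient (g : C -> C) (z : C) : Prop :=
  exists d B M U F, 0 < d /\ 0 <= B /\ taylor_seq d B M U /\ taylor_seq d B M F /\
    F O (RtoC 0) <> RtoC 0 /\
    forall w, Cmod w <= d -> (g (z + w) * F O w)%C = U O w.

Lemma taylor_seq_M d B M F : 0 <= d -> taylor_seq d B M F -> 0 <= M.
Proof.
intros Hd H; destruct (H O (RtoC 0)) as [_ H1]; [rewrite Cmod_0; lra|].
generalize (Cmod_ge_0 (F O (RtoC 0))); simpl in H1; lra.
Qed.

Lemma taylor_seq_weaken d B M d' B' M' F :
  0 <= d -> 0 <= B -> d' <= d -> B <= B' -> M <= M' ->
  taylor_seq d B M F -> taylor_seq d' B' M' F.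
Proof.
intros Hd HB Hd' HB' HM' H n w Hw.
assert (HM := taylor_seq_M d B M F Hd H).
destruct (H n w) as [H1 H2]; [lra|]; split; [exact H1|].
eapply Rle_trans; [exact H2|].
apply Rmult_le_compat; trivial; [now apply pow_le|now apply pow_incr].
Qed.

Lemma taylor_seq_lin d B M1 M2 F G c :
  taylor_seq d B M1 F -> taylor_seq d B M2 G ->
  taylor_seq d B (M1 + Cmod c * M2) (fun n w => F n w + c * G n w)%C.
Proof.
intros HF HG n w Hw; destruct (HF n w Hw) as [F1 F2], (HG n w Hw) as [G1 G2]; split.
- rewrite F1 at 1; rewrite G1 at 1; ring.
- eapply Rle_trans; [apply Cmod_triangle|].
  rewrite Cmod_mult, Rmult_plus_distr_r, Rmult_assoc.
  apply Rplus_le_compat; [assumption|].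
  apply Rmult_le_compat_l; [apply Cmod_ge_0|assumption].
Qed.

Lemma taylor_seq_shift d B M F :
  0 <= d -> taylor_seq d B M F -> taylor_seq d B (M * B) (fun n => F (S n)).
Proof.
intros Hd H n w Hw; destruct (H (S n) w Hw) as [H1 H2]; split; [exact H1|].
eapply Rle_trans; [exact H2|]; right; simpl; ring.
Qed.

(* [prod_tail F G n m] is [\sum_(i < n) F i 0 * G (n - i + m)]. *)
Fixpoint prod_tail (F G : nat -> C -> C) (n : nat) : nat -> C -> C :=
  match n with
  | O => fun _ _ => RtoC 0
  | S n => fun m w => (prod_tail F G n (S m) w + F n (RtoC 0) * G (S m) w)%C
  end.

Lemma prod_tail_eq d B M F G n m w :
  taylor_seq d B M G -> Cmod w <= d ->
  prod_tail F G n m w = (prod_tail F G n m (RtoC 0) + w * prod_tail F G n (S m) w)%C.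
Proof.
intros HG Hw; revert m; induction n as [|n IH]; intros m; simpl.
- ring.
- rewrite (IH (S m)); destruct (HG (S m) w Hw) as [E _]; rewrite E at 1; ring.
Qed.

Lemma prod_tail_bound d B M F G n m w :
  0 <= d -> 0 <= B -> taylor_seq d B M F -> taylor_seq d B M G -> Cmod w <= d ->
  Cmod (prod_tail F G n m w) <= INR n * (M * M * B ^ (n + m)).
Proof.
intros Hd HB HF HG Hw; revert m; induction n as [|n IH]; intros m.
- simpl; rewrite Cmod_0; lra.
- cbn [prod_tail]; rewrite S_INR, Rmult_plus_distr_r, Rmult_1_l.
  eapply Rle_trans; [apply Cmod_triangle|]; apply Rplus_le_compat.
  + replace (S n + m)%nat with (n + S m)%nat by lia; apply IH.
  + rewrite Cmod_mult.
    replace (M * M * B ^ (S n + m)) with ((M * B ^ n) * (M * B ^ S m))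
      by (replace (S n + m)%nat with (n + S m)%nat by lia; rewrite pow_add; ring).
    apply Rmult_le_compat; try apply Cmod_ge_0.
    * apply (HF n (RtoC 0)); rewrite Cmod_0; lra.
    * now apply HG.
Qed.

(** The [n]-th Taylor quotient of the product is [F_n G_0] plus the sum over [i < n] of
    [F_i(0) G_(n-i)]. Each of these [n + 1] terms is at most [M^2 B^n], and [n + 1 <= 2^n] explains
    the ratio [2 * B]. *)
Lemma taylor_seq_mult d B M F G :
  0 <= d -> 0 <= B -> taylor_seq d B M F -> taylor_seq d B M G ->
  taylor_seq d (2 * B) (M * M)
    (fun n w => F n w * G O w + prod_tail F G n O w)%C.
Proof.
intros Hd HB HF HG n w Hw; split.
- rewrite (prod_tail_eq d B M F G n O w HG Hw); cbn [prod_tail].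
  destruct (HF n w Hw) as [E1 _]; destruct (HG O w Hw) as [E2 _].
  set (g1 := G 1%nat w) in *; set (f1 := F (S n) w) in *; rewrite E1 at 1.
  rewrite Cmult_plus_distr_r, E2 at 1.
  rewrite E2; ring.
- eapply Rle_trans; [apply Cmod_triangle|].
  assert (H1 : Cmod (F n w * G O w) <= M * M * B ^ n).
  { rewrite Cmod_mult.
    replace (M * M * B ^ n) with (M * B ^ n * (M * B ^ 0)) by (simpl; ring).
    apply Rmult_le_compat; try apply Cmod_ge_0; [now apply HF|now apply HG]. }
  assert (H2 := prod_tail_bound d B M F G n O w Hd HB HF HG Hw).
  rewrite Nat.add_0_r in H2.
  rewrite Rpow_mult_distr.
  assert (HM : 0 <= M * M * B ^ n)
    by (apply Rmult_le_pos; [apply Rle_0_sqr|now apply pow_le]).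
  assert (H3 : INR n + 1 <= 2 ^ n).
  { clear; induction n as [|n IH]; [simpl; lra|].
    rewrite S_INR; simpl; generalize (pos_INR n); lra. }
  eapply Rle_trans; [apply Rplus_le_compat; [exact H1|exact H2]|].
  nra.
Qed.

Lemma analytic_at_common f g z :
  analytic_at f z -> analytic_at g z ->
  exists d B M F G, 0 < d /\ 0 <= B /\ taylor_seq d B M F /\ taylor_seq d B M G /\
    forall w, Cmod w <= d -> f (z + w)%C = F O w /\ g (z + w)%C = G O w.
Proof.
intros (d1 & B1 & M1 & F & Hd1 & HB1 & HF & EF) (d2 & B2 & M2 & G & Hd2 & HB2 & HG & EG).
assert (HM1 := taylor_seq_M d1 B1 M1 F (Rlt_le _ _ Hd1) HF).
assert (HM2 := taylor_seq_M d2 B2 M2 G (Rlt_le _ _ Hd2) HG).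
assert (m1 := Rmin_l d1 d2); assert (m2 := Rmin_r d1 d2).
exists (Rmin d1 d2), (B1 + B2), (M1 + M2), F, G.
split; [now apply Rmin_pos|]; split; [lra|]; split; [|split].
- apply (taylor_seq_weaken d1 B1 M1); trivial; lra.
- apply (taylor_seq_weaken d2 B2 M2); trivial; lra.
- intros w Hw; split; [apply EF|apply EG]; lra.
Qed.

Lemma analytic_at_lin f g c z :
  analytic_at f z -> analytic_at g z -> analytic_at (fun z => f z + c * g z)%C z.
Proof.
intros Hf Hg.
destruct (analytic_at_common f g z Hf Hg) as (d & B & M & F & G & Hd & HB & HF & HG & E).
exists d, B, (M + Cmod c * M), (fun n w => F n w + c * G n w)%C.
split; [assumption|]; split; [assumption|]; split; [now apply taylor_seq_lin|].
intros w Hw; destruct (E w Hw) as [-> ->]; reflexivity.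
Qed.

Lemma analytic_at_mult f g z :
  analytic_at f z -> analytic_at g z -> analytic_at (fun z => f z * g z)%C z.
Proof.
intros Hf Hg.
destruct (analytic_at_common f g z Hf Hg) as (d & B & M & F & G & Hd & HB & HF & HG & E).
exists d, (2 * B), (M * M), (fun n w => F n w * G O w + prod_tail F G n O w)%C.
split; [assumption|]; split; [lra|]; split; [apply taylor_seq_mult; trivial; lra|].
intros w Hw; destruct (E w Hw) as [-> ->]; simpl; ring.
Qed.

Lemma analytic_at_const c z : analytic_at (fun _ => c) z.
Proof.
exists 1, 0, (Cmod c), (fun n _ => match n with O => c | S _ => RtoC 0 end).
split; [lra|]; split; [lra|]; split; [|trivial].
intros [|n] w Hw; split; simpl.
- ring.
- lra.
- ring.
- rewrite Cmod_0; lra.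
Qed.

Lemma taylor_seq_nonzero d B M F :
  0 < d -> 0 <= B -> taylor_seq d B M F -> F O (RtoC 0) <> RtoC 0 ->
  exists d', 0 < d' <= d /\
    forall w, Cmod w <= d' -> Cmod (F O (RtoC 0)) / 2 <= Cmod (F O w).
Proof.
intros Hd HB HF H0.
assert (HM := taylor_seq_M d B M F (Rlt_le _ _ Hd) HF).
assert (Hc : 0 < Cmod (F O (RtoC 0))) by now apply Cmod_gt_0.
assert (HMB : 0 <= M * B) by now apply Rmult_le_pos.
exists (Rmin d (Cmod (F O (RtoC 0)) / 2 / (M * B + 1))).
assert (Hp : 0 < Cmod (F O (RtoC 0)) / 2 / (M * B + 1)) by (apply Rdiv_lt_0_compat; lra).
split; [split; [now apply Rmin_pos|apply Rmin_l]|].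
intros w Hw.
assert (Hw1 : Cmod w <= d) by (eapply Rle_trans; [exact Hw|apply Rmin_l]).
assert (Hw2 : Cmod w <= Cmod (F O (RtoC 0)) / 2 / (M * B + 1))
  by (eapply Rle_trans; [exact Hw|apply Rmin_r]).
destruct (HF O w Hw1) as [E _]; destruct (HF 1%nat w Hw1) as [_ E1].
apply Rmult_le_compat_r with (r := M * B + 1) in Hw2; [|lra].
replace (Cmod (F O (RtoC 0)) / 2 / (M * B + 1) * (M * B + 1))
  with (Cmod (F O (RtoC 0)) / 2) in Hw2 by (field; lra).
assert (E2 : Cmod (F O (RtoC 0)) <= Cmod (F O w) + Cmod w * Cmod (F 1%nat w)).
{ rewrite <- Cmod_mult.
  replace (F O (RtoC 0)) with (F O w - w * F 1%nat w)%C by (rewrite E; ring).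
  apply Cmod_minus_le. }
rewrite pow_1 in E1; generalize (Cmod_ge_0 w); intros.
assert (Cmod w * Cmod (F 1%nat w) <= Cmod w * (M * B)) by (now apply Rmult_le_compat_l).
lra.
Qed.

(** With [V = U - g z * F] the increment of [g] is [V / F], where [V] vanishes at the centre and [F]
    stays away from 0. *)
Lemma local_quotient_diff g z :
  local_quotient g z ->
  exists d B M V F e, 0 < d /\ 0 <= B /\ 0 < e /\ taylor_seq d B M V /\ taylor_seq d B M F /\
    V O (RtoC 0) = RtoC 0 /\
    (forall w, Cmod w <= d -> e <= Cmod (F O w)) /\
    forall w, Cmod w <= d -> ((g (z + w) - g z) * F O w)%C = V O w.
Proof.
intros (d & B & M & U & F & Hd & HB & HU & HF & F0 & E).
destruct (taylor_seq_nonzero d B M F Hd HB HF F0) as (d' & [Hd' Hd'd] & Hn).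
assert (HM := taylor_seq_M d B M F (Rlt_le _ _ Hd) HF).
set (c := (- g z)%C).
assert (HcM : 0 <= Cmod c * M) by (apply Rmult_le_pos; [apply Cmod_ge_0|assumption]).
exists d', B, (M + Cmod c * M), (fun n w => U n w + c * F n w)%C, F, (Cmod (F O (RtoC 0)) / 2).
split; [assumption|]; split; [assumption|]; split.
{ assert (0 < Cmod (F O (RtoC 0))) by now apply Cmod_gt_0. lra. }
split; [|split; [|split; [|split]]].
- apply (taylor_seq_weaken d B (M + Cmod c * M)); try lra; now apply taylor_seq_lin.
- apply (taylor_seq_weaken d B M); trivial; lra.
- rewrite <- E by (rewrite Cmod_0; lra).
  replace (z + 0)%C with z by ring; unfold c; ring.
- exact Hn.
- intros w Hw; rewrite <- E by lra; unfold c; ring.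
Qed.

Lemma local_quotient_cont g z :
  local_quotient g z ->
  forall eps, 0 < eps -> exists de, 0 < de /\
    forall w, Cmod w < de -> Cmod (g (z + w) - g z)%C < eps.
Proof.
intros H eps Heps.
destruct (local_quotient_diff g z H) as (d & B & M & V & F & e & Hd & HB & He & HV & _ & V0 & Hn & E).
assert (HM := taylor_seq_M d B M V (Rlt_le _ _ Hd) HV).
assert (HMB : 0 <= M * B) by now apply Rmult_le_pos.
exists (Rmin d (eps * e / (M * B + 1))); split.
{ apply Rmin_pos; [assumption|]; apply Rdiv_lt_0_compat; [nra|lra]. }
intros w Hw.
assert (Hw1 : Cmod w <= d) by (left; eapply Rlt_le_trans; [exact Hw|apply Rmin_l]).
assert (Hw2 : Cmod w < eps * e / (M * B + 1)) by (eapply Rlt_le_trans; [exact Hw|apply Rmin_r]).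
apply Rmult_lt_compat_r with (r := M * B + 1) in Hw2; [|lra].
replace (eps * e / (M * B + 1) * (M * B + 1)) with (eps * e) in Hw2 by (field; lra).
assert (E1 : Cmod (g (z + w) - g z)%C * Cmod (F O w) <= Cmod w * (M * B)).
{ rewrite <- Cmod_mult, E by assumption.
  destruct (HV O w Hw1) as [-> _]; rewrite V0.
  replace (0 + w * V 1%nat w)%C with (w * V 1%nat w)%C by ring.
  rewrite Cmod_mult; apply Rmult_le_compat_l; [apply Cmod_ge_0|].
  destruct (HV 1%nat w Hw1) as [_ E1]; now rewrite pow_1 in E1. }
specialize (Hn w Hw1).
generalize (Cmod_ge_0 w) (Cmod_ge_0 (g (z + w) - g z)%C); intros P1 P2.
apply Rmult_lt_reg_r with e; [assumption|]; nra.
Qed.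

Lemma Cpow_angle (x : R) n : ((cos x, sin x) ^ n)%C = (cos (INR n * x), sin (INR n * x)).
Proof.
induction n as [|n IH].
- simpl; rewrite Rmult_0_l, cos_0, sin_0; reflexivity.
- rewrite S_INR, Rmult_plus_distr_r, Rmult_1_l, cos_plus, sin_plus.
  cbn [Cpow]; rewrite IH; unfold Cmult; simpl; f_equal; ring.
Qed.

(** Polar form: the angle is plus or minus the arccosine of the real part, with the sign of the
    imaginary part, and is divided by [k]. *)
Lemma Croot_unit (u : C) (k : nat) :
  Cmod u = 1 -> (0 < k)%nat -> exists v, Cmod v = 1 /\ (v ^ k)%C = u.
Proof.
intros Hu Hk.
assert (E : fst u ^ 2 + snd u ^ 2 = 1).
{ generalize (Cmod2_alt u); rewrite Hu; unfold Re, Im; lra. }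
assert (B : -1 <= fst u <= 1) by nra.
assert (exists x, u = (cos x, sin x)) as [x Hx].
{ assert (Es : sin (acos (fst u)) = Rabs (snd u)).
  { rewrite sin_acos by assumption; rewrite <- sqrt_Rsqr_abs; f_equal; unfold Rsqr; lra. }
  destruct (Rle_dec 0 (snd u)) as [P|N].
  - exists (acos (fst u)); rewrite cos_acos, Es, Rabs_pos_eq by assumption.
    now destruct u.
  - exists (- acos (fst u)); rewrite cos_neg, sin_neg, cos_acos, Es by assumption.
    rewrite Rabs_left by lra; rewrite Ropp_involutive; now destruct u. }
exists (cos (x / INR k), sin (x / INR k)); split.
- unfold Cmod; simpl.
  replace (cos (x / INR k) * (cos (x / INR k) * 1) + sin (x / INR k) * (sin (x / INR k) * 1))
    with 1; [apply sqrt_1|].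
  generalize (sin2_cos2 (x / INR k)); unfold Rsqr; lra.
- rewrite Cpow_angle, Hx.
  replace (INR k * (x / INR k)) with x; [reflexivity|].
  field; apply not_0_INR; lia.
Qed.

Lemma Csqrt_exists (z : C) : exists r, (r * r)%C = z.
Proof.
destruct (classic (z = 0)) as [->|Hz]; [exists (RtoC 0); ring|].
assert (P : 0 < Cmod z) by now apply Cmod_gt_0.
assert (HC : RtoC (Cmod z) <> RtoC 0) by (intros E; apply RtoC_inj in E; lra).
destruct (Croot_unit (z / RtoC (Cmod z))%C 2) as (v & _ & Hv).
- rewrite Cmod_div, Cmod_R, Rabs_pos_eq by (trivial; lra); field; lra.
- lia.
- exists (RtoC (sqrt (Cmod z)) * v)%C.
  replace (RtoC (sqrt (Cmod z)) * v * (RtoC (sqrt (Cmod z)) * v))%C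
    with (RtoC (sqrt (Cmod z)) * RtoC (sqrt (Cmod z)) * (v ^ 2))%C by (simpl; ring).
  rewrite <- RtoC_mult, sqrt_sqrt, Hv by lra; field; exact HC.
Qed.

(* If [g] is not constant, its leading term [c w^k] can be aligned with [g z]. *)
Lemma local_max_const g z r :
  local_quotient g z -> 0 < r ->
  (forall w, Cmod w < r -> Cmod (g (z + w)%C) <= Cmod (g z)) ->
  exists d, 0 < d /\ forall w, Cmod w < d -> g (z + w)%C = g z.
Proof.
intros H Hr Hmax.
destruct (local_quotient_diff g z H) as (d & B & M & V & F & e & Hd & HB & He & HV & HF & V0 & Hn & E).
assert (HM := taylor_seq_M d B M V (Rlt_le _ _ Hd) HV).
assert (Fnz : forall w, Cmod w <= d -> F O w <> 0).
{ intros w Hw; apply Cmod_gt_0; specialize (Hn w Hw); lra. }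
(* As long as the Taylor coefficients vanish, powers of [w] factor out of [V]. *)
assert (fact : forall k, (forall j, (j < k)%nat -> V j (RtoC 0) = RtoC 0) ->
  forall w, Cmod w <= d -> V O w = (w ^ k * V k w)%C).
{ induction k as [|k IH]; intros Hk w Hw.
  - simpl; ring.
  - rewrite IH by (trivial; intros; apply Hk; lia).
    destruct (HV k w Hw) as [-> _]; rewrite (Hk k) by lia; simpl; ring. }
destruct (classic (forall k, V k (RtoC 0) = RtoC 0)) as [All|Ex].
(* All coefficients vanish: [|V|] is at most [M (|w| B)^n] for every [n], and the radius makes
   [|w| B <= 1 / 2]. *)
- exists (Rmin d (1 / 2 / (B + 1))); split.
  { apply Rmin_pos; [assumption|]; apply Rdiv_lt_0_compat; lra. }
  intros w Hw.
  assert (Hw1 : Cmod w <= d) by (left; eapply Rlt_le_trans; [exact Hw|apply Rmin_l]).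
  assert (Hw2 : Cmod w < 1 / 2 / (B + 1)) by (eapply Rlt_le_trans; [exact Hw|apply Rmin_r]).
  apply Rmult_lt_compat_r with (r := B + 1) in Hw2; [|lra].
  replace (1 / 2 / (B + 1) * (B + 1)) with (1 / 2) in Hw2 by (field; lra).
  assert (Z : Cmod (V O w) <= 0).
  { apply le_0_of_pow_half with M; intros n.
    rewrite (fact n) by trivial; rewrite Cmod_mult, Cmod_pow.
    destruct (HV n w Hw1) as [_ Hb].
    eapply Rle_trans; [apply Rmult_le_compat_l; [apply pow_le, Cmod_ge_0|exact Hb]|].
    replace (Cmod w ^ n * (M * B ^ n)) with (M * (Cmod w * B) ^ n)
      by (rewrite Rpow_mult_distr; ring).
    apply Rmult_le_compat_l; [assumption|].
    apply pow_incr; generalize (Cmod_ge_0 w); intros; split; [nra|nra]. }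
  assert (Z' : V O w = 0) by (apply Cmod_eq_0; generalize (Cmod_ge_0 (V O w)); lra).
  specialize (E w Hw1); rewrite Z' in E.
  assert (Z2 : (g (z + w) - g z)%C = 0).
  { replace (g (z + w) - g z)%C with ((g (z + w) - g z) * F O w / F O w)%C
      by (field; now apply Fnz).
    rewrite E; field; now apply Fnz. }
  replace (g (z + w)%C) with (g (z + w) - g z + g z)%C by ring; rewrite Z2; ring.
- exfalso.
  assert (exists k, V k (RtoC 0) <> RtoC 0 /\ forall j, (j < k)%nat -> V j (RtoC 0) = RtoC 0)
    as (k & Hk & Hmin).
  { apply not_all_ex_not in Ex as [n Hnz].
    revert Hnz; induction n as [n IH] using lt_wf_ind; intros Hnz.
    destruct (classic (exists j, (j < n)%nat /\ V j (RtoC 0) <> RtoC 0)) as [(j & Hj & Hj2)|No].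
    - now apply (IH j).
    - exists n; split; trivial; intros j Hj; apply NNPP; intros N; apply No; now exists j. }
  assert (Hk0 : (0 < k)%nat) by (destruct k; [contradiction|lia]).
  assert (Zd : Cmod (RtoC 0) <= d) by (rewrite Cmod_0; lra).
  set (v := V k (RtoC 0)) in *; set (f0 := F O (RtoC 0)).
  assert (Hf0 : f0 <> 0) by now apply Fnz.
  set (c := (v / f0)%C).
  assert (Hc : c <> 0).
  { intros N; apply Hk; replace v with (c * f0)%C by (unfold c; field; assumption).
    rewrite N; ring. }
  assert (Hcp : 0 < Cmod c) by now apply Cmod_gt_0.
  (* [L] bounds the rate at which [V k w / F O w] departs from its value [c] at 0. *)
  set (L := (M * B ^ S k * Cmod f0 + Cmod v * (M * B)) / (e * Cmod f0)).
  assert (Hf0p : 0 < Cmod f0) by now apply Cmod_gt_0.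
  assert (HL : 0 <= L).
  { apply Rdiv_le_0_compat; [|nra].
    apply Rplus_le_le_0_compat; repeat apply Rmult_le_pos; trivial; try apply Cmod_ge_0.
    now apply pow_le. }
  assert (lead : forall w, Cmod w <= d ->
     Cmod (V k w / F O w - c) <= L * Cmod w).
  { intros w Hw.
    destruct (HV k w Hw) as [E1 _]; destruct (HF O w Hw) as [E2 _].
    assert (Fw := Fnz w Hw).
    replace (V k w / F O w - c)%C with
      (w * (V (S k) w * f0 - v * F 1%nat w) / (F O w * f0))%C.
    2:{ unfold c; replace (V k w / F O w - v / f0)%C with ((V k w * f0 - v * F O w) / (F O w * f0))%C
          by (field; split; assumption).
        f_equal; rewrite E1; fold v; rewrite E2; fold f0; ring. }
    rewrite Cmod_div, !Cmod_mult by (apply Cmult_neq_0; assumption).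
    unfold L; replace ((M * B ^ S k * Cmod f0 + Cmod v * (M * B)) / (e * Cmod f0) * Cmod w)
      with (Cmod w * (M * B ^ S k * Cmod f0 + Cmod v * (M * B)) / (e * Cmod f0)) by (field; lra).
    apply Rmult_le_compat.
    - apply Rmult_le_pos; apply Cmod_ge_0.
    - left; apply Rinv_0_lt_compat, Rmult_lt_0_compat; [|assumption].
      specialize (Hn w Hw); lra.
    - apply Rmult_le_compat_l; [apply Cmod_ge_0|].
      eapply Rle_trans; [apply Cmod_minus_le|]; rewrite !Cmod_mult.
      destruct (HV (S k) w Hw) as [_ B1]; destruct (HF 1%nat w Hw) as [_ B2].
      rewrite pow_1 in B2.
      apply Rplus_le_compat.
      + apply Rmult_le_compat_r; [apply Cmod_ge_0|exact B1].
      + apply Rmult_le_compat_l; [apply Cmod_ge_0|exact B2].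
    - apply Rinv_le_contravar; [nra|].
      apply Rmult_le_compat_r; [lra|now apply Hn]. }
  (* [u] is the direction of [g z]; if [g z = 0] any direction will do. *)
  assert (exists u, Cmod u = 1 /\ g z = (RtoC (Cmod (g z)) * u)%C) as (u & Hu & Egz).
  { destruct (classic (g z = 0)) as [Z|N].
    - exists (RtoC 1); rewrite Z, Cmod_1, Cmod_0; split; [reflexivity|ring].
    - assert (P : 0 < Cmod (g z)) by now apply Cmod_gt_0.
      assert (RtoC (Cmod (g z)) <> 0) by (intros E1; apply RtoC_inj in E1; lra).
      exists (g z / RtoC (Cmod (g z)))%C; split; [|field; assumption].
      rewrite Cmod_div, Cmod_R, Rabs_pos_eq by (trivial; lra); field; lra. }
  (* [om] is chosen so that [om^k c] has direction [u]. Along [om] the leading term then adds to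
     [|g z|] without cancellation, and the remainder, at most [s^k (L s)], is smaller than the gain
     [s^k |c|]. *)
  destruct (Croot_unit (u * RtoC (Cmod c) / c)%C k) as (om & Hom & Eom); trivial.
  { rewrite Cmod_div, Cmod_mult, Cmod_R, Hu, Rabs_pos_eq by (trivial; lra); field; lra. }
  set (s := Rmin (Rmin d (r / 2)) (Cmod c / 2 / (L + 1))).
  assert (Hs : 0 < s).
  { repeat apply Rmin_pos; try lra; apply Rdiv_lt_0_compat; lra. }
  assert (s1 : s <= d) by (eapply Rle_trans; [apply Rmin_l|apply Rmin_l]).
  assert (s2 : s < r) by (assert (s <= r / 2) by (eapply Rle_trans; [apply Rmin_l|apply Rmin_r]); lra).
  assert (s3 : L * s < Cmod c).
  { assert (s3 : s <= Cmod c / 2 / (L + 1)) by apply Rmin_r.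
    apply Rmult_le_compat_r with (r := L + 1) in s3; [|lra].
    replace (Cmod c / 2 / (L + 1) * (L + 1)) with (Cmod c / 2) in s3 by (field; lra).
    lra. }
  set (w := (RtoC s * om)%C).
  assert (Hw : Cmod w = s) by (unfold w; rewrite Cmod_mult, Cmod_R, Hom, Rabs_pos_eq; lra).
  assert (Hmw := Hmax w ltac:(lra)).
  assert (Hwd : Cmod w <= d) by lra.
  assert (Eg : g (z + w)%C = (g z + w ^ k * (V k w / F O w))%C).
  { replace (g (z + w)%C) with (g z + (g (z + w) - g z) * F O w / F O w)%C
      by (field; now apply Fnz).
    rewrite E, (fact k Hmin) by assumption; field; now apply Fnz. }
  assert (Ewk : (w ^ k * c)%C = (RtoC (s ^ k * Cmod c) * u)%C).
  { unfold w; rewrite Cpow_mult_l, Eom, RtoC_mult, RtoC_pow; field; assumption. }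
  assert (G1 : Cmod (g z + w ^ k * c) = Cmod (g z) + s ^ k * Cmod c).
  { rewrite Ewk, Egz at 1.
    rewrite <- Cmult_plus_distr_r, <- RtoC_plus, Cmod_mult, Hu, Cmod_R, Rabs_pos_eq; [ring|].
    apply Rplus_le_le_0_compat; [apply Cmod_ge_0|].
    apply Rmult_le_pos; [apply pow_le; lra|apply Cmod_ge_0]. }
  assert (G2 : Cmod (g z + w ^ k * c) <= Cmod (g (z + w)%C) + s ^ k * (L * s)).
  { replace (g z + w ^ k * c)%C with (g (z + w) - w ^ k * (V k w / F O w - c))%C
      by (rewrite Eg; ring).
    eapply Rle_trans; [apply Cmod_minus_le|]; apply Rplus_le_compat_l.
    rewrite Cmod_mult, Cmod_pow, Hw.
    apply Rmult_le_compat_l; [apply pow_le; lra|].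
    eapply Rle_trans; [now apply lead|]; rewrite Hw; lra. }
  assert (0 < s ^ k) by now apply pow_lt.
  nra.
Qed.

(** * Maximum principle on squares in the [rho]-plane *)

Definition in_square (R0 x y : R) : Prop := -R0 <= x <= R0 /\ -R0 <= y <= R0.

Definition on_square (R0 x y : R) : Prop :=
  in_square R0 x y /\ (Rabs x = R0 \/ Rabs y = R0).

Lemma list_max {T : Type} (P : T -> Prop) (f : T -> R) (l : list T) :
  (exists x, In x l /\ P x) ->
  exists m, In m l /\ P m /\ forall x, In x l -> P x -> f x <= f m.
Proof.
induction l as [|a l IH]; intros (x & Hx & Px); [destruct Hx|].
destruct (classic (exists y, In y l /\ P y)) as [Ex|No].
- destruct (IH Ex) as (m & Hm & Pm & Hmax).
  destruct (classic (P a /\ f m < f a)) as [[Pa La]|N].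
  + exists a; split; [now left|]; split; [assumption|].
    intros y [->|Hy] Py; [lra|]; specialize (Hmax y Hy Py); lra.
  + exists m; split; [now right|]; split; [assumption|].
    intros y [->|Hy] Py; [|now apply Hmax].
    apply Rnot_lt_le; intros L; apply N; now split.
- destruct Hx as [->|Hx]; [|elim No; now exists x].
  exists x; split; [now left|]; split; [assumption|].
  intros y [->|Hy] Py; [lra|elim No; now exists y].
Qed.

(** If no maximum were attained, each point would have a competitor beating [phi] on a whole
    neighbourhood. Finitely many such neighbourhoods cover the square; the best of their competitors
    lies in one of them and is beaten by its competitor. *)
Lemma usc_attains_max (phi : R -> R -> R) (R0 : R) :
  0 <= R0 ->
  (forall x y, in_square R0 x y -> forall eta, 0 < eta -> exists de, 0 < de /\
     forall x' y', in_square R0 x' y' -> Rabs (x' - x) < de -> Rabs (y' - y) < de ->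
       phi x' y' < phi x y + eta) ->
  exists x y, in_square R0 x y /\ forall x' y', in_square R0 x' y' -> phi x' y' <= phi x y.
Proof.
intros HR Husc; apply NNPP; intros N.
assert (better : forall p : R * R, exists p' : R * R, exists de, 0 < de /\
  (in_square R0 (fst p) (snd p) -> in_square R0 (fst p') (snd p') /\
   forall x y, in_square R0 x y -> Rabs (x - fst p) < de -> Rabs (y - snd p) < de ->
     phi x y < phi (fst p') (snd p'))).
{ intros [x y]; simpl.
  destruct (classic (in_square R0 x y)) as [Hin|Hout].
  - assert (exists x' y', in_square R0 x' y' /\ phi x y < phi x' y') as (x' & y' & Hin' & L).
    { apply NNPP; intros N2; apply N; exists x, y; split; trivial.
      intros x' y' Hin'; apply Rnot_lt_le; intros L; apply N2; now exists x', y'. }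
    destruct (Husc x y Hin (phi x' y' - phi x y)) as (de & Hde & Hd); [lra|].
    exists (x', y'), de; split; trivial; intros _; split; trivial.
    intros x2 y2 H1 H2 H3; specialize (Hd x2 y2 H1 H2 H3); simpl; lra.
  - exists (0, 0), 1; split; [lra|]; tauto. }
set (nxt := fun p => proj1_sig (constructive_indefinite_description _ (better p))).
assert (Hn1 := fun p => proj2_sig (constructive_indefinite_description _ (better p))).
cbv beta in Hn1.
set (de := fun p => proj1_sig (constructive_indefinite_description _ (Hn1 p))).
assert (Hn2 := fun p => proj2_sig (constructive_indefinite_description _ (Hn1 p))).
cbv beta in Hn2.
set (q2 := fun t : Compactness.Tn 2 R => (fst t, fst (snd t))).
set (delta := fun t : Compactness.Tn 2 R => mkposreal (de (q2 t)) (proj1 (Hn2 (q2 t)))).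
apply (compactness_list 2 (- R0, (- R0, tt)) (R0, (R0, tt)) delta).
intros (l & Hl).
assert (Hl' : forall x y, in_square R0 x y -> exists t, In t l /\
   in_square R0 (fst (q2 t)) (snd (q2 t)) /\
   Rabs (x - fst (q2 t)) < de (q2 t) /\ Rabs (y - snd (q2 t)) < de (q2 t)).
{ intros x y [Hx Hy]; destruct (Hl (x, (y, tt))) as (t & Ht & Hb & Hc).
  - simpl; tauto.
  - exists t; split; trivial; destruct t as [t1 [t2 []]]; simpl in *; unfold in_square; tauto. }
destruct (list_max (fun t => in_square R0 (fst (q2 t)) (snd (q2 t)))
  (fun t => phi (fst (nxt (q2 t))) (snd (nxt (q2 t)))) l) as (m & Hm & Pm & Hmax).
- destruct (Hl' 0 0) as (t & Ht & Ht2 & _); [unfold in_square; lra|]; now exists t.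
- destruct (Hn2 (q2 m)) as [_ Hb]; destruct (Hb Pm) as [Hin _].
  destruct (Hl' _ _ Hin) as (t & Ht & Ht2 & D1 & D2).
  specialize (Hmax t Ht Ht2).
  destruct (Hn2 (q2 t)) as [_ Hb2]; destruct (Hb2 Ht2) as [_ Hlt].
  specialize (Hlt _ _ Hin D1 D2); unfold nxt in *; lra.
Qed.

(** A neighbourhood of [p^2] in the [lam]-plane is covered by squares of points near [p], also at
    the branch point [p = 0]: since [(r - p)(r + p) = w], one of the roots [r], [- r] is close to
    [p]. *)
Lemma Csquare_lift (p w : C) (de : R) :
  0 < de -> Cmod w < de * de -> exists r, (r * r)%C = (p * p + w)%C /\ Cmod (r - p) < de.
Proof.
intros Hde Hw.
destruct (Csqrt_exists (p * p + w)%C) as [r Hr].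
assert (E : Cmod (r - p) * Cmod (r + p) < de * de).
{ rewrite <- Cmod_mult; replace ((r - p) * (r + p))%C with (r * r - p * p)%C by ring.
  rewrite Hr; replace (p * p + w - p * p)%C with w by ring; assumption. }
destruct (Rlt_dec (Cmod (r - p)) de) as [L|G]; [now exists r|].
exists (- r)%C; split; [rewrite <- Hr; ring|].
replace (- r - p)%C with (- (r + p))%C by ring; rewrite Cmod_opp.
apply Rnot_le_lt; intros L.
assert (de * de <= Cmod (r - p) * Cmod (r + p)) by (apply Rmult_le_compat; lra); lra.
Qed.

Lemma Cmod_square_diff (x y x' y' de : R) :
  Rabs (x' - x) < de -> Rabs (y' - y) < de -> de <= 1 ->
  Cmod ((x', y') * (x', y') - (x, y) * (x, y))%C <= 2 * de * (2 * Cmod (x, y) + 2).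
Proof.
intros Hx Hy Hde.
assert (D : Cmod ((x', y') - (x, y))%C <= 2 * de).
{ eapply Rle_trans; [apply Cmod_le_abs|]; simpl; unfold Rminus in *; lra. }
replace ((x', y') * (x', y') - (x, y) * (x, y))%C with
  (((x', y') - (x, y)) * (((x', y') - (x, y)) + (x, y) + (x, y)))%C by ring.
rewrite Cmod_mult.
apply Rmult_le_compat; try apply Cmod_ge_0; [assumption|].
eapply Rle_trans; [apply Cmod_triangle|].
eapply Rle_trans; [apply Rplus_le_compat_r, Cmod_triangle|]; lra.
Qed.

Lemma square_cont (g : C -> C) (x y eta : R) :
  local_quotient g ((x, y) * (x, y))%C -> 0 < eta ->
  exists de, 0 < de /\ forall x' y', Rabs (x' - x) < de -> Rabs (y' - y) < de ->
    Cmod (g ((x', y') * (x', y')) - g ((x, y) * (x, y)))%C < eta.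
Proof.
intros Hg Heta.
destruct (local_quotient_cont g _ Hg eta Heta) as (d & Hd & Hc).
set (c := 2 * (2 * Cmod (x, y) + 2)).
assert (Hcp : 0 < c) by (unfold c; generalize (Cmod_ge_0 (x, y)); lra).
exists (Rmin 1 (d / 2 / c)); split.
{ apply Rmin_pos; [lra|]; apply Rdiv_lt_0_compat; lra. }
intros x' y' Hx Hy.
replace ((x', y') * (x', y'))%C with
  ((x, y) * (x, y) + ((x', y') * (x', y') - (x, y) * (x, y)))%C by ring.
apply Hc; eapply Rle_lt_trans; [apply (Cmod_square_diff _ _ _ _ _ Hx Hy); apply Rmin_l|].
assert (m := Rmin_r 1 (d / 2 / c)).
apply Rmult_le_compat_r with (r := c) in m; [|lra].
replace (d / 2 / c * c) with (d / 2) in m by (field; lra).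
unfold c in *; lra.
Qed.

(** A maximum above [eps] is attained only in the interior. Near it [g] is constant, so a point
    slightly to the right is also a maximiser; choosing the rightmost maximiser gives the
    contradiction without a connectedness argument. *)
Lemma maximum_principle_square (g : C -> C) (R0 eps : R) :
  0 < R0 ->
  (forall z, local_quotient g z) ->
  (forall x y, on_square R0 x y -> Cmod (g ((x, y) * (x, y))%C) <= eps) ->
  forall x y, in_square R0 x y -> Cmod (g ((x, y) * (x, y))%C) <= eps.
Proof.
intros HR Hg Hbd.
set (phi := fun x y => Cmod (g ((x, y) * (x, y))%C)).
destruct (usc_attains_max phi R0) as (x1 & y1 & Hin1 & Hmax1); [lra| |].
{ intros x y _ eta Heta.
  destruct (square_cont g x y eta (Hg _) Heta) as (de & Hde & Hc).
  exists de; split; trivial; intros x' y' _ Hx Hy.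
  specialize (Hc x' y' Hx Hy); unfold phi.
  generalize (Cmod_minus_ge (g ((x', y') * (x', y'))%C) (g ((x, y) * (x, y))%C)); lra. }
destruct (Rle_dec (phi x1 y1) eps) as [L|G].
{ intros x y Hin; eapply Rle_trans; [exact (Hmax1 x y Hin)|exact L]. }
exfalso.
(* Among the maximisers take one with largest real part. *)
set (phi2 := fun x y => if Req_EM_T (phi x y) (phi x1 y1) then x else - R0 - 1).
destruct (usc_attains_max phi2 R0) as (x2 & y2 & Hin2 & Hmax2); [lra| |].
(* [phi2] is upper semicontinuous: the non-maximisers form an open set, and there it takes the value
   [- R0 - 1], below every abscissa in the square. *)
{ intros x y Hin eta Heta.
  destruct (Req_EM_T (phi x y) (phi x1 y1)) as [E|N].
  - exists eta; split; trivial; intros x' y' [Hin' _] Hx Hy; unfold phi2.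
    destruct (Req_EM_T (phi x y) (phi x1 y1)); [|contradiction].
    apply Rabs_lt_between in Hx; destruct Hin as [Hin _].
    destruct (Req_EM_T (phi x' y') (phi x1 y1)); lra.
  - assert (Lt : phi x y < phi x1 y1) by (destruct (Hmax1 x y Hin); [assumption|contradiction]).
    destruct (square_cont g x y (phi x1 y1 - phi x y) (Hg _)) as (de & Hde & Hc); [lra|].
    exists de; split; trivial; intros x' y' Hin' Hx Hy; unfold phi2.
    specialize (Hc x' y' Hx Hy).
    generalize (Cmod_minus_ge (g ((x', y') * (x', y'))%C) (g ((x, y) * (x, y))%C)); intros Hm.
    destruct (Req_EM_T (phi x' y') (phi x1 y1)) as [E|_]; [unfold phi in *; lra|].
    destruct (Req_EM_T (phi x y) (phi x1 y1)); [contradiction|lra]. }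
assert (E2 : phi x2 y2 = phi x1 y1).
{ specialize (Hmax2 x1 y1 Hin1); unfold phi2 in Hmax2.
  destruct (Req_EM_T (phi x1 y1) (phi x1 y1)); [|contradiction].
  destruct (Req_EM_T (phi x2 y2) (phi x1 y1)); [assumption|].
  destruct Hin1; lra. }
assert (Hint : Rabs x2 < R0 /\ Rabs y2 < R0).
{ destruct Hin2 as [Hx Hy].
  assert (Rabs x2 <= R0) by (apply Rabs_le; lra).
  assert (Rabs y2 <= R0) by (apply Rabs_le; lra).
  split; (destruct (Rle_lt_or_eq_dec _ _ H) as [?|Ex]; [|exfalso; apply G; rewrite <- E2;
     apply Hbd; split; [split; assumption|now left]]);
  (destruct (Rle_lt_or_eq_dec _ _ H0) as [?|Ey]; [|exfalso; apply G; rewrite <- E2;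
     apply Hbd; split; [split; assumption|now right]]); assumption. }
destruct Hint as [Ix Iy].
set (p := (x2, y2) : C).
set (de := Rmin (R0 - Rabs x2) (R0 - Rabs y2)).
assert (Hde : 0 < de) by (apply Rmin_pos; lra).
assert (de1 : de <= R0 - Rabs x2) by apply Rmin_l.
assert (de2 : de <= R0 - Rabs y2) by apply Rmin_r.
destruct (local_max_const g (p * p)%C (de * de) (Hg _)) as (d & Hd & Hconst); [nra| |].
{ intros w Hw; destruct (Csquare_lift p w de Hde Hw) as ([rx ry] & Er & Hr).
  rewrite <- Er; change (phi rx ry <= phi x2 y2); rewrite E2; apply Hmax1.
  assert (A1 := fst_le_Cmod ((rx, ry) - p)%C); assert (A2 := snd_le_Cmod ((rx, ry) - p)%C).
  simpl in A1, A2.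
  assert (A3 : Rabs (rx - x2) < de) by (unfold Rminus; lra).
  assert (A4 : Rabs (ry - y2) < de) by (unfold Rminus; lra).
  apply Rabs_lt_between in A3, A4.
  generalize (Rle_abs x2) (Rle_abs (- x2)) (Rle_abs y2) (Rle_abs (- y2)).
  rewrite !Rabs_Ropp; unfold in_square; lra. }
set (c := 2 * (2 * Cmod p + 2)).
assert (Hcp : 0 < c) by (unfold c; generalize (Cmod_ge_0 p); lra).
(* The shift [s] keeps the point in the square and moves its square by less than [d], hence within
   the region where [g] is constant. *)
set (s := Rmin 1 (Rmin de (d / c)) / 4).
assert (Hmin : 0 < Rmin 1 (Rmin de (d / c))).
{ repeat apply Rmin_pos; try lra; apply Rdiv_lt_0_compat; lra. }
assert (m1 := Rmin_l 1 (Rmin de (d / c))); assert (m2 := Rmin_r 1 (Rmin de (d / c))).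
assert (m3 := Rmin_l de (d / c)); assert (m4 := Rmin_r de (d / c)).
assert (Hs : 0 < s) by (unfold s; lra).
assert (E3 : phi (x2 + s) y2 = phi x1 y1).
{ rewrite <- E2; unfold phi.
  replace (((x2 + s)%R, y2) * ((x2 + s)%R, y2))%C with
    (p * p + (((x2 + s)%R, y2) * ((x2 + s)%R, y2) - p * p))%C by ring.
  rewrite Hconst; [reflexivity|].
  eapply Rle_lt_trans; [apply (Cmod_square_diff x2 y2 (x2 + s) y2 (2 * s))|].
  - replace (x2 + s - x2) with s by ring; rewrite Rabs_pos_eq; lra.
  - rewrite Rminus_diag, Rabs_R0; lra.
  - unfold s; lra.
  - assert (s * c <= d / 4).
    { replace (d / 4) with (d / c / 4 * c) by (field; lra).
      apply Rmult_le_compat_r; [lra|unfold s; lra]. }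
    replace (2 * (2 * s) * (2 * Cmod (x2, y2) + 2)) with (2 * (s * c)) by (unfold c, p; ring).
    lra. }
specialize (Hmax2 (x2 + s) y2); unfold phi2 in Hmax2.
destruct (Req_EM_T (phi (x2 + s) y2) (phi x1 y1)); [|contradiction].
destruct (Req_EM_T (phi x2 y2) (phi x1 y1)); [|contradiction].
generalize (Rle_abs x2) (Rle_abs (- x2)); rewrite Rabs_Ropp; intros.
assert (x2 + s <= x2); [|lra].
apply Hmax2; destruct Hin2; split; unfold s; lra.
Qed.

(** Removal of the singularity of [(ft - f) / f]. At a zero of [f], simple by assumption, numerator
    and denominator are both divided by [w], that is, their Taylor sequences are shifted by one. The
    last clause makes [f] nonzero at all neighbours, where the extended function is the honest
    quotient. *)
Lemma quotient_extends (f ft : C -> C) (z : C) :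
  analytic_at ft z ->
  (exists d B M F, 0 < d /\ 0 <= B /\ taylor_seq d B M F /\
     (forall w, Cmod w <= d -> f (z + w)%C = F O w) /\
     (f z = 0 -> F 1%nat (RtoC 0) <> 0)) ->
  (f z = 0 -> ft z = 0) ->
  exists v, (f z <> 0 -> v = ((ft z - f z) / f z)%C) /\
    exists d B M U F, 0 < d /\ 0 <= B /\ taylor_seq d B M U /\ taylor_seq d B M F /\
      F O (RtoC 0) <> 0 /\ (v * F O (RtoC 0))%C = U O (RtoC 0) /\
      forall w, Cmod w <= d -> w <> 0 ->
        f (z + w)%C <> 0 /\ ((ft (z + w) - f (z + w)) / f (z + w) * F O w)%C = U O w.
Proof.
intros (d1 & B1 & M1 & G & Hd1 & HB1 & HG & EG) (d2 & B2 & M2 & F & Hd2 & HB2 & HF & EF & simple) Hz.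
assert (HM1 := taylor_seq_M d1 B1 M1 G (Rlt_le _ _ Hd1) HG).
assert (HM2 := taylor_seq_M d2 B2 M2 F (Rlt_le _ _ Hd2) HF).
set (d := Rmin d1 d2); set (B := B1 + B2); set (M := M1 + M2).
assert (Hd : 0 < d) by now apply Rmin_pos.
assert (HB : 0 <= B) by (unfold B; lra).
assert (dl : d <= d1) by apply Rmin_l; assert (dr : d <= d2) by apply Rmin_r.
apply (taylor_seq_weaken _ _ _ d B M) in HG; try (unfold B, M; lra).
apply (taylor_seq_weaken _ _ _ d B M) in HF; try (unfold B, M; lra).
assert (HM : 0 <= M) by (unfold M; lra).
set (V := fun n w => (G n w + RtoC (-1) * F n w)%C).
assert (HV : taylor_seq d B (M + M) V).
{ assert (H := taylor_seq_lin d B M M G F (RtoC (-1)) HG HF).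
  rewrite Cmod_R, Rabs_left in H by lra; replace (- (-1) * M) with M in H by ring; exact H. }
assert (EV : forall w, Cmod w <= d -> (ft (z + w) - f (z + w))%C = V O w).
{ intros w Hw; rewrite EG, EF by lra; unfold V.
  apply injective_projections; simpl; ring. }
assert (Z0 : Cmod (RtoC 0) <= d) by (rewrite Cmod_0; lra).
assert (Ez : (z + 0)%C = z) by ring.
assert (Ef0 : f z = F O (RtoC 0)) by (rewrite <- EF, Ez by lra; reflexivity).
assert (Ev0 : (ft z - f z)%C = V O (RtoC 0)) by (rewrite <- EV, Ez by lra; reflexivity).
destruct (classic (f z = 0)) as [Zero|NZ].
- specialize (simple Zero); specialize (Hz Zero).
  assert (HF' := taylor_seq_shift d B M F (Rlt_le _ _ Hd) HF).
  assert (HV' := taylor_seq_shift d B (M + M) V (Rlt_le _ _ Hd) HV).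
  destruct (taylor_seq_nonzero d B _ _ Hd HB HF' simple) as (d' & [Hd' Hdd'] & Hn).
  exists (V 1%nat (RtoC 0) / F 1%nat (RtoC 0))%C; split; [intros N; contradiction|].
  assert (HMB : 0 <= M * B) by now apply Rmult_le_pos.
  exists d', B, ((M + M) * B), (fun n => V (S n)), (fun n => F (S n)).
  split; [assumption|]; split; [assumption|]; split; [|split; [|split; [|split]]].
  + apply (taylor_seq_weaken d B ((M + M) * B)); trivial; lra.
  + apply (taylor_seq_weaken d B (M * B)); trivial; lra.
  + exact simple.
  + field; exact simple.
  + intros w Hw Hw0.
    assert (Fw : F 1%nat w <> 0).
    { apply Cmod_gt_0; specialize (Hn w Hw).
      assert (0 < Cmod (F 1%nat (RtoC 0))) by now apply Cmod_gt_0.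
      lra. }
    assert (Ef : f (z + w)%C = (w * F 1%nat w)%C).
    { rewrite EF by lra; destruct (HF O w) as [-> _]; [lra|].
      rewrite <- Ef0, Zero; ring. }
    split.
    * rewrite Ef; now apply Cmult_neq_0.
    * rewrite EV, Ef by lra; destruct (HV O w) as [-> _]; [lra|].
      rewrite <- Ev0, Hz, Zero; field; split; assumption.
- rewrite Ef0 in NZ.
  destruct (taylor_seq_nonzero d B _ _ Hd HB HF NZ) as (d' & [Hd' Hdd'] & Hn).
  exists ((ft z - f z) / f z)%C; split; [reflexivity|].
  exists d', B, (M + M), V, F.
  split; [assumption|]; split; [assumption|]; split; [|split; [|split; [|split]]].
  + apply (taylor_seq_weaken d B (M + M)); trivial; lra.
  + apply (taylor_seq_weaken d B M); trivial; lra.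
  + exact NZ.
  + rewrite Ev0, Ef0; field; exact NZ.
  + intros w Hw _.
    assert (Fw : F O w <> 0).
    { apply Cmod_gt_0; specialize (Hn w Hw).
      assert (0 < Cmod (F O (RtoC 0))) by now apply Cmod_gt_0.
      lra. }
    rewrite EV, EF by lra; split; [exact Fw|field; exact Fw].
Qed.

(* The quotient [ft / f] has only removable singularities and tends to [1] on
   large contours, so the maximum principle applies to [ft / f - 1]. *)
Lemma same_zeros_eq (f ft : C -> C) :
  (forall z, analytic_at ft z) ->
  (forall z, exists d B M F, 0 < d /\ 0 <= B /\ taylor_seq d B M F /\
     (forall w, Cmod w <= d -> f (z + w)%C = F O w) /\
     (f z = 0 -> F 1%nat (RtoC 0) <> 0)) ->
  (forall z, f z = 0 -> ft z = 0) ->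
  (forall eps R1, 0 < eps -> exists R0, R1 < R0 /\ forall x y, on_square R0 x y ->
     f ((x, y) * (x, y))%C <> 0 /\
     Cmod (ft ((x, y) * (x, y)) - f ((x, y) * (x, y)))%C
       <= eps * Cmod (f ((x, y) * (x, y))%C)) ->
  forall z, ft z = f z.
Proof.
intros Hft Hf Hz Hbd.
assert (ext := fun z => quotient_extends f ft z (Hft z) (Hf z) (Hz z)).
(* The values [v] are collected by choice into one function on the plane; the local data then show
   that it is a local quotient everywhere. *)
set (g := fun z => proj1_sig (constructive_indefinite_description _ (ext z))).
assert (Hg := fun z => proj2_sig (constructive_indefinite_description _ (ext z))).
cbv beta in Hg; fold g in Hg.
assert (Hg' : forall z, (f z <> 0 -> g z = ((ft z - f z) / f z)%C) /\
    exists d B M U F, 0 < d /\ 0 <= B /\ taylor_seq d B M U /\ taylor_seq d B M F /\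
      F O (RtoC 0) <> 0 /\ (g z * F O (RtoC 0))%C = U O (RtoC 0) /\
      forall w, Cmod w <= d -> w <> 0 ->
        f (z + w)%C <> 0 /\ ((ft (z + w) - f (z + w)) / f (z + w) * F O w)%C = U O w)
  by exact Hg.
clear Hg; clearbody g.
assert (Lg : forall z, local_quotient g z).
{ intros z; destruct (Hg' z) as (_ & d & B & M & U & F & Hd & HB & HU & HF & F0 & E0 & E).
  exists d, B, M, U, F; split; [assumption|]; split; [assumption|].
  split; [assumption|]; split; [assumption|]; split; [assumption|].
  intros w Hw; destruct (classic (w = 0)) as [->|Nw].
  - replace (z + 0)%C with z by ring; exact E0.
  - destruct (E w Hw Nw) as [Nf Ew].
    destruct (Hg' (z + w)%C) as [-> _]; assumption. }
assert (g0 : forall z, g z = 0).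
{ intros z; destruct (Csqrt_exists z) as [[x y] Er].
  apply Cmod_eq_0; apply Rle_antisym; [|apply Cmod_ge_0].
  apply le_epsilon; intros eps Heps; rewrite Rplus_0_l.
  destruct (Hbd eps (Rabs x + Rabs y) Heps) as (R0 & HR & Hb).
  generalize (Rabs_pos x) (Rabs_pos y); intros.
  rewrite <- Er; apply (maximum_principle_square g R0 eps); trivial.
  - lra.
  - intros x' y' Hon; destruct (Hb x' y' Hon) as [Nf Hle].
    destruct (Hg' ((x', y') * (x', y'))%C) as [-> _]; trivial.
    rewrite Cmod_div by assumption.
    assert (P : 0 < Cmod (f ((x', y') * (x', y'))%C)) by now apply Cmod_gt_0.
    apply Rmult_le_reg_r with (Cmod (f ((x', y') * (x', y'))%C)); trivial.
    unfold Rdiv; rewrite Rmult_assoc, Rinv_l, Rmult_1_r by lra; exact Hle.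
  - generalize (Rle_abs x) (Rle_abs (- x)) (Rle_abs y) (Rle_abs (- y)).
    rewrite !Rabs_Ropp; unfold in_square; lra. }
intros z; destruct (classic (f z = 0)) as [Z|N].
- now rewrite Z, (Hz z Z).
- destruct (Hg' z) as [E _]; specialize (E N); rewrite g0 in E.
  replace (ft z) with ((ft z - f z) / f z * f z + f z)%C by (field; assumption).
  rewrite <- E; ring.
Qed.

(** A Liouville theorem, obtained by comparing [1 + P] with the constant 1, which has no zeros. *)
Lemma vanishes_on_squares_eq0 (P : C -> C) :
  (forall z, analytic_at P z) ->
  (forall eps R1, 0 < eps -> exists R0, R1 < R0 /\ forall x y, on_square R0 x y ->
     Cmod (P ((x, y) * (x, y))%C) <= eps) ->
  forall z, P z = 0.
Proof.
intros HP Hb z.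
assert (E : (RtoC 1 + RtoC 1 * P z)%C = RtoC 1).
{ apply (same_zeros_eq (fun _ => RtoC 1) (fun z => RtoC 1 + RtoC 1 * P z)%C).
  - intros y; apply analytic_at_lin; [apply analytic_at_const|apply HP].
  - intros y; destruct (analytic_at_const (RtoC 1) y) as (d & B & M & F & Hd & HB & HF & EF).
    exists d, B, M, F; repeat (split; [assumption|]).
    intros H; apply RtoC_inj in H; lra.
  - intros y H; apply RtoC_inj in H; lra.
  - intros eps R1 Heps; destruct (Hb eps R1 Heps) as (R0 & HR & H).
    exists R0; split; trivial; intros x y Hon; split.
    + intros E; apply RtoC_inj in E; lra.
    + rewrite Cmod_1, Rmult_1_r; eapply Rle_trans; [|apply (H x y Hon)].
      right; f_equal; ring. }
replace (P z) with (RtoC 1 + RtoC 1 * P z - RtoC 1)%C by ring.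
rewrite E; ring.
Qed.

(** * Dependence on the spectral parameter *)

Definition pot (Q : R -> R) (lam : C) (t : R) : C := (RtoC (Q t) - lam)%C.

Definition SLy (Q : R -> R) (lam y0 z0 : C) : R -> C :=
  sol_y (pot Q lam) (fun _ => RtoC 0) y0 z0.
Definition SLz (Q : R -> R) (lam y0 z0 : C) : R -> C :=
  sol_z (pot Q lam) (fun _ => RtoC 0) y0 z0.

Definition init (c : C) (n : nat) : C := match n with O => c | S _ => RtoC 0 end.

(* [forcing n] is minus the [n-1]-st coefficient of the expansion of the
   solution in powers of [lam - lam0]. *)
Fixpoint forcing (Q : R -> R) (lam0 y0 z0 : C) (n : nat) : R -> C :=
  match n with
  | O => fun _ => RtoC 0
  | S n => fun t =>
     (- sol_y (pot Q (lam0 + 0)%C) (forcing Q lam0 y0 z0 n) (init y0 n) (init z0 n) t)%C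
  end.

(** The [n]-th Taylor quotients of the solution at [lam0]. For [n = 0] this is the solution at
    [lam0 + w]. Subtracting the equations at [w] and at 0 leaves the source [- w * quoty n 0], so
    the divided difference solves the equation with forcing [- quoty n 0] and zero data. The
    [lam0 + 0] in [forcing] makes [forcing (S n)] exactly this term. *)
Definition quoty Q lam0 y0 z0 n w : R -> C :=
  sol_y (pot Q (lam0 + w)%C) (forcing Q lam0 y0 z0 n) (init y0 n) (init z0 n).
Definition quotz Q lam0 y0 z0 n w : R -> C :=
  sol_z (pot Q (lam0 + w)%C) (forcing Q lam0 y0 z0 n) (init y0 n) (init z0 n).

Lemma pot_cont Q lam : (forall t, continuous Q t) -> forall t, Ccont (pot Q lam) t.
Proof.
intros HQ t; unfold pot; apply Ccont_plus; [|apply Ccont_const].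
split; simpl; [apply HQ|apply continuous_const].
Qed.

Lemma pot_bound Q lam A t : Rabs (Q t) <= A -> Cmod (pot Q lam t) <= A + Cmod lam.
Proof.
intros H; unfold pot; eapply Rle_trans; [apply Cmod_minus_le|]; rewrite Cmod_R; lra.
Qed.

(** One [K] serves all [n], since [A'] bounds the potential for every [|w| <= 1]. For [n > 0] the
    data vanish, so by [linear_ode_exists] each order is at most 4 times its forcing: hence [4 ^ n].
    [N] is the bound for [n = 0]. *)
Lemma quot_spec Q A lam0 y0 z0 :
  (forall t, continuous Q t) -> (forall t, Rabs (Q t) <= A) ->
  exists N K, 0 < K /\ 0 <= N /\ forall n,
  (forall t, Ccont (forcing Q lam0 y0 z0 n) t) /\
  forall w, Cmod w <= 1 ->
  (forall t, Cd (quoty Q lam0 y0 z0 n w) t (quotz Q lam0 y0 z0 n w t)) /\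
  (forall t, Cd (quotz Q lam0 y0 z0 n w) t
     (pot Q (lam0 + w)%C t * quoty Q lam0 y0 z0 n w t + forcing Q lam0 y0 z0 n t)%C) /\
  quoty Q lam0 y0 z0 n w 0 = init y0 n /\ quotz Q lam0 y0 z0 n w 0 = init z0 n /\
  (forall t, Cmod (quotz Q lam0 y0 z0 n w t) <= N * 4 ^ n * exp (K * Rabs t)) /\
  (forall t, Cmod (quoty Q lam0 y0 z0 n w t) <= N * 4 ^ n * exp (K * Rabs t)).
Proof.
intros HQ HA.
assert (HA0 : 0 <= A) by (generalize (HA 0) (Rabs_pos (Q 0)); lra).
set (A' := A + (Cmod lam0 + 1)).
assert (HA' : 1 <= A') by (unfold A'; generalize (Cmod_ge_0 lam0); lra).
set (K := 2 * A'); set (N := Cmod y0 + 4 * (Cmod z0 + A' * Cmod y0)).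
assert (HK : 1 <= K) by (unfold K; lra).
assert (HKK : 2 * A' <= K * K) by (unfold K; nra).
assert (Hy0 := Cmod_ge_0 y0); assert (Hz0 := Cmod_ge_0 z0).
assert (HN : 0 <= N) by (unfold N; nra).
exists N, K; split; [lra|]; split; [assumption|].
assert (Hw' : forall w t, Cmod w <= 1 -> Cmod (pot Q (lam0 + w)%C t) <= A').
{ intros w t Hw; eapply Rle_trans; [apply pot_bound, HA|].
  unfold A'; generalize (Cmod_triangle lam0 w); lra. }
assert (step : forall n be, 0 <= be -> (forall t, Ccont (forcing Q lam0 y0 z0 n) t) ->
  (forall t, Cmod (forcing Q lam0 y0 z0 n t) <= be * exp (K * Rabs t)) ->
  Cmod (init y0 n) + 4 * (Cmod (init z0 n) + (be + A' * Cmod (init y0 n))) <= N * 4 ^ n ->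
  forall w, Cmod w <= 1 ->
  (forall t, Cd (quoty Q lam0 y0 z0 n w) t (quotz Q lam0 y0 z0 n w t)) /\
  (forall t, Cd (quotz Q lam0 y0 z0 n w) t
     (pot Q (lam0 + w)%C t * quoty Q lam0 y0 z0 n w t + forcing Q lam0 y0 z0 n t)%C) /\
  quoty Q lam0 y0 z0 n w 0 = init y0 n /\ quotz Q lam0 y0 z0 n w 0 = init z0 n /\
  (forall t, Cmod (quotz Q lam0 y0 z0 n w t) <= N * 4 ^ n * exp (K * Rabs t)) /\
  (forall t, Cmod (quoty Q lam0 y0 z0 n w t) <= N * 4 ^ n * exp (K * Rabs t))).
{ intros n be Hbe Cf Bf Hle w Hw.
  destruct (linear_ode_exists (pot Q (lam0 + w)%C) (forcing Q lam0 y0 z0 n) (init y0 n) (init z0 n)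
    A' K be) as (D1 & D2 & I1 & I2 & B1 & B2); trivial; try lra.
  { now apply pot_cont. }
  { intros t; now apply Hw'. }
  split; [exact D1|]; split; [exact D2|]; split; [exact I1|]; split; [exact I2|].
  assert (iy := Cmod_ge_0 (init y0 n)); assert (iz := Cmod_ge_0 (init z0 n)).
  set (X := be + A' * Cmod (init y0 n)) in *.
  assert (HX : 0 <= X) by (unfold X; nra).
  assert (HXK : X / K <= X).
  { apply Rmult_le_reg_r with K; [lra|]; unfold Rdiv.
    rewrite Rmult_assoc, Rinv_l, Rmult_1_r by lra; nra. }
  assert (HXK0 : 0 <= X / K) by (apply Rdiv_le_0_compat; lra).
  split; intros t.
  - eapply Rle_trans; [apply B1|]; apply Rmult_le_compat_r; [left; apply exp_pos|lra].
  - eapply Rle_trans; [apply B2|]; apply Rmult_le_compat_r; [left; apply exp_pos|].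
    assert (4 * (Cmod (init z0 n) + X / K) / K <= 4 * (Cmod (init z0 n) + X / K)).
    { apply Rmult_le_reg_r with K; [lra|]; unfold Rdiv at 1.
      rewrite Rmult_assoc, Rinv_l, Rmult_1_r by lra; nra. }
    lra. }
assert (all : forall n, (forall t, Ccont (forcing Q lam0 y0 z0 n) t) /\
  exists be, 0 <= be /\ (forall t, Cmod (forcing Q lam0 y0 z0 n t) <= be * exp (K * Rabs t)) /\
  Cmod (init y0 n) + 4 * (Cmod (init z0 n) + (be + A' * Cmod (init y0 n))) <= N * 4 ^ n).
{ induction n as [|n (Cf & be & Hbe & Bf & Hle)].
  - split; [intros t; apply Ccont_const|].
    exists 0; split; [lra|]; split; [intros t; simpl; rewrite Cmod_0; lra|].
    simpl; unfold N; lra.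
  - destruct (step n be Hbe Cf Bf Hle (RtoC 0)) as (D1 & _ & _ & _ & _ & B2);
      [rewrite Cmod_0; lra|].
    split.
    + intros t; simpl; apply Ccont_opp; eapply Cd_cont, D1.
    + exists (N * 4 ^ n); split; [apply Rmult_le_pos; [assumption|apply pow_le; lra]|].
      split; [intros t; simpl; rewrite Cmod_opp; apply B2|].
      simpl; rewrite Cmod_0; lra. }
intros n; destruct (all n) as (Cf & be & Hbe & Bf & Hle); split; [exact Cf|].
intros w Hw; now apply (step n be).
Qed.

Lemma quot_step Q A lam0 y0 z0 n w t :
  (forall t, continuous Q t) -> (forall t, Rabs (Q t) <= A) ->
  Cmod w <= 1 -> 0 <= t ->
  quoty Q lam0 y0 z0 n w t
    = (quoty Q lam0 y0 z0 n 0 t + w * quoty Q lam0 y0 z0 (S n) w t)%C /\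
  quotz Q lam0 y0 z0 n w t
    = (quotz Q lam0 y0 z0 n 0 t + w * quotz Q lam0 y0 z0 (S n) w t)%C.
Proof.
intros HQ HA Hw Ht.
destruct (quot_spec Q A lam0 y0 z0 HQ HA) as (N & K & _ & _ & sp).
destruct (sp n) as [_ sn]; destruct (sp (S n)) as [_ sSn].
destruct (sn w Hw) as (Y1 & Z1 & y1 & z1 & _).
destruct (sn (RtoC 0)) as (Y2 & Z2 & y2 & z2 & _); [rewrite Cmod_0; lra|].
destruct (sSn w Hw) as (Y3 & Z3 & y3 & z3 & _).
destruct (linear_ode_unique (pot Q (lam0 + w)%C)
  (fun s => quoty Q lam0 y0 z0 n w s - quoty Q lam0 y0 z0 n 0 s - w * quoty Q lam0 y0 z0 (S n) w s)%C
  (fun s => quotz Q lam0 y0 z0 n w s - quotz Q lam0 y0 z0 n 0 s - w * quotz Q lam0 y0 z0 (S n) w s)%C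
  (A + Cmod (lam0 + w)%C) t) with (t := t) as [E1 E2]; trivial.
- intros s _; now apply pot_bound.
- intros s _; apply Cd_minus; [apply Cd_minus; trivial|now apply Cd_scal].
- intros s _; eapply Cd_val.
  + apply Cd_minus; [apply Cd_minus; [apply Z1|apply Z2]|apply Cd_scal, Z3].
  + simpl; fold (quoty Q lam0 y0 z0 n 0); unfold pot; ring.
- rewrite y1, y2, y3; simpl; ring.
- rewrite z1, z2, z3; simpl; ring.
- lra.
- assert (Eq : forall p q r : C, (p - q - r)%C = 0 -> p = (q + r)%C).
  { intros p q r E; replace p with (p - q - r + (q + r))%C by ring; rewrite E; ring. }
  split; now apply Eq.
Qed.

Lemma quot_taylor Q A lam0 y0 z0 t :
  (forall t, continuous Q t) -> (forall t, Rabs (Q t) <= A) -> 0 <= t ->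
  exists M, taylor_seq 1 4 M (fun n w => quoty Q lam0 y0 z0 n w t) /\
            taylor_seq 1 4 M (fun n w => quotz Q lam0 y0 z0 n w t).
Proof.
intros HQ HA Ht.
destruct (quot_spec Q A lam0 y0 z0 HQ HA) as (N & K & HK & HN & sp).
exists (N * exp (K * Rabs t)); split; intros n w Hw;
  destruct (quot_step Q A lam0 y0 z0 n w t HQ HA Hw Ht) as [E1 E2];
  destruct (sp n) as [_ sn]; destruct (sn w Hw) as (_ & _ & _ & _ & B1 & B2).
- split; [exact E1|]; eapply Rle_trans; [apply B2|right; ring].
- split; [exact E2|]; eapply Rle_trans; [apply B1|right; ring].
Qed.

Lemma SL_analytic Q A y0 z0 t lam0 :
  (forall t, continuous Q t) -> (forall t, Rabs (Q t) <= A) -> 0 <= t ->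
  analytic_at (fun lam => SLy Q lam y0 z0 t) lam0 /\
  analytic_at (fun lam => SLz Q lam y0 z0 t) lam0.
Proof.
intros HQ HA Ht; destruct (quot_taylor Q A lam0 y0 z0 t HQ HA Ht) as (M & Hy & Hz).
split.
- exists 1, 4, M, (fun n w => quoty Q lam0 y0 z0 n w t).
  repeat (split; [lra || assumption|]); reflexivity.
- exists 1, 4, M, (fun n w => quotz Q lam0 y0 z0 n w t).
  repeat (split; [lra || assumption|]); reflexivity.
Qed.

Lemma SL_spec Q A lam y0 z0 :
  (forall t, continuous Q t) -> (forall t, Rabs (Q t) <= A) ->
  (forall t, Cd (SLy Q lam y0 z0) t (SLz Q lam y0 z0 t)) /\
  (forall t, Cd (SLz Q lam y0 z0) t (pot Q lam t * SLy Q lam y0 z0 t)%C) /\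
  SLy Q lam y0 z0 0 = y0 /\ SLz Q lam y0 z0 0 = z0.
Proof.
intros HQ HA.
set (A' := A + Cmod lam).
assert (HA' : 0 <= A')
  by (unfold A'; generalize (HA 0) (Rabs_pos (Q 0)) (Cmod_ge_0 lam); lra).
destruct (linear_ode_exists (pot Q lam) (fun _ => RtoC 0) y0 z0 A' (1 + 2 * A') 0)
  as (D1 & D2 & I1 & I2 & _); try lra; try nra.
- now apply pot_cont.
- intros t; apply Ccont_const.
- intros t; now apply pot_bound.
- intros t; rewrite Cmod_0; lra.
- split; [exact D1|]; split; [|split; [exact I1|exact I2]].
  intros t; eapply Cd_val; [apply D2|]; cbv beta; unfold SLy; ring.
Qed.

Lemma continuous_zero_limit (f : R -> R) x :
  continuous f x -> (forall de, 0 < de -> exists s, Rabs (s - x) < de /\ f s = 0) -> f x = 0.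
Proof.
intros Hf Hd; apply NNPP; intros N.
assert (P : 0 < Rabs (f x)) by now apply Rabs_pos_lt.
destruct (proj1 (filterlim_locally f (f x)) Hf (mkposreal _ P)) as [de Hde].
destruct (Hd de (cond_pos de)) as (s & Hs & Es).
specialize (Hde s Hs); change (Rabs (f s - f x) < Rabs (f x)) in Hde.
rewrite Es, Rminus_0_l, Rabs_Ropp in Hde; lra.
Qed.

Lemma Ccont_zero_limit (f : R -> C) x :
  Ccont f x -> (forall de, 0 < de -> exists s, Rabs (s - x) < de /\ f s = 0) -> f x = 0.
Proof.
intros [F1 F2] Hd; apply injective_projections; simpl.
- apply (continuous_zero_limit (fun s => fst (f s))); trivial.
  intros de Hde; destruct (Hd de Hde) as (s & Hs & Es); exists s; now rewrite Es.
- apply (continuous_zero_limit (fun s => snd (f s))); trivial.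
  intros de Hde; destruct (Hd de Hde) as (s & Hs & Es); exists s; now rewrite Es.
Qed.

Lemma Ccont_zero_closed (f : R -> C) T :
  0 < T -> (forall t, 0 <= t <= T -> Ccont f t) -> (forall t, 0 < t < T -> f t = 0) ->
  forall t, 0 <= t <= T -> f t = 0.
Proof.
intros HT Hf Hz t Ht; apply Ccont_zero_limit; [now apply Hf|].
intros de Hde.
assert (m1 := Rmin_l de T); assert (m2 := Rmin_r de T).
assert (m : 0 < Rmin de T) by now apply Rmin_pos.
destruct (Rle_dec t (T / 2)) as [L|G].
- exists (t + Rmin de T / 3); split.
  + replace (t + Rmin de T / 3 - t) with (Rmin de T / 3) by ring.
    rewrite Rabs_pos_eq; lra.
  + apply Hz; lra.
- exists (t - Rmin de T / 3); split.
  + replace (t - Rmin de T / 3 - t) with (- (Rmin de T / 3)) by ring.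
    rewrite Rabs_Ropp, Rabs_pos_eq; lra.
  + apply Hz; lra.
Qed.

Lemma Cd_zero_open (f : R -> C) a b t d :
  a < t < b -> (forall s, a < s < b -> f s = 0) -> Cd f t d -> d = 0.
Proof.
intros Ht Hf Hd; apply (Cd_unique f t); [exact Hd|].
assert (L : locally t (fun s => f s = 0)).
{ assert (P : 0 < Rmin (t - a) (b - t)) by (apply Rmin_pos; lra).
  exists (mkposreal _ P); intros s Hs; change (Rabs (s - t) < Rmin (t - a) (b - t)) in Hs.
  assert (m1 := Rmin_l (t - a) (b - t)); assert (m2 := Rmin_r (t - a) (b - t)).
  apply Rabs_lt_between in Hs; apply Hf; lra. }
split; simpl.
- apply (is_derive_ext_loc (fun _ => 0)); [|exact (is_derive_const 0 t)].
  revert L; apply filter_imp; intros s ->; reflexivity.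
- apply (is_derive_ext_loc (fun _ => 0)); [|exact (is_derive_const 0 t)].
  revert L; apply filter_imp; intros s ->; reflexivity.
Qed.

Lemma Cd_conj f t d : Cd f t d -> Cd (fun s => Cconj (f s)) t (Cconj d).
Proof.
intros [F1 F2]; split; simpl; [exact F1|].
exact (is_derive_opp _ _ _ F2).
Qed.

(** The conjugate solves the same initial value problem, whose coefficients and data are real. *)
Lemma SL_real Q A (l a b : R) :
  (forall t, continuous Q t) -> (forall t, Rabs (Q t) <= A) ->
  forall t, 0 <= t -> snd (SLy Q (RtoC l) (RtoC a) (RtoC b) t) = 0.
Proof.
intros HQ HA t Ht.
destruct (SL_spec Q A (RtoC l) (RtoC a) (RtoC b) HQ HA) as (Y & Z & y & z).
set (u := SLy Q (RtoC l) (RtoC a) (RtoC b)) in *.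
set (v := SLz Q (RtoC l) (RtoC a) (RtoC b)) in *.
clearbody u v.
destruct (linear_ode_unique (pot Q (RtoC l)) (fun s => u s - Cconj (u s))%C
  (fun s => v s - Cconj (v s))%C (A + Cmod (RtoC l)) t) with (t := t) as [E _]; trivial.
- intros s _; now apply pot_bound.
- intros s _; apply Cd_minus; [apply Y|apply Cd_conj, Y].
- intros s _; eapply Cd_val; [apply Cd_minus; [apply Z|apply Cd_conj, Z]|].
  unfold pot; apply injective_projections; simpl; ring.
- rewrite y; apply injective_projections; simpl; ring.
- rewrite z; apply injective_projections; simpl; ring.
- lra.
- apply (f_equal snd) in E; simpl in E; lra.
Qed.

(* The Wronskian of the solution and its [lam]-derivative has derivative [y^2]. *)
Lemma simple_zero Q A (l a b H T : R) :
  (forall t, continuous Q t) -> (forall t, Rabs (Q t) <= A) -> 0 < T ->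
  ~ (a = 0 /\ b = 0) ->
  (SLz Q (RtoC l) (RtoC a) (RtoC b) T + RtoC H * SLy Q (RtoC l) (RtoC a) (RtoC b) T)%C = 0 ->
  (quotz Q (RtoC l) (RtoC a) (RtoC b) 1 0 T
    + RtoC H * quoty Q (RtoC l) (RtoC a) (RtoC b) 1 0 T)%C <> 0.
Proof.
intros HQ HA HT Hab Hbc N.
destruct (SL_spec Q A (RtoC l) (RtoC a) (RtoC b) HQ HA) as (Y & Z & y & z).
assert (Im0 := SL_real Q A l a b HQ HA).
destruct (quot_spec Q A (RtoC l) (RtoC a) (RtoC b) HQ HA) as (N' & K & _ & _ & sp).
destruct (sp 1%nat) as [_ s1]; destruct (s1 (RtoC 0)) as (Y1 & Z1 & y1 & z1 & _);
  [rewrite Cmod_0; lra|].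
cbn [forcing init] in Z1.
replace (RtoC l + 0)%C with (RtoC l) in Z1 by ring.
fold (SLy Q (RtoC l) (RtoC a) (RtoC b)) in Z1.
set (u := SLy Q (RtoC l) (RtoC a) (RtoC b)) in *.
set (v := SLz Q (RtoC l) (RtoC a) (RtoC b)) in *.
set (u1 := quoty Q (RtoC l) (RtoC a) (RtoC b) 1 0) in *.
set (v1 := quotz Q (RtoC l) (RtoC a) (RtoC b) 1 0) in *.
clearbody u v u1 v1.
set (W := fun s => (v s * u1 s - u s * v1 s)%C).
assert (DW : forall s, Cd W s (u s * u s)%C).
{ intros s; eapply Cd_val.
  - apply Cd_minus; apply Cd_mult; [apply Z|apply Y1|apply Y|apply Z1].
  - ring. }
assert (W0 : W 0 = 0) by (unfold W; rewrite y1, z1; simpl; ring).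
(* [N] supposes that the [lam]-derivative of the boundary form vanishes too. The pairs at [T] are
   then proportional and [W T = 0]. As [u] is real, [W' = u^2 >= 0], so [W] cannot leave 0 and [u]
   vanishes. *)
assert (WT : W T = 0).
{ unfold W.
  replace (v T * u1 T - u T * v1 T)%C with
    ((v T + RtoC H * u T) * u1 T - u T * (v1 T + RtoC H * u1 T))%C by ring.
  rewrite Hbc, N; ring. }
assert (sq : forall s, 0 <= s -> fst (u s * u s)%C = fst (u s) * fst (u s)).
{ intros s Hs; simpl; rewrite (Im0 s Hs); ring. }
assert (mono : forall p q, 0 <= p <= q -> fst (W p) <= fst (W q)).
{ intros p q Hpq.
  destruct (MVT_gen (fun s => fst (W s)) p q (fun s => fst (u s * u s)%C)) as (c & Hc & E).
  - intros x _; apply DW.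
  - intros x _; apply continuity_pt_filterlim.
    apply (ex_derive_continuous (fun s => fst (W s))); eexists; apply DW.
  - rewrite Rmin_left, Rmax_right in Hc by lra.
    rewrite sq in E by lra; nra. }
assert (Wz : forall s, 0 < s < T -> fst (W s) = 0).
{ intros s Hs; generalize (mono 0 s) (mono s T); rewrite W0, WT; simpl; lra. }
assert (uz : forall s, 0 < s < T -> u s = 0).
{ intros s Hs.
  assert (E : RtoC (fst (u s * u s)%C) = 0).
  { apply (Cd_zero_open (fun r => RtoC (fst (W r))) 0 T s); trivial.
    - intros r Hr; now rewrite Wz.
    - split; simpl; [apply DW|exact (is_derive_const 0 s)]. }
  apply RtoC_inj in E; rewrite sq in E by lra.
  apply injective_projections; simpl; [nra|apply Im0; lra]. }
assert (vz : forall s, 0 < s < T -> v s = 0).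
{ intros s Hs; exact (Cd_zero_open u 0 T s (v s) Hs uz (Y s)). }
apply Hab; split; apply RtoC_inj.
- rewrite <- y; apply (Ccont_zero_closed u T); trivial; [|lra].
  intros t _; eapply Cd_cont, Y.
- rewrite <- z; apply (Ccont_zero_closed v T); trivial; [|lra].
  intros t _; eapply Cd_cont, Z.
Qed.

(** * Asymptotics for large spectral parameter *)

(* [eix rho s] is [exp (i rho s)]. *)
Definition eix (rho : C) (s : R) : C :=
  (exp (- (snd rho * s)) * cos (fst rho * s), exp (- (snd rho * s)) * sin (fst rho * s)).

Lemma eix_deriv rho s : Cd (eix rho) s (Ci * rho * eix rho s)%C.
Proof. split; simpl; auto_derive; trivial; ring. Qed.

Lemma eix_mod rho s : Cmod (eix rho s) = exp (- (snd rho * s)).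
Proof.
unfold Cmod, eix; simpl.
replace (_ + _) with (Rsqr (exp (- (snd rho * s)))).
- apply sqrt_Rsqr; left; apply exp_pos.
- generalize (sin2_cos2 (fst rho * s)); unfold Rsqr; intros E.
  transitivity (exp (- (snd rho * s)) * exp (- (snd rho * s))
    * (sin (fst rho * s) * sin (fst rho * s) + cos (fst rho * s) * cos (fst rho * s))).
  + rewrite E; ring.
  + ring.
Qed.

Lemma eix_mod_le rho s : 0 <= s -> Cmod (eix rho s) <= exp (Rabs (snd rho) * s).
Proof.
intros Hs; rewrite eix_mod; apply exp_le_mono.
generalize (Rle_abs (- snd rho)); rewrite Rabs_Ropp; intros; nra.
Qed.

Lemma eix_0 rho : eix rho 0 = 1.
Proof. unfold eix; rewrite !Rmult_0_r, Ropp_0, exp_0, cos_0, sin_0, Rmult_0_r, Rmult_1_r; reflexivity. Qed.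

(** The combination [w = z + i rho y] satisfies the first order equation [w' = i rho w + Q y].
    Multiplying by [exp (i rho (t - s))] and integrating in [s] leaves only [Q y]; the weights
    [exp (k (t - s))] and [exp (k s)], with [k = |Im rho|], multiply to a constant in [s]. *)
Lemma wave_step (y z : R -> C) (Q : R -> R) (A T m : R) (rho : C) :
  0 <= m ->
  (forall t, 0 <= t <= T -> Rabs (Q t) <= A) ->
  (forall t, 0 <= t <= T -> Cd y t (z t)) ->
  (forall t, 0 <= t <= T -> Cd z t (pot Q (rho * rho)%C t * y t)%C) ->
  (forall t, 0 <= t <= T -> Cmod (y t) <= m * exp (Rabs (snd rho) * t)) ->
  forall t, 0 <= t <= T ->
  Cmod (z t + Ci * rho * y t - eix rho t * (z 0 + Ci * rho * y 0))%C
    <= T * A * m * exp (Rabs (snd rho) * t).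
Proof.
intros Hm HA Hy Hz Hb t Ht.
assert (HA0 : 0 <= A) by (generalize (HA t Ht) (Rabs_pos (Q t)); lra).
set (c := A * m * exp (Rabs (snd rho) * t)).
assert (Hc : 0 <= c)
  by (unfold c; repeat apply Rmult_le_pos; trivial; left; apply exp_pos).
set (g := fun s => (eix rho (t - s)%R * (z s + Ci * rho * y s))%C).
assert (B : Cmod (g t - g 0) <= c * t - c * 0).
{ apply (Cd_mean_value g (fun s => eix rho (t - s)%R * (RtoC (Q s) * y s))%C
    (fun s => c * s) (fun _ => c)).
  - lra.
  - intros s Hs; unfold g; eapply Cd_val.
    + apply Cd_mult.
      * eapply (Cd_comp (eix rho) (fun s => t - s) s _ (-1)); [apply eix_deriv|].
        auto_derive; trivial; ring.
      * apply Cd_plus; [apply Hz; lra|apply Cd_scal, Hy; lra].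
    + cbv beta; unfold pot.
      (* [ring] does not know that [Ci * Ci = -1], so the terms that cancel for this reason are
         grouped first. *)
      assert (Ci2 : (Ci * Ci)%C = RtoC (-1)) by (apply injective_projections; simpl; ring).
      assert (E1 : (RtoC (-1) * (Ci * rho * eix rho (t - s)%R) * (z s + Ci * rho * y s)
        + eix rho (t - s)%R * ((RtoC (Q s) - rho * rho) * y s + Ci * rho * z s)
        = eix rho (t - s)%R * (RtoC (Q s) * y s + ((RtoC (-1) + RtoC 1) * Ci * rho * z s)
           + (RtoC (-1) * (Ci * Ci) - RtoC 1) * rho * rho * y s))%C) by ring.
      rewrite E1, Ci2, <- RtoC_mult, <- RtoC_plus, <- RtoC_minus.
      replace (-1 + 1) with 0 by ring; replace (-1 * -1 - 1) with 0 by ring; ring.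
  - intros s _; auto_derive; trivial; ring.
  - intros s Hs; rewrite !Cmod_mult, Cmod_R.
    replace c with (exp (Rabs (snd rho) * (t - s)) * (A * (m * exp (Rabs (snd rho) * s)))).
    + apply Rmult_le_compat; [apply Cmod_ge_0| |apply eix_mod_le; lra|].
      * apply Rmult_le_pos; [apply Rabs_pos|apply Cmod_ge_0].
      * apply Rmult_le_compat; [apply Rabs_pos|apply Cmod_ge_0|apply HA; lra|apply Hb; lra].
    + unfold c.
      replace (Rabs (snd rho) * t) with (Rabs (snd rho) * (t - s) + Rabs (snd rho) * s) by ring.
      rewrite exp_plus; ring. }
unfold g in B; rewrite Rminus_diag, Rminus_0_r, eix_0, Cmult_1_l in B.
eapply Rle_trans; [exact B|]; unfold c in *; nra.
Qed.

(** [m] is the maximum of [|y| exp (- k s)]. The waves for [rho] and [- rho] differ by [2 i rho y],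
    which bounds [2 m |rho|] by the initial waves plus [2 T A m]; as [2 T A <= |rho|], the last term
    is absorbed on the left. *)
Lemma wave_asymptotics (y z : R -> C) (Q : R -> R) (A T : R) (rho : C) :
  0 <= T -> 0 < Cmod rho -> 2 * (T * A) <= Cmod rho ->
  (forall t, 0 <= t <= T -> Rabs (Q t) <= A) ->
  (forall t, 0 <= t <= T -> Cd y t (z t)) ->
  (forall t, 0 <= t <= T -> Cd z t (pot Q (rho * rho)%C t * y t)%C) ->
  exists m, 0 <= m /\
  m * Cmod rho <= Cmod (z 0 + Ci * rho * y 0)%C + Cmod (z 0 - Ci * rho * y 0)%C /\
  forall t, 0 <= t <= T ->
  Cmod (y t) <= m * exp (Rabs (snd rho) * t) /\
  Cmod (z t + Ci * rho * y t - eix rho t * (z 0 + Ci * rho * y 0))%C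
    <= T * A * m * exp (Rabs (snd rho) * t) /\
  Cmod (z t - Ci * rho * y t - eix (- rho) t * (z 0 - Ci * rho * y 0))%C
    <= T * A * m * exp (Rabs (snd rho) * t).
Proof.
intros HT Hrho Hlarge HA Hy Hz.
set (k := Rabs (snd rho)).
destruct (continuity_ab_maj (fun s => Cmod (y s) * exp (- (k * s))) 0 T HT) as [p [Hp Hp2]].
{ intros s Hs; apply continuity_pt_filterlim.
  apply (continuous_mult (fun s => Cmod (y s)) (fun s => exp (- (k * s)))).
  - eapply Ccont_Cmod, Cd_cont, Hy, Hs.
  - apply (ex_derive_continuous (fun s => exp (- (k * s)))); auto_derive; trivial. }
set (m := Cmod (y p) * exp (- (k * p))) in *.
assert (Ee : forall s, exp (- (k * s)) * exp (k * s) = 1).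
{ intros s; rewrite <- exp_plus, <- exp_0; f_equal; ring. }
assert (B1 : forall s, 0 <= s <= T -> Cmod (y s) <= m * exp (k * s)).
{ intros s Hs; specialize (Hp s Hs).
  apply Rmult_le_compat_r with (r := exp (k * s)) in Hp; [|left; apply exp_pos].
  rewrite Rmult_assoc, Ee in Hp; lra. }
assert (Hm : 0 <= m) by (apply Rmult_le_pos; [apply Cmod_ge_0|left; apply exp_pos]).
assert (HA0 : 0 <= A) by (generalize (HA p Hp2) (Rabs_pos (Q p)); lra).
assert (Wp := wave_step y z Q A T m rho Hm HA Hy Hz B1).
assert (Wm : forall t, 0 <= t <= T ->
  Cmod (z t - Ci * rho * y t - eix (- rho) t * (z 0 - Ci * rho * y 0))%C
    <= T * A * m * exp (k * t)).
{ intros t Ht.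
  assert (W := wave_step y z Q A T m (- rho)%C Hm HA Hy).
  simpl snd in W; rewrite Rabs_Ropp in W; fold k in W.
  replace (- rho * - rho)%C with (rho * rho)%C in W by ring.
  specialize (W Hz B1 t Ht).
  eapply Rle_trans; [|exact W]; right; f_equal; ring. }
exists m; split; [exact Hm|]; split.
- set (wp := (z 0 + Ci * rho * y 0)%C) in *; set (wm := (z 0 - Ci * rho * y 0)%C) in *.
  specialize (Wp p Hp2); specialize (Wm p Hp2); fold k in Wp.
  set (P := (z p + Ci * rho * y p - eix rho p * wp)%C) in *.
  set (N := (z p - Ci * rho * y p - eix (- rho) p * wm)%C) in *.
  assert (Ey : (RtoC 2 * Ci * rho * y p = P - N + (eix rho p * wp - eix (- rho) p * wm))%C).
  { unfold P, N; replace (RtoC 2) with (RtoC 1 + RtoC 1)%C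
      by (apply injective_projections; simpl; ring); ring. }
  assert (E2 : 2 * (Cmod rho * Cmod (y p)) <= (2 * (T * A * m) + (Cmod wp + Cmod wm)) * exp (k * p)).
  { replace (2 * (Cmod rho * Cmod (y p))) with (Cmod (RtoC 2 * Ci * rho * y p)%C)
      by (rewrite !Cmod_mult, Cmod_R, Cmod_Ci, Rabs_pos_eq; [ring|lra]).
    rewrite Ey; eapply Rle_trans; [apply Cmod_triangle|].
    assert (Cmod (P - N) <= Cmod P + Cmod N) by apply Cmod_minus_le.
    assert (Q1 := Cmod_minus_le (eix rho p * wp) (eix (- rho) p * wm)).
    rewrite !Cmod_mult in Q1.
    assert (e1 := eix_mod_le rho p (proj1 Hp2)); assert (e2 := eix_mod_le (- rho) p (proj1 Hp2)).
    simpl snd in e2; rewrite Rabs_Ropp in e2; fold k in e1, e2.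
    assert (f1 := Cmod_ge_0 wp); assert (f2 := Cmod_ge_0 wm).
    assert (g1 : Cmod (eix rho p) * Cmod wp <= exp (k * p) * Cmod wp)
      by (now apply Rmult_le_compat_r).
    assert (g2 : Cmod (eix (- rho) p) * Cmod wm <= exp (k * p) * Cmod wm)
      by (now apply Rmult_le_compat_r).
    lra. }
  apply Rmult_le_compat_r with (r := exp (- (k * p))) in E2; [|left; apply exp_pos].
  rewrite (Rmult_assoc _ (exp (k * p))), (Rmult_comm (exp (k * p))), Ee in E2.
  replace (2 * (Cmod rho * Cmod (y p)) * exp (- (k * p))) with (2 * (m * Cmod rho)) in E2
    by (unfold m; ring).
  nra.
- intros t Ht; split; [now apply B1|]; split; [now apply Wp|now apply Wm].
Qed.

(** The difference is [2 i sin (rho T)]. On vertical sides [|sin (x T)| = 1], and the two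
    exponentials add up in the imaginary part. On horizontal sides one exponential is at least twice
    the other because [R0 T >= 1]. *)
Lemma eix_diff_lower (R0 T x y : R) :
  0 < T -> 1 <= R0 * T -> cos (R0 * T) = 0 -> on_square R0 x y ->
  exp (Rabs y * T) / 2 <= Cmod (eix (x, y) T - eix (- (x, y)) T)%C.
Proof.
intros HT HRT Hcos [[Hx Hy] [Ex|Ey]].
- assert (C0 : cos (x * T) = 0).
  { unfold Rabs in Ex; destruct (Rcase_abs x) in Ex; rewrite <- Ex in Hcos; trivial.
    rewrite Ropp_mult_distr_l_reverse, cos_neg in Hcos; exact Hcos. }
  assert (S1 : Rabs (sin (x * T)) = 1).
  { generalize (sin2_cos2 (x * T)); rewrite C0; unfold Rsqr; intros.
    unfold Rabs; destruct (Rcase_abs (sin (x * T))); nra. }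
  eapply Rle_trans; [|apply snd_le_Cmod]; simpl.
  replace (- x * T) with (- (x * T)) by ring; replace (- y * T) with (- (y * T)) by ring.
  rewrite sin_neg, Ropp_involutive.
  replace (exp (- (y * T)) * sin (x * T) + - (exp (y * T) * - sin (x * T)))
    with ((exp (- (y * T)) + exp (y * T)) * sin (x * T)) by ring.
  rewrite Rabs_mult, S1, Rmult_1_r.
  generalize (exp_pos (- (y * T))) (exp_pos (y * T)); intros P1 P2.
  rewrite (Rabs_pos_eq (exp (- (y * T)) + exp (y * T))) by lra.
  unfold Rabs; destruct (Rcase_abs y); [|lra].
  replace (- y * T) with (- (y * T)) by ring; lra.
- assert (A1 : forall a b : C, Cmod a - Cmod b <= Cmod (a - b)) by apply Cmod_minus_ge.
  assert (E2 : exp (- (R0 * T)) <= exp (R0 * T) / 2).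
  { assert (2 <= exp (R0 * T)) by (generalize (exp_ineq1_le (R0 * T)); lra).
    assert (exp (- (R0 * T)) <= 1).
    { rewrite <- exp_0; apply exp_le_mono; lra. }
    lra. }
  rewrite Ey.
  unfold Rabs in Ey; destruct (Rcase_abs y).
  + specialize (A1 (eix (x, y) T) (eix (- (x, y)) T)).
    rewrite !eix_mod in A1; simpl in A1.
    replace (- (y * T)) with (R0 * T) in A1 by (rewrite <- Ey; ring).
    replace (- (- y * T)) with (- (R0 * T)) in A1 by (rewrite <- Ey; ring).
    lra.
  + specialize (A1 (eix (- (x, y)) T) (eix (x, y) T)).
    rewrite Cmod_minus_sym; rewrite !eix_mod in A1; simpl in A1; subst y.
    replace (- (- R0 * T)) with (R0 * T) in A1 by ring.
    lra.
Qed.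

(** The sum is [2 cos (rho T)], so the vertical sides are placed where the sine vanishes and the
    cosine has modulus 1. *)
Lemma eix_sum_lower (R0 T x y : R) :
  0 < T -> 1 <= R0 * T -> sin (R0 * T) = 0 -> on_square R0 x y ->
  exp (Rabs y * T) / 2 <= Cmod (eix (x, y) T + eix (- (x, y)) T)%C.
Proof.
intros HT HRT Hsin [[Hx Hy] [Ex|Ey]].
- assert (S0 : sin (x * T) = 0).
  { unfold Rabs in Ex; destruct (Rcase_abs x) in Ex; rewrite <- Ex in Hsin; trivial.
    rewrite Ropp_mult_distr_l_reverse, sin_neg in Hsin; lra. }
  assert (C1 : Rabs (cos (x * T)) = 1).
  { generalize (sin2_cos2 (x * T)); rewrite S0; unfold Rsqr; intros.
    unfold Rabs; destruct (Rcase_abs (cos (x * T))); nra. }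
  eapply Rle_trans; [|apply fst_le_Cmod]; simpl.
  replace (- x * T) with (- (x * T)) by ring; replace (- y * T) with (- (y * T)) by ring.
  rewrite cos_neg, Ropp_involutive, <- Rmult_plus_distr_r.
  rewrite Rabs_mult, C1, Rmult_1_r.
  generalize (exp_pos (- (y * T))) (exp_pos (y * T)); intros P1 P2.
  rewrite (Rabs_pos_eq (exp (- (y * T)) + exp (y * T))) by lra.
  unfold Rabs; destruct (Rcase_abs y); [|lra].
  replace (- y * T) with (- (y * T)) by ring; lra.
- assert (A1 : forall a b : C, Cmod a - Cmod b <= Cmod (a + b)).
  { intros a b; generalize (Cmod_minus_ge a (- b)); rewrite Cmod_opp.
    replace (a - - b)%C with (a + b)%C by ring; trivial. }
  assert (E2 : exp (- (R0 * T)) <= exp (R0 * T) / 2).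
  { assert (2 <= exp (R0 * T)) by (generalize (exp_ineq1_le (R0 * T)); lra).
    assert (exp (- (R0 * T)) <= 1).
    { rewrite <- exp_0; apply exp_le_mono; lra. }
    lra. }
  rewrite Ey.
  unfold Rabs in Ey; destruct (Rcase_abs y).
  + specialize (A1 (eix (x, y) T) (eix (- (x, y)) T)).
    rewrite !eix_mod in A1; simpl in A1.
    replace (- (y * T)) with (R0 * T) in A1 by (rewrite <- Ey; ring).
    replace (- (- y * T)) with (- (R0 * T)) in A1 by (rewrite <- Ey; ring).
    lra.
  + specialize (A1 (eix (- (x, y)) T) (eix (x, y) T)).
    rewrite Cplus_comm; rewrite !eix_mod in A1; simpl in A1; subst y.
    replace (- (- R0 * T)) with (R0 * T) in A1 by ring.
    lra.
Qed.

Lemma on_square_Cmod R0 x y : on_square R0 x y -> R0 <= Cmod (x, y).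
Proof.
intros [_ [E|E]]; rewrite <- E; [apply (fst_le_Cmod (x, y))|apply (snd_le_Cmod (x, y))].
Qed.

Lemma large_cos_zero (T X : R) : 0 < T -> exists R0, X < R0 /\ cos (R0 * T) = 0.
Proof.
intros HT; destruct (INR_unbounded (Rabs X * T)) as [n Hn].
exists ((PI / 2 + INR n * PI) / T); assert (P := PI_RGT_0); split.
- apply Rmult_lt_reg_r with T; [assumption|]; unfold Rdiv at 1.
  rewrite Rmult_assoc, Rinv_l, Rmult_1_r by lra.
  generalize (Rle_abs X) PI2_1 (pos_INR n) (Rabs_pos X); intros; nra.
- replace ((PI / 2 + INR n * PI) / T * T) with (PI / 2 + INR n * PI) by (field; lra).
  clear; induction n as [|n IH].
  + simpl; rewrite Rmult_0_l, Rplus_0_r; apply cos_PI2.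
  + rewrite S_INR; replace (PI / 2 + (INR n + 1) * PI) with (PI / 2 + INR n * PI + PI) by ring.
    rewrite neg_cos, IH; ring.
Qed.

Lemma large_sin_zero (T X : R) : 0 < T -> exists R0, X < R0 /\ sin (R0 * T) = 0.
Proof.
intros HT; destruct (INR_unbounded (Rabs X * T)) as [n Hn].
exists ((INR n * PI) / T); assert (P := PI_RGT_0); split.
- apply Rmult_lt_reg_r with T; [assumption|]; unfold Rdiv at 1.
  rewrite Rmult_assoc, Rinv_l, Rmult_1_r by lra.
  generalize (Rle_abs X) PI2_1 (pos_INR n) (Rabs_pos X); intros; nra.
- replace (INR n * PI / T * T) with (INR n * PI) by (field; lra).
  clear; induction n as [|n IH].
  + simpl; rewrite Rmult_0_l; apply sin_0.
  + rewrite S_INR; replace ((INR n + 1) * PI) with (INR n * PI + PI) by ring.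
    rewrite neg_sin, IH; ring.
Qed.

(** Sum and difference of the two waves: for data [(1, h)] the leading terms are [cos (rho t)] for
    [y] and [-rho sin (rho t)] for [z]. [M] comes from [m |rho| <= 2 |h| + 2 |rho|] and
    [|rho| >= 1]. *)
Lemma robin_estimates (y z : R -> C) (Q : R -> R) (A T h : R) (rho : C) :
  0 <= T -> 1 <= Cmod rho -> 2 * (T * A) <= Cmod rho ->
  (forall t, 0 <= t <= T -> Rabs (Q t) <= A) ->
  (forall t, 0 <= t <= T -> Cd y t (z t)) ->
  (forall t, 0 <= t <= T -> Cd z t (pot Q (rho * rho)%C t * y t)%C) ->
  y 0 = RtoC 1 -> z 0 = RtoC h ->
  forall t, 0 <= t <= T ->
  let e := exp (Rabs (snd rho) * t) in
  let M := 2 + 2 * Rabs h in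
  Cmod (y t) <= M * e /\
  Cmod (RtoC 2 * z t - Ci * rho * (eix rho t - eix (- rho) t))%C
    <= 2 * (T * A * M + Rabs h) * e /\
  Cmod (RtoC 2 * Ci * rho * y t - Ci * rho * (eix rho t + eix (- rho) t))%C
    <= 2 * (T * A * M + Rabs h) * e.
Proof.
intros HT H1 H2 HA Hy Hz y0 z0 t Ht e M.
assert (HA0 : 0 <= A) by (generalize (HA t Ht) (Rabs_pos (Q t)); lra).
destruct (wave_asymptotics y z Q A T rho) as (m & Hm & Hm2 & W); trivial; [lra|].
assert (HmM : m <= M).
{ assert (Cmod (z 0 + Ci * rho * y 0)%C <= Rabs h + Cmod rho).
  { rewrite y0, z0; eapply Rle_trans; [apply Cmod_triangle|].
    rewrite !Cmod_mult, !Cmod_R, Cmod_Ci, Rabs_R1; lra. }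
  assert (Cmod (z 0 - Ci * rho * y 0)%C <= Rabs h + Cmod rho).
  { rewrite y0, z0; eapply Rle_trans; [apply Cmod_minus_le|].
    rewrite !Cmod_mult, !Cmod_R, Cmod_Ci, Rabs_R1; lra. }
  unfold M; generalize (Rabs_pos h); intros; nra. }
destruct (W t Ht) as (W1 & W2 & W3); clear W.
rewrite y0, z0 in W2, W3; fold e in W1, W2, W3.
assert (He : 0 < e) by apply exp_pos.
assert (HTA : 0 <= T * A) by now apply Rmult_le_pos.
assert (b1 : T * A * m * e <= T * A * M * e).
{ apply Rmult_le_compat_r; [lra|]; now apply Rmult_le_compat_l. }
assert (e1 := eix_mod_le rho t (proj1 Ht)); assert (e2 := eix_mod_le (- rho) t (proj1 Ht)).
simpl snd in e2; rewrite Rabs_Ropp in e2; fold e in e1, e2.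
set (E1 := eix rho t) in *; set (E2 := eix (- rho) t) in *; clearbody E1 E2.
set (P := (z t + Ci * rho * y t - E1 * (RtoC h + Ci * rho * RtoC 1))%C) in *.
set (N := (z t - Ci * rho * y t - E2 * (RtoC h - Ci * rho * RtoC 1))%C) in *.
assert (R2 : RtoC 2 = (RtoC 1 + RtoC 1)%C) by (apply injective_projections; simpl; ring).
assert (hb : forall X : C, Cmod X <= 2 * e -> Cmod (RtoC h * X) <= 2 * (Rabs h * e)).
{ intros X HX; rewrite Cmod_mult, Cmod_R; generalize (Rabs_pos h); intros; nra. }
split; [|split].
- eapply Rle_trans; [exact W1|]; apply Rmult_le_compat_r; lra.
- replace (RtoC 2 * z t - Ci * rho * (E1 - E2))%C with (P + N + RtoC h * (E1 + E2))%C
    by (unfold P, N; rewrite R2; ring).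
  assert (T1 := Cmod_triangle (P + N) (RtoC h * (E1 + E2))).
  assert (T2 := Cmod_triangle P N).
  assert (T3 := hb (E1 + E2)%C ltac:(eapply Rle_trans; [apply Cmod_triangle|lra])).
  lra.
- replace (RtoC 2 * Ci * rho * y t - Ci * rho * (E1 + E2))%C with (P - N + RtoC h * (E1 - E2))%C
    by (unfold P, N; rewrite R2; ring).
  assert (T1 := Cmod_triangle (P - N) (RtoC h * (E1 - E2))).
  assert (T2 := Cmod_minus_le P N).
  assert (T3 := hb (E1 - E2)%C ltac:(eapply Rle_trans; [apply Cmod_minus_le|lra])).
  lra.
Qed.

(** * Characteristic functions: [D] for the data [(1, h)], [D1] for [(0, 1)] *)

Definition charf (Q : R -> R) (T H : R) (y0 z0 lam : C) : C :=
  (SLz Q lam y0 z0 T + RtoC H * SLy Q lam y0 z0 T)%C.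

Lemma charf_robin_asymptotics Q A T h H :
  (forall t, continuous Q t) -> (forall t, Rabs (Q t) <= A) -> 0 < T ->
  exists K, 0 <= K /\ forall rho, 1 + 2 * (T * A) <= Cmod rho ->
  Cmod (RtoC 2 * charf Q T H (RtoC 1) (RtoC h) (rho * rho)
    - Ci * rho * (eix rho T - eix (- rho) T))%C <= K * exp (Rabs (snd rho) * T).
Proof.
intros HQ HA HT.
assert (HA0 : 0 <= A) by (generalize (HA 0) (Rabs_pos (Q 0)); lra).
assert (HTA : 0 <= T * A) by (apply Rmult_le_pos; lra).
set (M := 2 + 2 * Rabs h).
assert (HM : 0 <= M) by (unfold M; generalize (Rabs_pos h); lra).
assert (P1 := Rabs_pos h); assert (P2 := Rabs_pos H).
exists (2 * (T * A * M + Rabs h) + 2 * (Rabs H * M)); split; [nra|].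
intros rho Hr.
destruct (SL_spec Q A (rho * rho)%C (RtoC 1) (RtoC h) HQ HA) as (Y & Z & y0 & z0).
destruct (robin_estimates _ _ Q A T h rho ltac:(lra) ltac:(lra) ltac:(lra) (fun t _ => HA t)
  (fun t _ => Y t) (fun t _ => Z t) y0 z0 T ltac:(lra)) as (B1 & B2 & _).
fold M in B1, B2; unfold charf.
set (y := SLy Q (rho * rho)%C (RtoC 1) (RtoC h) T) in *.
set (z := SLz Q (rho * rho)%C (RtoC 1) (RtoC h) T) in *.
set (E := (Ci * rho * (eix rho T - eix (- rho) T))%C) in *.
set (e := exp (Rabs (snd rho) * T)) in *.
replace (RtoC 2 * (z + RtoC H * y) - E)%C with ((RtoC 2 * z - E) + RtoC 2 * RtoC H * y)%C by ring.
eapply Rle_trans; [apply Cmod_triangle|].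
rewrite !Cmod_mult, !Cmod_R, (Rabs_pos_eq 2) by lra.
assert (2 * Rabs H * Cmod y <= 2 * Rabs H * (M * e)) by (apply Rmult_le_compat_l; lra).
lra.
Qed.

(** For data [(0, 1)] both initial waves equal 1, hence [m |rho| <= 2]. Everything is one power of
    [rho] smaller than for data [(1, h)], which is the factor [Cmod rho] on the left. *)
Lemma charf_dirichlet_asymptotics Q A T H :
  (forall t, continuous Q t) -> (forall t, Rabs (Q t) <= A) -> 0 < T ->
  exists K, 0 <= K /\ forall rho, 1 + 2 * (T * A) <= Cmod rho ->
  Cmod rho * Cmod (RtoC 2 * charf Q T H (RtoC 0) (RtoC 1) (rho * rho)
    - (eix rho T + eix (- rho) T))%C <= K * exp (Rabs (snd rho) * T).
Proof.
intros HQ HA HT.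
assert (HA0 : 0 <= A) by (generalize (HA 0) (Rabs_pos (Q 0)); lra).
assert (HTA : 0 <= T * A) by (apply Rmult_le_pos; lra).
assert (P2 := Rabs_pos H).
exists (4 * (T * A + Rabs H)); split; [lra|].
intros rho Hr.
destruct (SL_spec Q A (rho * rho)%C (RtoC 0) (RtoC 1) HQ HA) as (Y & Z & y0 & z0).
destruct (wave_asymptotics _ _ Q A T rho ltac:(lra) ltac:(lra) ltac:(lra) (fun t _ => HA t)
  (fun t _ => Y t) (fun t _ => Z t)) as (m & Hm & Hm2 & W).
destruct (W T ltac:(lra)) as (B1 & B2 & B3).
rewrite y0, z0 in Hm2, B2, B3; unfold charf.
replace (RtoC 1 + Ci * rho * 0)%C with (RtoC 1) in Hm2, B2 by ring.
replace (RtoC 1 - Ci * rho * 0)%C with (RtoC 1) in Hm2, B3 by ring.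
rewrite Cmod_1 in Hm2.
set (y := SLy Q (rho * rho)%C (RtoC 0) (RtoC 1) T) in *.
set (z := SLz Q (rho * rho)%C (RtoC 0) (RtoC 1) T) in *.
set (e := exp (Rabs (snd rho) * T)) in *.
assert (He : 0 < e) by apply exp_pos.
set (E1 := eix rho T) in *; set (E2 := eix (- rho) T) in *.
assert (R2 : RtoC 2 = (RtoC 1 + RtoC 1)%C) by (apply injective_projections; simpl; ring).
assert (B : Cmod (RtoC 2 * (z + RtoC H * y) - (E1 + E2))%C <= 2 * (T * A + Rabs H) * m * e).
{ replace (RtoC 2 * (z + RtoC H * y) - (E1 + E2))%C with
    ((z + Ci * rho * y - E1 * 1) + (z - Ci * rho * y - E2 * 1) + RtoC 2 * RtoC H * y)%C
    by (rewrite R2; ring).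
  eapply Rle_trans; [apply Cmod_triangle|].
  eapply Rle_trans; [apply Rplus_le_compat_r, Cmod_triangle|].
  rewrite !Cmod_mult, !Cmod_R, (Rabs_pos_eq 2) by lra.
  assert (2 * Rabs H * Cmod y <= 2 * Rabs H * (m * e)) by (apply Rmult_le_compat_l; lra).
  lra. }
eapply Rle_trans; [apply Rmult_le_compat_l; [apply Cmod_ge_0|exact B]|].
replace (Cmod rho * (2 * (T * A + Rabs H) * m * e)) with (2 * (T * A + Rabs H) * e * (m * Cmod rho)) by ring.
replace (4 * (T * A + Rabs H) * e) with (2 * (T * A + Rabs H) * e * 2) by ring.
apply Rmult_le_compat_l; [|lra].
apply Rmult_le_pos; lra.
Qed.

(** Supplies the simple zeros that [same_zeros_eq] asks for: the first Taylor coefficient is the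
    [lam]-derivative of [simple_zero], which speaks of real [lam]. *)
Lemma charf_taylor Q A T H (a b : R) lam0 :
  (forall t, continuous Q t) -> (forall t, Rabs (Q t) <= A) -> 0 < T ->
  ~ (a = 0 /\ b = 0) ->
  (charf Q T H (RtoC a) (RtoC b) lam0 = 0 -> exists l : R, lam0 = RtoC l) ->
  exists d B M F, 0 < d /\ 0 <= B /\ taylor_seq d B M F /\
     (forall w, Cmod w <= d -> charf Q T H (RtoC a) (RtoC b) (lam0 + w)%C = F O w) /\
     (charf Q T H (RtoC a) (RtoC b) lam0 = 0 -> F 1%nat (RtoC 0) <> 0).
Proof.
intros HQ HA HT Hab real0.
destruct (quot_taylor Q A lam0 (RtoC a) (RtoC b) T HQ HA ltac:(lra)) as (M & Hy & Hz).
exists 1, 4, (M + Cmod (RtoC H) * M), (fun n w => quotz Q lam0 (RtoC a) (RtoC b) n w T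
  + RtoC H * quoty Q lam0 (RtoC a) (RtoC b) n w T)%C.
split; [lra|]; split; [lra|]; split; [exact (taylor_seq_lin 1 4 M M _ _ (RtoC H) Hz Hy)|].
split; [reflexivity|].
intros E; destruct (real0 E) as [l ->].
now apply (simple_zero Q A l a b H T).
Qed.

Lemma charf_analytic Q A T H y0 z0 lam0 :
  (forall t, continuous Q t) -> (forall t, Rabs (Q t) <= A) -> 0 < T ->
  analytic_at (charf Q T H y0 z0) lam0.
Proof.
intros HQ HA HT.
destruct (SL_analytic Q A y0 z0 T lam0 HQ HA ltac:(lra)) as [Hy Hz].
exact (analytic_at_lin _ _ (RtoC H) lam0 Hz Hy).
Qed.

Lemma charf_robin_lower Q A T h H :
  (forall t, continuous Q t) -> (forall t, Rabs (Q t) <= A) -> 0 < T ->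
  forall L X, exists R0, X < R0 /\ forall x y, on_square R0 x y ->
    L * exp (Rabs y * T) <= Cmod (charf Q T H (RtoC 1) (RtoC h) ((x, y) * (x, y))%C).
Proof.
intros HQ HA HT L X.
destruct (charf_robin_asymptotics Q A T h H HQ HA HT) as (K & HK & HB).
assert (HA0 : 0 <= A) by (generalize (HA 0) (Rabs_pos (Q 0)); lra).
assert (HTA : 0 <= T * A) by (apply Rmult_le_pos; lra).
(* [1 / T] gives [R0 T >= 1]. With [2 * K + 4 * Rabs L] the leading term, at least [R0 e / 2], still
   exceeds [2 |L| e] after the error [K e] is subtracted. *)
destruct (large_cos_zero T (Rabs X + (1 + 2 * (T * A)) + 1 / T + 2 * K + 4 * Rabs L) HT)
  as (R0 & HR & Hcos).
assert (a1 := Rle_abs X); assert (a2 := Rle_abs L).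
assert (a3 := Rabs_pos X); assert (a4 := Rabs_pos L).
assert (HT1 : 0 < 1 / T) by (apply Rdiv_lt_0_compat; lra).
exists R0; split; [lra|]; intros x y Hon.
assert (Hmod := on_square_Cmod R0 x y Hon).
assert (HRT : 1 <= R0 * T).
{ replace 1 with (1 / T * T) by (field; lra); apply Rmult_le_compat_r; lra. }
assert (low := eix_diff_lower R0 T x y HT HRT Hcos Hon).
specialize (HB (x, y) ltac:(lra)); simpl snd in HB.
set (D := charf Q T H (RtoC 1) (RtoC h) ((x, y) * (x, y))%C) in *.
set (E := (eix (x, y) T - eix (- (x, y)) T)%C) in *.
set (e := exp (Rabs y * T)) in *.
assert (He : 0 < e) by apply exp_pos.
assert (T1 := Cmod_minus_ge (Ci * (x, y) * E) (Ci * (x, y) * E - RtoC 2 * D)).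
replace (Ci * (x, y) * E - (Ci * (x, y) * E - RtoC 2 * D))%C with (RtoC 2 * D)%C in T1 by ring.
rewrite (Cmod_minus_sym (Ci * (x, y) * E)) in T1.
rewrite !Cmod_mult, Cmod_Ci, Cmod_R, (Rabs_pos_eq 2) in T1 by lra.
assert (T2 : R0 * (e / 2) <= Cmod (x, y) * Cmod E) by (apply Rmult_le_compat; lra).
assert (T3 : (2 * K + 4 * Rabs L) * (e / 2) <= R0 * (e / 2)) by (apply Rmult_le_compat_r; lra).
assert (T4 : L * e <= Rabs L * e) by (apply Rmult_le_compat_r; lra).
lra.
Qed.

(** The common leading term cancels, so the difference is of order [exp (|Im rho| T)], while
    [charf_robin_lower] makes [D] exceed any multiple of it. *)
Lemma charf_robin_eq Q Qt A T h H ht Ht :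
  (forall t, continuous Q t) -> (forall t, Rabs (Q t) <= A) ->
  (forall t, continuous Qt t) -> (forall t, Rabs (Qt t) <= A) -> 0 < T ->
  (forall z, charf Q T H (RtoC 1) (RtoC h) z = 0 -> exists l : R, z = RtoC l) ->
  (forall z, charf Q T H (RtoC 1) (RtoC h) z = 0 -> charf Qt T Ht (RtoC 1) (RtoC ht) z = 0) ->
  forall z, charf Qt T Ht (RtoC 1) (RtoC ht) z = charf Q T H (RtoC 1) (RtoC h) z.
Proof.
intros HQ HA HQt HAt HT Hreal Hz.
assert (HA0 : 0 <= A) by (generalize (HA 0) (Rabs_pos (Q 0)); lra).
assert (HTA : 0 <= T * A) by (apply Rmult_le_pos; lra).
destruct (charf_robin_asymptotics Q A T h H HQ HA HT) as (K & HK & HB).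
destruct (charf_robin_asymptotics Qt A T ht Ht HQt HAt HT) as (Kt & HKt & HBt).
apply same_zeros_eq.
- intros z; now apply (charf_analytic Qt A).
- intros z; apply (charf_taylor Q A); trivial; [lra|apply Hreal].
- exact Hz.
- intros eps R1 Heps.
  (* The quotient by [eps] controls the difference; the [+ 1] makes [D] nonzero on the square. *)
  destruct (charf_robin_lower Q A T h H HQ HA HT ((K + Kt) / eps + 1) (Rabs R1 + (1 + 2 * (T * A))))
    as (R0 & HR & Hlow).
  assert (a1 := Rle_abs R1); assert (a2 := Rabs_pos R1).
  exists R0; split; [lra|]; intros x y Hon.
  assert (Hmod := on_square_Cmod R0 x y Hon).
  specialize (Hlow x y Hon).
  specialize (HB (x, y) ltac:(lra)); simpl snd in HB.
  specialize (HBt (x, y) ltac:(lra)); simpl snd in HBt.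
  set (D := charf Q T H (RtoC 1) (RtoC h) ((x, y) * (x, y))%C) in *.
  set (Dt := charf Qt T Ht (RtoC 1) (RtoC ht) ((x, y) * (x, y))%C) in *.
  set (E := (Ci * (x, y) * (eix (x, y) T - eix (- (x, y)) T))%C) in *.
  set (e := exp (Rabs y * T)) in *.
  assert (He : 0 < e) by apply exp_pos.
  assert (Hq : 0 <= (K + Kt) / eps) by (apply Rdiv_le_0_compat; lra).
  split.
  + apply Cmod_gt_0; nra.
  + assert (T1 := Cmod_minus_le (RtoC 2 * Dt - E) (RtoC 2 * D - E)).
    replace (RtoC 2 * Dt - E - (RtoC 2 * D - E))%C with (RtoC 2 * (Dt - D))%C in T1 by ring.
    rewrite Cmod_mult, Cmod_R, (Rabs_pos_eq 2) in T1 by lra.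
    assert (T2 : eps * (((K + Kt) / eps + 1) * e) <= eps * Cmod D) by (apply Rmult_le_compat_l; lra).
    replace (eps * (((K + Kt) / eps + 1) * e)) with ((K + Kt + eps) * e) in T2 by (field; lra).
    assert (0 <= eps * e) by (apply Rmult_le_pos; lra).
    assert (0 <= (K + Kt) * e) by (apply Rmult_le_pos; lra).
    lra.
Qed.

(** Here the denominator is only bounded below by a multiple of [exp (|Im rho| T)]; the quotient
    tends to 1 because the difference carries a factor [1 / |rho|]. *)
Lemma charf_dirichlet_eq Q Qt A T H Ht :
  (forall t, continuous Q t) -> (forall t, Rabs (Q t) <= A) ->
  (forall t, continuous Qt t) -> (forall t, Rabs (Qt t) <= A) -> 0 < T ->
  (forall z, charf Q T H (RtoC 0) (RtoC 1) z = 0 -> exists l : R, z = RtoC l) ->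
  (forall z, charf Q T H (RtoC 0) (RtoC 1) z = 0 -> charf Qt T Ht (RtoC 0) (RtoC 1) z = 0) ->
  forall z, charf Qt T Ht (RtoC 0) (RtoC 1) z = charf Q T H (RtoC 0) (RtoC 1) z.
Proof.
intros HQ HA HQt HAt HT Hreal Hz.
assert (HA0 : 0 <= A) by (generalize (HA 0) (Rabs_pos (Q 0)); lra).
assert (HTA : 0 <= T * A) by (apply Rmult_le_pos; lra).
destruct (charf_dirichlet_asymptotics Q A T H HQ HA HT) as (K & HK & HB).
destruct (charf_dirichlet_asymptotics Qt A T Ht HQt HAt HT) as (Kt & HKt & HBt).
apply same_zeros_eq.
- intros z; now apply (charf_analytic Qt A).
- intros z; apply (charf_taylor Q A); trivial; [lra|apply Hreal].
- exact Hz.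
- intros eps R1 Heps.
  assert (Hq : 0 <= (K + Kt) / eps) by (apply Rdiv_le_0_compat; lra).
  assert (HT1 : 0 < 1 / T) by (apply Rdiv_lt_0_compat; lra).
  (* [4 * K] keeps the error below half of the leading term and yields [|D| >= e / 8];
     [4 * ((K + Kt) / eps)] then makes the difference small against it. *)
  destruct (large_sin_zero T (Rabs R1 + (1 + 2 * (T * A)) + 1 / T + 4 * K + 4 * ((K + Kt) / eps)) HT)
    as (R0 & HR & Hsin).
  assert (a1 := Rle_abs R1); assert (a2 := Rabs_pos R1).
  exists R0; split; [lra|]; intros x y Hon.
  assert (Hmod := on_square_Cmod R0 x y Hon).
  assert (HRT : 1 <= R0 * T).
  { replace 1 with (1 / T * T) by (field; lra); apply Rmult_le_compat_r; lra. }
  assert (low := eix_sum_lower R0 T x y HT HRT Hsin Hon).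
  specialize (HB (x, y) ltac:(lra)); simpl snd in HB.
  specialize (HBt (x, y) ltac:(lra)); simpl snd in HBt.
  set (D := charf Q T H (RtoC 0) (RtoC 1) ((x, y) * (x, y))%C) in *.
  set (Dt := charf Qt T Ht (RtoC 0) (RtoC 1) ((x, y) * (x, y))%C) in *.
  set (E := (eix (x, y) T + eix (- (x, y)) T)%C) in *.
  set (e := exp (Rabs y * T)) in *.
  set (r := Cmod (x, y)) in *.
  assert (He : 0 < e) by apply exp_pos.
  assert (T0 := Cmod_minus_ge E (E - RtoC 2 * D)).
  replace (E - (E - RtoC 2 * D))%C with (RtoC 2 * D)%C in T0 by ring.
  rewrite (Cmod_minus_sym E), Cmod_mult, Cmod_R, (Rabs_pos_eq 2) in T0 by lra.
  assert (T1 := Cmod_minus_le (RtoC 2 * Dt - E) (RtoC 2 * D - E)).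
  replace (RtoC 2 * Dt - E - (RtoC 2 * D - E))%C with (RtoC 2 * (Dt - D))%C in T1 by ring.
  rewrite Cmod_mult, Cmod_R, (Rabs_pos_eq 2) in T1 by lra.
  assert (Hr : 0 < r) by lra.
  assert (Hr1 : (4 * K + 4 * ((K + Kt) / eps)) * e <= r * e) by (apply Rmult_le_compat_r; lra).
  assert (T2 : r * Cmod D >= r * (e / 8)).
  { assert (r * (e / 2) - K * e <= r * (2 * Cmod D)).
    { apply Rle_trans with (r * (Cmod E - Cmod (RtoC 2 * D - E))); [|apply Rmult_le_compat_l; lra].
      assert (r * (e / 2) <= r * Cmod E) by (apply Rmult_le_compat_l; lra). lra. }
    assert (0 <= (K + Kt) / eps * e) by (apply Rmult_le_pos; lra).
    lra. }
  assert (T3 : e / 8 <= Cmod D) by (apply Rmult_le_reg_l with r; lra).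
  split.
  + apply Cmod_gt_0; lra.
  + apply Rmult_le_reg_l with (2 * r); [lra|].
    assert (T4 : 2 * r * Cmod (Dt - D) <= (Kt + K) * e).
    { apply Rle_trans with (r * (2 * Cmod (Dt - D))); [lra|].
      eapply Rle_trans; [apply Rmult_le_compat_l; [lra|exact T1]|]; lra. }
    assert (T5 : (K + Kt) * e <= eps * (r * (e / 4))).
    { assert (Q1 : eps * ((4 * K + 4 * ((K + Kt) / eps)) * e) <= eps * (r * e))
        by (apply Rmult_le_compat_l; lra).
      replace (eps * ((4 * K + 4 * ((K + Kt) / eps)) * e)) with
        (4 * (eps * K * e) + 4 * ((K + Kt) * e)) in Q1 by (field; lra).
      assert (0 <= eps * K * e) by (repeat apply Rmult_le_pos; lra).
      lra. }
    assert (T6 : eps * (r * (e / 4)) <= eps * (2 * r * Cmod D)) by (apply Rmult_le_compat_l; lra).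
    lra.
Qed.

(** * Uniqueness in the variable t *)

Lemma SL_wronskian Q A lam h t :
  (forall t, continuous Q t) -> (forall t, Rabs (Q t) <= A) -> 0 <= t ->
  (SLy Q lam (RtoC 1) (RtoC h) t * SLz Q lam (RtoC 0) (RtoC 1) t
   - SLz Q lam (RtoC 1) (RtoC h) t * SLy Q lam (RtoC 0) (RtoC 1) t)%C = 1.
Proof.
intros HQ HA Ht.
destruct (SL_spec Q A lam (RtoC 1) (RtoC h) HQ HA) as (Y & Z & y0 & z0).
destruct (SL_spec Q A lam (RtoC 0) (RtoC 1) HQ HA) as (Y1 & Z1 & y1 & z1).
assert (E := Cd_zero_const (fun s => SLy Q lam (RtoC 1) (RtoC h) s * SLz Q lam (RtoC 0) (RtoC 1) s
   - SLz Q lam (RtoC 1) (RtoC h) s * SLy Q lam (RtoC 0) (RtoC 1) s)%C 0 t Ht).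
cbv beta in E; rewrite E.
- rewrite y0, z0, y1, z1; ring.
- intros s _; eapply Cd_val; [apply Cd_minus; apply Cd_mult; [apply Y|apply Z1|apply Z|apply Y1]|].
  ring.
Qed.

(* The left-hand side is the solution with value [1] and derivative [-H] at [T]; read
   backwards from [T] it obeys the growth bound of [robin_estimates]. *)
Lemma weyl_numerator_bound Q A T h H t rho :
  (forall t, continuous Q t) -> (forall t, Rabs (Q t) <= A) -> 0 < T ->
  1 + 2 * (T * A) <= Cmod rho -> 0 <= t <= T ->
  let lam := (rho * rho)%C in
  Cmod (charf Q T H (RtoC 0) (RtoC 1) lam * SLy Q lam (RtoC 1) (RtoC h) t
    - charf Q T H (RtoC 1) (RtoC h) lam * SLy Q lam (RtoC 0) (RtoC 1) t)%C
    <= (2 + 2 * Rabs H) * exp (Rabs (snd rho) * (T - t)).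
Proof.
intros HQ HA HT Hr Ht lam.
assert (HA0 : 0 <= A) by (generalize (HA 0) (Rabs_pos (Q 0)); lra).
assert (HTA : 0 <= T * A) by (apply Rmult_le_pos; lra).
destruct (SL_spec Q A lam (RtoC 1) (RtoC h) HQ HA) as (Y & Z & y0 & z0).
destruct (SL_spec Q A lam (RtoC 0) (RtoC 1) HQ HA) as (Y1 & Z1 & y1 & z1).
assert (W := SL_wronskian Q A lam h T HQ HA ltac:(lra)).
set (D1 := charf Q T H (RtoC 0) (RtoC 1) lam).
set (D := charf Q T H (RtoC 1) (RtoC h) lam).
set (c := SLy Q lam (RtoC 1) (RtoC h)) in *.
set (c' := SLz Q lam (RtoC 1) (RtoC h)) in *.
set (s := SLy Q lam (RtoC 0) (RtoC 1)) in *.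
set (s' := SLz Q lam (RtoC 0) (RtoC 1)) in *.
assert (ED1 : D1 = (s' T + RtoC H * s T)%C) by reflexivity.
assert (ED : D = (c' T + RtoC H * c T)%C) by reflexivity.
clearbody c c' s s' D D1.
assert (est := robin_estimates (fun r => D1 * c (T - r)%R - D * s (T - r)%R)%C
  (fun r => RtoC (-1) * (D1 * c' (T - r)%R - D * s' (T - r)%R))%C (fun r => Q (T - r)) A T H rho
  ltac:(lra) ltac:(lra) ltac:(lra)).
assert (dT : forall r, is_derive (fun r => T - r) r (-1)) by (intros r; auto_derive; trivial; ring).
destruct est with (t := T - t) as (B & _).
- intros r _; apply HA.
- intros r _; eapply Cd_val.
  + apply (Cd_comp (fun x => D1 * c x - D * s x)%C (fun r => T - r)); [|apply dT].
    apply Cd_minus; apply Cd_scal; [apply Y|apply Y1].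
  + reflexivity.
- intros r _; eapply Cd_val.
  + apply Cd_scal.
    apply (Cd_comp (fun x => D1 * c' x - D * s' x)%C (fun r => T - r)); [|apply dT].
    apply Cd_minus; apply Cd_scal; [apply Z|apply Z1].
  + cbv beta; unfold pot, lam.
    assert (E1 : (RtoC (-1) * RtoC (-1))%C = RtoC 1) by (apply injective_projections; simpl; ring).
    rewrite Cmult_assoc, E1; ring.
(* At [T] the value is the Wronskian, hence 1. The next goal is the slope, which is [H] because time
   is reversed. *)
- rewrite Rminus_0_r, ED1, ED; rewrite <- W; ring.
- rewrite Rminus_0_r, ED1, ED.
  replace (RtoC H) with (RtoC H * 1)%C at 3 by ring; rewrite <- W.
  apply injective_projections; simpl; ring.
- lra.
- replace (T - (T - t)) with t in B by ring; exact B.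
Qed.

Lemma weyl_kernel_zero Q Qt A T h H ht Ht t :
  (forall t, continuous Q t) -> (forall t, Rabs (Q t) <= A) ->
  (forall t, continuous Qt t) -> (forall t, Rabs (Qt t) <= A) -> 0 < T ->
  (forall z, charf Qt T Ht (RtoC 1) (RtoC ht) z = charf Q T H (RtoC 1) (RtoC h) z) ->
  (forall z, charf Qt T Ht (RtoC 0) (RtoC 1) z = charf Q T H (RtoC 0) (RtoC 1) z) ->
  0 <= t <= T ->
  forall lam, (SLy Q lam (RtoC 0) (RtoC 1) t * SLy Qt lam (RtoC 1) (RtoC ht) t
    - SLy Q lam (RtoC 1) (RtoC h) t * SLy Qt lam (RtoC 0) (RtoC 1) t)%C = 0.
Proof.
intros HQ HA HQt HAt HT ER ED Ht'.
assert (HA0 : 0 <= A) by (generalize (HA 0) (Rabs_pos (Q 0)); lra).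
assert (HTA : 0 <= T * A) by (apply Rmult_le_pos; lra).
apply (vanishes_on_squares_eq0 (fun lam =>
  SLy Q lam (RtoC 0) (RtoC 1) t * SLy Qt lam (RtoC 1) (RtoC ht) t
    - SLy Q lam (RtoC 1) (RtoC h) t * SLy Qt lam (RtoC 0) (RtoC 1) t)%C).
- intros z.
  destruct (SL_analytic Q A (RtoC 0) (RtoC 1) t z HQ HA (proj1 Ht')) as [a1 _].
  destruct (SL_analytic Qt A (RtoC 1) (RtoC ht) t z HQt HAt (proj1 Ht')) as [a2 _].
  destruct (SL_analytic Q A (RtoC 1) (RtoC h) t z HQ HA (proj1 Ht')) as [a3 _].
  destruct (SL_analytic Qt A (RtoC 0) (RtoC 1) t z HQt HAt (proj1 Ht')) as [a4 _].
  destruct (analytic_at_lin _ _ (RtoC (-1)) z (analytic_at_mult _ _ z a1 a2) (analytic_at_mult _ _ z a3 a4))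
    as (d & B & M & F & Hd & HB & HF & EF).
  exists d, B, M, F; repeat (split; [assumption|]).
  intros w Hw; rewrite <- EF by assumption.
  assert (Em : RtoC (-1) = (- RtoC 1)%C) by (apply injective_projections; simpl; ring).
  rewrite Em; ring.
- intros eps R1 Heps.
  set (N := (2 + 2 * Rabs h) * (2 + 2 * Rabs Ht) + (2 + 2 * Rabs H) * (2 + 2 * Rabs ht)).
  assert (HN : 0 <= N).
  { unfold N; generalize (Rabs_pos h) (Rabs_pos H) (Rabs_pos ht) (Rabs_pos Ht); intros; nra. }
  assert (HNe : 0 <= N / eps) by (apply Rdiv_le_0_compat; lra).
  destruct (charf_robin_lower Q A T h H HQ HA HT (N / eps + 1) (Rabs R1 + (1 + 2 * (T * A))))
    as (R0 & HR & Hlow).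
  assert (b1 := Rle_abs R1); assert (b2 := Rabs_pos R1).
  exists R0; split; [lra|]; intros x y Hon.
  assert (Hmod := on_square_Cmod R0 x y Hon); specialize (Hlow x y Hon).
  assert (W1 := weyl_numerator_bound Q A T h H t (x, y) HQ HA HT ltac:(lra) Ht').
  assert (W2 := weyl_numerator_bound Qt A T ht Ht t (x, y) HQt HAt HT ltac:(lra) Ht').
  (* The second numerator is now built from the same [D1] and [D] as the first, so the [D1] terms
     cancel in the identity below. *)
  cbv zeta in W1, W2; rewrite ER, ED in W2; simpl snd in W1, W2.
  set (lam := ((x, y) * (x, y))%C) in *.
  destruct (SL_spec Q A lam (RtoC 1) (RtoC h) HQ HA) as (Y & Z & y0 & z0).
  destruct (SL_spec Qt A lam (RtoC 1) (RtoC ht) HQt HAt) as (Yt & Zt & yt0 & zt0).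
  destruct (robin_estimates _ _ Q A T h (x, y) ltac:(lra) ltac:(lra) ltac:(lra) (fun t _ => HA t)
    (fun t _ => Y t) (fun t _ => Z t) y0 z0 t Ht') as (B1 & _).
  destruct (robin_estimates _ _ Qt A T ht (x, y) ltac:(lra) ltac:(lra) ltac:(lra) (fun t _ => HAt t)
    (fun t _ => Yt t) (fun t _ => Zt t) yt0 zt0 t Ht') as (B2 & _).
  simpl snd in B1, B2.
  set (D1 := charf Q T H (RtoC 0) (RtoC 1) lam) in *.
  set (D := charf Q T H (RtoC 1) (RtoC h) lam) in *.
  set (c := SLy Q lam (RtoC 1) (RtoC h) t) in *.
  set (ct := SLy Qt lam (RtoC 1) (RtoC ht) t) in *.
  set (s := SLy Q lam (RtoC 0) (RtoC 1) t) in *.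
  set (st := SLy Qt lam (RtoC 0) (RtoC 1) t) in *.
  clearbody D1 D c ct s st.
  set (e1 := exp (Rabs y * t)) in *; set (e2 := exp (Rabs y * (T - t))) in *.
  assert (He : exp (Rabs y * T) = e1 * e2).
  { unfold e1, e2; rewrite <- exp_plus; f_equal; ring. }
  rewrite He in Hlow.
  assert (He1 : 0 < e1) by apply exp_pos; assert (He2 : 0 < e2) by apply exp_pos.
  assert (Hee : 0 < e1 * e2) by now apply Rmult_lt_0_compat.
  assert (Main : Cmod D * Cmod (s * ct - c * st)%C <= N * (e1 * e2)).
  { rewrite <- Cmod_mult.
    replace (D * (s * ct - c * st))%C with (c * (D1 * ct - D * st) - (D1 * c - D * s) * ct)%C by ring.
    eapply Rle_trans; [apply Cmod_minus_le|]; rewrite !Cmod_mult.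
    replace (N * (e1 * e2)) with ((2 + 2 * Rabs h) * e1 * ((2 + 2 * Rabs Ht) * e2)
      + (2 + 2 * Rabs H) * e2 * ((2 + 2 * Rabs ht) * e1)) by (unfold N; ring).
    apply Rplus_le_compat; apply Rmult_le_compat; trivial; apply Cmod_ge_0. }
  assert (P := Cmod_ge_0 (s * ct - c * st)%C).
  apply Rmult_le_reg_l with ((N / eps + 1) * (e1 * e2)).
  + apply Rmult_lt_0_compat; lra.
  + apply Rle_trans with (Cmod D * Cmod (s * ct - c * st)%C); [now apply Rmult_le_compat_r|].
    eapply Rle_trans; [exact Main|].
    replace ((N / eps + 1) * (e1 * e2) * eps) with ((N + eps) * (e1 * e2)) by (field; lra).
    apply Rmult_le_compat_r; lra.
Qed.

(** At [rho = i k], that is [lam = - k^2], the solution is [cosh (k t)] up to an error of at most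
    [K exp (k t) / (2 k)]. Positivity is what later selects the sign in [C^2 = C~^2]. *)
Lemma SL_positive Q A T h :
  (forall t, continuous Q t) -> (forall t, Rabs (Q t) <= A) -> 0 < T ->
  exists k0, forall k, k0 <= k -> forall t, 0 <= t <= T ->
    0 < fst (SLy Q ((0, k) * (0, k))%C (RtoC 1) (RtoC h) t).
Proof.
intros HQ HA HT.
assert (HA0 : 0 <= A) by (generalize (HA 0) (Rabs_pos (Q 0)); lra).
assert (HTA : 0 <= T * A) by (apply Rmult_le_pos; lra).
set (K := 2 * (T * A * (2 + 2 * Rabs h) + Rabs h)).
assert (HK : 0 <= K) by (unfold K; generalize (Rabs_pos h); intros; nra).
exists (1 + 2 * (T * A) + K); intros k Hk t Ht.
assert (Hkm : Cmod (0, k) = k).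
{ unfold Cmod; simpl; replace (0 * (0 * 1) + k * (k * 1)) with (k * k) by ring.
  apply sqrt_square; lra. }
destruct (SL_spec Q A ((0, k) * (0, k))%C (RtoC 1) (RtoC h) HQ HA) as (Y & Z & y0 & z0).
destruct (robin_estimates _ _ Q A T h (0, k) ltac:(lra) ltac:(lra) ltac:(lra) (fun t _ => HA t)
    (fun t _ => Y t) (fun t _ => Z t) y0 z0 t Ht) as (_ & _ & B).
fold K in B; simpl snd in B.
set (c := SLy Q ((0, k) * (0, k))%C (RtoC 1) (RtoC h) t) in *.
clearbody c.
rewrite (Rabs_pos_eq k) in B by lra.
set (E1 := eix (0, k) t) in *; set (E2 := eix (- (0, k)) t) in *.
replace (RtoC 2 * Ci * (0, k) * c - Ci * (0, k) * (E1 + E2))%C with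
  (Ci * (0, k) * (RtoC 2 * c - (E1 + E2)))%C in B by ring.
rewrite !Cmod_mult, Cmod_Ci, Hkm in B.
assert (F := fst_le_Cmod (RtoC 2 * c - (E1 + E2))%C).
assert (e := exp_pos (k * t)); assert (e' := exp_pos (- (k * t))).
assert (G : fst (RtoC 2 * c - (E1 + E2))%C = 2 * fst c - (exp (- (k * t)) + exp (k * t))).
{ unfold E1, E2, eix; simpl.
  replace (- 0 * t) with 0 by ring; rewrite !Rmult_0_l, !cos_0.
  replace (- (- k * t)) with (k * t) by ring; ring. }
rewrite G in F.
apply Rnot_le_lt; intros N.
assert (L : exp (k * t) < Cmod (RtoC 2 * c - (E1 + E2))%C).
{ eapply Rlt_le_trans; [|exact F].
  rewrite Rabs_left; lra. }
assert (k * exp (k * t) < k * Cmod (RtoC 2 * c - (E1 + E2))%C) by (apply Rmult_lt_compat_l; lra).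
assert (K * exp (k * t) <= k * exp (k * t)) by (apply Rmult_le_compat_r; lra).
lra.
Qed.

(** A single very negative [lam] suffices: once [c = ct] with [c] nowhere 0, the equation returns
    [Q], the slope at 0 returns [h], and equality of the characteristic functions at this [lam]
    returns [H]. *)
Theorem inverse_two_spectra Q Qt A T h H ht Ht :
  (forall t, continuous Q t) -> (forall t, Rabs (Q t) <= A) ->
  (forall t, continuous Qt t) -> (forall t, Rabs (Qt t) <= A) -> 0 < T ->
  (forall z, charf Qt T Ht (RtoC 1) (RtoC ht) z = charf Q T H (RtoC 1) (RtoC h) z) ->
  (forall z, charf Qt T Ht (RtoC 0) (RtoC 1) z = charf Q T H (RtoC 0) (RtoC 1) z) ->
  (forall t, 0 < t < T -> Q t = Qt t) /\ h = ht /\ H = Ht.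
Proof.
intros HQ HA HQt HAt HT ER ED.
destruct (SL_positive Q A T h HQ HA HT) as (k1 & P1).
destruct (SL_positive Qt A T ht HQt HAt HT) as (k2 & P2).
set (k := Rmax k1 k2); set (lam := ((0, k) * (0, k))%C).
specialize (P1 k (Rmax_l _ _)); specialize (P2 k (Rmax_r _ _)); fold lam in P1, P2.
assert (K0 := fun t Ht' => weyl_kernel_zero Q Qt A T h H ht Ht t HQ HA HQt HAt HT ER ED Ht' lam).
assert (W := fun t => SL_wronskian Q A lam h t HQ HA).
assert (Wt := fun t => SL_wronskian Qt A lam ht t HQt HAt).
specialize (ER lam); unfold charf in ER.
destruct (SL_spec Q A lam (RtoC 1) (RtoC h) HQ HA) as (Y & Z & y0 & z0).
destruct (SL_spec Qt A lam (RtoC 1) (RtoC ht) HQt HAt) as (Yt & Zt & yt0 & zt0).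
destruct (SL_spec Q A lam (RtoC 0) (RtoC 1) HQ HA) as (Y1 & _).
destruct (SL_spec Qt A lam (RtoC 0) (RtoC 1) HQt HAt) as (Yt1 & _).
set (c := SLy Q lam (RtoC 1) (RtoC h)) in *.
set (c' := SLz Q lam (RtoC 1) (RtoC h)) in *.
set (ct := SLy Qt lam (RtoC 1) (RtoC ht)) in *.
set (ct' := SLz Qt lam (RtoC 1) (RtoC ht)) in *.
set (s := SLy Q lam (RtoC 0) (RtoC 1)) in *.
set (s' := SLz Q lam (RtoC 0) (RtoC 1)) in *.
set (st := SLy Qt lam (RtoC 0) (RtoC 1)) in *.
set (st' := SLz Qt lam (RtoC 0) (RtoC 1)) in *.
clearbody c c' ct ct' s s' st st'.
assert (cc : forall t, 0 < t < T -> (c t - ct t)%C = 0).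
{ intros t Ht'.
  assert (k0 := K0 t ltac:(lra)); cbv beta in k0.
  assert (k1' : (s' t * ct t + s t * ct' t - (c' t * st t + c t * st' t))%C = 0).
  { apply (Cd_zero_open (fun r => s r * ct r - c r * st r)%C 0 T t); trivial.
    - intros r Hr; apply K0; lra.
    - apply Cd_minus; apply Cd_mult; trivial. }
  specialize (W t ltac:(lra)); specialize (Wt t ltac:(lra)); cbv beta in W, Wt.
  specialize (P1 t ltac:(lra)); specialize (P2 t ltac:(lra)).
  (* Differentiating s / c = st / ct gives 1 / c^2 = 1 / ct^2. *)
  assert (E : ((c t - ct t) * (c t + ct t))%C = 0).
  { transitivity (c t * c t * (ct t * st' t - ct' t * st t)
      - ct t * ct t * (c t * s' t - c' t * s t))%C; [rewrite W, Wt; ring|].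
    transitivity ((c t * ct' t + c' t * ct t) * (s t * ct t - c t * st t)
      - c t * ct t * (s' t * ct t + s t * ct' t - (c' t * st t + c t * st' t)))%C; [ring|].
    rewrite k0, k1'; ring. }
  apply NNPP; intros N; revert E; apply Cmult_neq_0; trivial.
  (* The other factor, [c + ct], has positive real part. *)
  intros E; apply (f_equal fst) in E; simpl in E; lra. }
assert (cc' : forall t, 0 < t < T -> (c' t - ct' t)%C = 0).
{ intros t Ht'; apply (Cd_zero_open (fun r => c r - ct r)%C 0 T t); trivial.
  apply Cd_minus; trivial. }
assert (cn : forall t, 0 <= t <= T -> c t <> 0).
{ intros t Ht' E; specialize (P1 t Ht'); rewrite E in P1; simpl in P1; lra. }
assert (eq0 : forall a b : C, (a - b)%C = 0 -> a = b).
{ intros a b E; replace a with (a - b + b)%C by ring; rewrite E; ring. }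
assert (ccT : forall t, 0 <= t <= T -> (c t - ct t)%C = 0).
{ apply (Ccont_zero_closed (fun r => c r - ct r)%C T HT); trivial.
  intros t _; eapply Cd_cont, Cd_minus; trivial. }
assert (ccT' : forall t, 0 <= t <= T -> (c' t - ct' t)%C = 0).
{ apply (Ccont_zero_closed (fun r => c' r - ct' r)%C T HT); trivial.
  intros t _; eapply Cd_cont, Cd_minus; trivial. }
split; [|split].
- intros t Ht'.
  assert (E : (pot Q lam t * c t - pot Qt lam t * ct t)%C = 0).
  { apply (Cd_zero_open (fun r => c' r - ct' r)%C 0 T t); trivial.
    apply Cd_minus; trivial. }
  rewrite <- (eq0 _ _ (cc t Ht')) in E; unfold pot in E.
  apply RtoC_inj, eq0; apply NNPP; intros N.
  apply (Cmult_neq_0 _ _ N (cn t ltac:(lra))).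
  rewrite <- E; ring.
- apply RtoC_inj; rewrite <- z0, <- zt0; apply eq0, ccT'; lra.
- rewrite <- (eq0 _ _ (ccT T ltac:(lra))), <- (eq0 _ _ (ccT' T ltac:(lra))) in ER.
  apply RtoC_inj, eq0; apply NNPP; intros N.
  apply (Cmult_neq_0 _ _ N (cn T ltac:(lra))).
  replace ((RtoC H - RtoC Ht) * c T)%C with
    ((c' T + RtoC H * c T) - (c' T + RtoC Ht * c T))%C by ring.
  rewrite ER; ring.
Qed.

(** * The conformable problem *)

(* The real power extended by [0]; [Rpower 0 a] itself is [1]. *)
Definition pow0 (a x : R) : R := if Rle_dec x 0 then 0 else Rpower x a.

(** The substitution with [dt = x^(al - 1) dx], which turns the conformable derivative into [d/dt];
    [xvar] inverts it. *)
Definition tvar (al x : R) : R := pow0 al x / al.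
Definition xvar (al t : R) : R := pow0 (1 / al) (al * t).

Lemma pow0_pos a x : 0 < x -> pow0 a x = Rpower x a.
Proof. intros H; unfold pow0; destruct (Rle_dec x 0); [lra|reflexivity]. Qed.

Lemma pow0_0 a : pow0 a 0 = 0.
Proof. unfold pow0; destruct (Rle_dec 0 0); [reflexivity|lra]. Qed.

Lemma locally_pos (x : R) : 0 < x -> locally x (fun s => 0 < s).
Proof.
intros Hx; exists (mkposreal x Hx); intros s Hs; change (Rabs (s - x) < x) in Hs.
apply Rabs_lt_between in Hs; lra.
Qed.

Lemma pow0_derive a x : 0 < x -> is_derive (pow0 a) x (a * Rpower x (a - 1)).
Proof.
intros Hx; apply (is_derive_ext_loc (fun s => exp (a * ln s))).
- generalize (locally_pos x Hx); apply filter_imp; intros s Hs; now rewrite pow0_pos.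
- auto_derive; [assumption|].
  unfold Rpower; replace ((a - 1) * ln x) with (a * ln x + - ln x) by ring.
  rewrite exp_plus, exp_Ropp, exp_ln by assumption; field; lra.
Qed.

Lemma pow0_cont a x : 0 < a -> continuous (pow0 a) x.
Proof.
intros Ha; destruct (Rtotal_order x 0) as [N|[->|P]].
- apply (continuous_ext_loc (pow0 a) (fun _ => 0)); [|apply continuous_const].
  assert (Hx : 0 < - x) by lra.
  exists (mkposreal _ Hx); intros s Hs; change (Rabs (s - x) < - x) in Hs.
  apply Rabs_lt_between in Hs; unfold pow0; destruct (Rle_dec s 0); [reflexivity|lra].
- apply filterlim_locally; intros eps; rewrite pow0_0.
  exists (mkposreal (Rpower eps (1 / a)) (exp_pos _)); intros s Hs.
  change (Rabs (s - 0) < Rpower eps (1 / a)) in Hs; change (Rabs (pow0 a s - 0) < eps).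
  rewrite Rminus_0_r in *; unfold pow0; destruct (Rle_dec s 0).
  + rewrite Rabs_R0; apply cond_pos.
  + rewrite Rabs_pos_eq by (left; apply exp_pos).
    rewrite Rabs_pos_eq in Hs by lra.
    assert (E : Rpower (Rpower eps (1 / a)) a = eps).
    { rewrite Rpower_mult; replace (1 / a * a) with 1 by (field; lra).
      apply Rpower_1, cond_pos. }
    rewrite <- E; apply Rlt_Rpower_l; lra.
- apply (ex_derive_continuous (pow0 a)); eexists; now apply pow0_derive.
Qed.

Lemma tvar_cont al x : 0 < al -> continuous (tvar al) x.
Proof.
intros Ha; unfold tvar, Rdiv.
apply (continuous_mult (pow0 al) (fun _ => / al)); [now apply pow0_cont|apply continuous_const].
Qed.

Lemma tvar_derive al x : 0 < al -> 0 < x -> is_derive (tvar al) x (/ Rpower x (1 - al)).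
Proof.
intros Ha Hx; apply (is_derive_ext (fun s => / al * pow0 al s)).
- intros s; apply Rmult_comm.
- eapply is_derive_val; [apply is_derive_scal; now apply pow0_derive|].
  unfold Rpower; rewrite <- exp_Ropp; replace (- ((1 - al) * ln x)) with ((al - 1) * ln x) by ring.
  field; lra.
Qed.

Lemma tvar_0 al : tvar al 0 = 0.
Proof. unfold tvar; rewrite pow0_0; unfold Rdiv; ring. Qed.

Lemma tvar_bounds al x : 0 < al -> 0 < x < PI -> 0 < tvar al x < tvar al PI.
Proof.
intros Ha Hx; unfold tvar; rewrite !pow0_pos by lra; split.
- apply Rdiv_lt_0_compat; [apply exp_pos|assumption].
- apply Rmult_lt_compat_r; [now apply Rinv_0_lt_compat|apply Rlt_Rpower_l; lra].
Qed.

Lemma xvar_tvar al x : 0 < al -> 0 < x -> xvar al (tvar al x) = x.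
Proof.
intros Ha Hx; unfold xvar, tvar; rewrite (pow0_pos al x Hx).
replace (al * (Rpower x al / al)) with (Rpower x al) by (field; lra).
rewrite pow0_pos by apply exp_pos; rewrite Rpower_mult.
replace (al * (1 / al)) with 1 by (field; lra); now apply Rpower_1.
Qed.

Lemma xvar_cont al t : 0 < al -> continuous (xvar al) t.
Proof.
intros Ha; unfold xvar.
apply (continuous_comp (fun t => al * t) (pow0 (1 / al))).
- apply (continuous_mult (fun _ => al) (fun t => t)); [apply continuous_const|apply continuous_id].
- apply pow0_cont; apply Rdiv_lt_0_compat; lra.
Qed.

(** Composing with [clamp] extends [q] from the closed interval to a bounded continuous function on
    the line, as the global existence theorem requires. *)
Definition clamp (x : R) : R := Rmax 0 (Rmin PI x).

Definition potential (al : R) (q : R -> R) (t : R) : R := q (clamp (xvar al t)).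

Lemma clamp_bounds x : 0 <= clamp x <= PI.
Proof.
unfold clamp; assert (P := PI_RGT_0); split; [apply Rmax_l|].
apply Rmax_lub; [lra|apply Rmin_l].
Qed.

Lemma clamp_id x : 0 <= x <= PI -> clamp x = x.
Proof. intros H; unfold clamp; rewrite Rmin_right, Rmax_right; lra. Qed.

Lemma clamp_lipschitz x y : Rabs (clamp x - clamp y) <= Rabs (x - y).
Proof.
unfold clamp, Rmax, Rmin; assert (P := PI_RGT_0).
destruct (Rle_dec PI x), (Rle_dec PI y);
  repeat destruct (Rle_dec _ _); unfold Rabs; repeat destruct (Rcase_abs _); lra.
Qed.

Lemma clamp_comp_cont q x : continuous_on_0pi q -> continuous (fun x => q (clamp x)) x.
Proof.
intros Hq; apply filterlim_locally; intros eps.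
specialize (Hq (clamp x) (clamp_bounds x)).
destruct (proj1 (filterlim_locally q (q (clamp x))) Hq eps) as [de Hde].
exists de; intros y Hy; apply Hde; [|apply clamp_bounds].
change (Rabs (clamp y - clamp x) < de); change (Rabs (y - x) < de) in Hy.
generalize (clamp_lipschitz y x); lra.
Qed.

Lemma potential_cont al q t : 0 < al -> continuous_on_0pi q -> continuous (potential al q) t.
Proof.
intros Ha Hq; apply (continuous_comp (xvar al) (fun x => q (clamp x))).
- now apply xvar_cont.
- now apply clamp_comp_cont.
Qed.

Lemma potential_bounded al q : continuous_on_0pi q -> exists A, forall t, Rabs (potential al q t) <= A.
Proof.
intros Hq; assert (P := PI_RGT_0).
destruct (continuity_ab_maj (fun x => Rabs (q (clamp x))) 0 PI) as (m & Hm & _); [lra| |].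
- intros c _; apply continuity_pt_filterlim.
  apply (continuous_comp (fun x => q (clamp x)) Rabs); [now apply clamp_comp_cont|].
  apply (continuous_abs (q (clamp c))).
- exists (Rabs (q (clamp m))); intros t; unfold potential.
  rewrite <- (clamp_id (clamp (xvar al t))) by apply clamp_bounds.
  apply Hm, clamp_bounds.
Qed.

Lemma potential_tvar al q x : 0 < al -> 0 < x < PI -> potential al q (tvar al x) = q x.
Proof.
intros Ha Hx; unfold potential; rewrite xvar_tvar, clamp_id by lra; reflexivity.
Qed.

(** * Conformable and ordinary derivatives *)

Lemma Cdiv_real (z : C) (e : R) : e <> 0 -> Cdiv z (RtoC e) = (fst z / e, snd z / e).
Proof.
intros He; unfold Cdiv, Cinv, Cmult; simpl; f_equal; field; trivial.
Qed.

Lemma conf_deriv_components al f x (d : C) :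
  conf_deriv al f x d <->
  forall eps, 0 < eps -> exists de, 0 < de /\ forall e, e <> 0 -> Rabs e < de ->
    Rabs ((fst (f (x + e * Rpower x (1 - al))) - fst (f x)) / e - fst d) < eps /\
    Rabs ((snd (f (x + e * Rpower x (1 - al))) - snd (f x)) / e - snd d) < eps.
Proof.
unfold conf_deriv; split.
- intros Hf eps Heps.
  destruct (proj1 (filterlim_locally _ d) Hf (mkposreal eps Heps)) as [de Hde].
  exists de; split; [apply cond_pos|]; intros e He Hle.
  assert (B := Hde e); rewrite Cdiv_real in B by assumption.
  apply B; [|assumption].
  change (Rabs (e - 0) < de); now rewrite Rminus_0_r.
- intros H; apply filterlim_locally; intros eps.
  destruct (H eps (cond_pos eps)) as (de & Hde & Hd).
  exists (mkposreal de Hde); intros e Hball He.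
  change (Rabs (e - 0) < de) in Hball; rewrite Rminus_0_r in Hball.
  rewrite Cdiv_real by assumption; exact (Hd e He Hball).
Qed.

Lemma is_derive_eps (f : R -> R) x l :
  is_derive f x l <->
  forall eps, 0 < eps -> exists de, 0 < de /\ forall e, e <> 0 -> Rabs e < de ->
    Rabs ((f (x + e) - f x) / e - l) < eps.
Proof.
rewrite is_derive_Reals; split.
- intros H eps Heps; destruct (H eps Heps) as [de Hde]; exists de; split; [apply cond_pos|exact Hde].
- intros H eps Heps; destruct (H eps Heps) as (de & P & Hde); exists (mkposreal de P); exact Hde.
Qed.

Lemma scaled_quotient (f : R -> R) (x c d : R) :
  0 < c ->
  (is_derive f x (/ c * d) <->
  forall eps, 0 < eps -> exists de, 0 < de /\ forall e, e <> 0 -> Rabs e < de ->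
    Rabs ((f (x + e * c) - f x) / e - d) < eps).
Proof.
intros Hc; rewrite is_derive_eps; split; intros H eps Heps.
- destruct (H (eps / c)) as (de & Hde & Hd); [now apply Rdiv_lt_0_compat|].
  exists (de / c); split; [now apply Rdiv_lt_0_compat|]; intros e He Hle.
  assert (Hec : e * c <> 0) by (apply Rmult_integral_contrapositive; split; lra).
  specialize (Hd (e * c) Hec).
  rewrite Rabs_mult, (Rabs_pos_eq c) in Hd by lra.
  apply Rmult_lt_compat_r with (r := c) in Hle; [|assumption].
  replace (de / c * c) with de in Hle by (field; lra).
  specialize (Hd Hle).
  apply Rmult_lt_compat_r with (r := c) in Hd; [|assumption].
  replace (eps / c * c) with eps in Hd by (field; lra).
  rewrite <- (Rabs_pos_eq c) in Hd at 4 by lra; rewrite <- Rabs_mult in Hd.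
  replace ((f (x + e * c) - f x) / e - d) with
    (((f (x + e * c) - f x) / (e * c) - / c * d) * c) by (field; split; lra).
  exact Hd.
- destruct (H (eps * c)) as (de & Hde & Hd); [now apply Rmult_lt_0_compat|].
  exists (de * c); split; [now apply Rmult_lt_0_compat|]; intros e He Hle.
  assert (Hec : e / c <> 0).
  { unfold Rdiv; apply Rmult_integral_contrapositive; split; [assumption|apply Rinv_neq_0_compat; lra]. }
  specialize (Hd (e / c) Hec).
  assert (Hle' : Rabs (e / c) < de).
  { unfold Rdiv; rewrite Rabs_mult, (Rabs_pos_eq (/ c)) by (left; now apply Rinv_0_lt_compat).
    apply Rmult_lt_reg_r with c; [assumption|].
    rewrite Rmult_assoc, Rinv_l, Rmult_1_r by lra; exact Hle. }
  specialize (Hd Hle').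
  replace (e / c * c) with e in Hd by (field; lra).
  replace ((f (x + e) - f x) / e - / c * d) with (((f (x + e) - f x) / (e / c) - d) * / c)
    by (field; split; lra).
  rewrite Rabs_mult, (Rabs_pos_eq (/ c)) by (left; now apply Rinv_0_lt_compat).
  apply Rmult_lt_reg_r with c; [assumption|].
  rewrite Rmult_assoc, Rinv_l, Rmult_1_r by lra; exact Hd.
Qed.

(** For fixed [x] the factor [Rpower x (1 - al)] is a positive constant, so the defining limit is an
    ordinary difference quotient with rescaled increment. Differentiability is thus derived from the
    limit. *)
Lemma conf_deriv_Cd al f x d :
  conf_deriv al f x d <-> Cd f x (RtoC (/ Rpower x (1 - al)) * d)%C.
Proof.
rewrite conf_deriv_components; unfold Cd.
set (c := Rpower x (1 - al)); assert (Hc : 0 < c) by apply exp_pos.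
replace (fst (RtoC (/ c) * d)%C) with (/ c * fst d) by (simpl; ring).
replace (snd (RtoC (/ c) * d)%C) with (/ c * snd d) by (simpl; ring).
rewrite (scaled_quotient (fun s => fst (f s))), (scaled_quotient (fun s => snd (f s))) by assumption.
split.
- intros H; split; intros eps Heps; destruct (H eps Heps) as (de & Hde & Hd);
    exists de; split; trivial; intros e He Hle; now apply Hd.
- intros [H1 H2] eps Heps.
  destruct (H1 eps Heps) as (de1 & Hde1 & Hd1); destruct (H2 eps Heps) as (de2 & Hde2 & Hd2).
  exists (Rmin de1 de2); split; [now apply Rmin_pos|]; intros e He Hle.
  assert (m1 := Rmin_l de1 de2); assert (m2 := Rmin_r de1 de2).
  split; [apply Hd1|apply Hd2]; trivial; lra.
Qed.

Lemma Ccont_filterlim (f : R -> C) t : Ccont f t -> filterlim f (locally t) (locally (f t)).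
Proof.
intros [F1 F2]; apply filterlim_locally; intros eps.
generalize (filter_and _ _ (proj1 (filterlim_locally _ _) F1 eps) (proj1 (filterlim_locally _ _) F2 eps)).
apply filter_imp; intros s [B1 B2]; split; assumption.
Qed.

Lemma filterlim_components (F : (R -> Prop) -> Prop) (FF : Filter F) (f : R -> C) (l : C) :
  filterlim f F (locally l) ->
  filterlim (fun s => fst (f s)) F (locally (fst l)) /\
  filterlim (fun s => snd (f s)) F (locally (snd l)).
Proof.
intros H; split; apply filterlim_locally; intros eps;
  generalize (proj1 (filterlim_locally f l) H eps); apply filter_imp; intros s [B1 B2]; assumption.
Qed.

(** An eigenfunction solves the equation only inside the interval, and its derivative has mere
    one-sided limits at the ends. Filling in these limits gives functions continuous on the closed
    interval. *)
Definition extend {V : Type} (f : R -> V) (l r : V) (x : R) : V :=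
  if Rle_dec x 0 then l else if Rle_dec PI x then r else f x.

Lemma extend_in {V : Type} (f : R -> V) l r x : 0 < x < PI -> extend f l r x = f x.
Proof.
intros H; unfold extend; destruct (Rle_dec x 0); [lra|]; destruct (Rle_dec PI x); [lra|reflexivity].
Qed.

Lemma extend_0 {V : Type} (f : R -> V) l r : extend f l r 0 = l.
Proof. unfold extend; destruct (Rle_dec 0 0); [reflexivity|lra]. Qed.

Lemma extend_PI {V : Type} (f : R -> V) l r : extend f l r PI = r.
Proof.
assert (P := PI_RGT_0); unfold extend.
destruct (Rle_dec PI 0); [lra|]; destruct (Rle_dec PI PI); [reflexivity|lra].
Qed.

Lemma extend_cont (f : R -> R) l r x :
  (forall x, 0 < x < PI -> continuous f x) ->
  filterlim f (at_right 0) (locally l) -> filterlim f (at_left PI) (locally r) ->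
  0 <= x <= PI -> continuous (extend f l r) x.
Proof.
intros Hf Hl Hr Hx; assert (P := PI_RGT_0).
destruct (Req_dec x 0) as [->|N0]; [|destruct (Req_dec x PI) as [->|NP]].
- apply filterlim_locally; intros eps; rewrite extend_0.
  destruct (proj1 (filterlim_locally f l) Hl eps) as [de Hde].
  assert (Hm : 0 < Rmin de PI) by (apply Rmin_pos; [apply cond_pos|assumption]).
  exists (mkposreal _ Hm); intros s Hs; change (Rabs (s - 0) < Rmin de PI) in Hs.
  assert (m1 := Rmin_l de PI); assert (m2 := Rmin_r de PI).
  unfold extend; destruct (Rle_dec s 0); [apply ball_center|].
  assert (Hs' := Hs); apply Rabs_lt_between in Hs'.
  destruct (Rle_dec PI s); [lra|]; apply Hde; [|lra].
  change (Rabs (s - 0) < de); lra.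
- apply filterlim_locally; intros eps; rewrite extend_PI.
  destruct (proj1 (filterlim_locally f r) Hr eps) as [de Hde].
  assert (Hm : 0 < Rmin de PI) by (apply Rmin_pos; [apply cond_pos|assumption]).
  exists (mkposreal _ Hm); intros s Hs; change (Rabs (s - PI) < Rmin de PI) in Hs.
  assert (m1 := Rmin_l de PI); assert (m2 := Rmin_r de PI).
  assert (Hs' := Hs); apply Rabs_lt_between in Hs'.
  unfold extend; destruct (Rle_dec s 0); [lra|].
  destruct (Rle_dec PI s); [apply ball_center|]; apply Hde; [|lra].
  change (Rabs (s - PI) < de); lra.
- assert (Hx' : 0 < x < PI) by lra.
  apply (continuous_ext_loc _ f); [|now apply Hf].
  assert (Hm : 0 < Rmin x (PI - x)) by (apply Rmin_pos; lra).
  exists (mkposreal _ Hm); intros s Hs; change (Rabs (s - x) < Rmin x (PI - x)) in Hs.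
  assert (m1 := Rmin_l x (PI - x)); assert (m2 := Rmin_r x (PI - x)).
  apply Rabs_lt_between in Hs; symmetry; apply extend_in; lra.
Qed.

Lemma extend_Ccont (f : R -> C) l r x :
  (forall x, 0 < x < PI -> Ccont f x) ->
  filterlim f (at_right 0) (locally l) -> filterlim f (at_left PI) (locally r) ->
  0 <= x <= PI -> Ccont (extend f l r) x.
Proof.
intros Hf Hl Hr Hx.
destruct (filterlim_components _ _ f l Hl) as [l1 l2]; destruct (filterlim_components _ _ f r Hr) as [r1 r2].
split.
- apply (continuous_ext (extend (fun s => fst (f s)) (fst l) (fst r))).
  + intros s; unfold extend; destruct (Rle_dec s 0); [reflexivity|]; now destruct (Rle_dec PI s).
  + apply extend_cont; trivial; intros s Hs; now apply Hf.
- apply (continuous_ext (extend (fun s => snd (f s)) (snd l) (snd r))).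
  + intros s; unfold extend; destruct (Rle_dec s 0); [reflexivity|]; now destruct (Rle_dec PI s).
  + apply extend_cont; trivial; intros s Hs; now apply Hf.
Qed.

(** * Eigenvalues are the zeros of the characteristic function *)

Lemma Ccont_comp (f : R -> C) (g : R -> R) x :
  Ccont f (g x) -> continuous g x -> Ccont (fun s => f (g s)) x.
Proof.
intros [F1 F2] G; split.
- exact (continuous_comp g (fun s => fst (f s)) x G F1).
- exact (continuous_comp g (fun s => snd (f s)) x G F2).
Qed.

Lemma eigenvalue_of_charf_zero al q (bc0 : C -> C -> Prop) (a b H : R) lam :
  0 < al -> continuous_on_0pi q -> ~ (a = 0 /\ b = 0) ->
  bc0 (RtoC a) (RtoC b) ->
  charf (potential al q) (tvar al PI) H (RtoC a) (RtoC b) lam = 0 ->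
  is_eigenvalue al q bc0
    (fun ypi dpi => Cplus dpi (Cmult (RtoC H) ypi) = RtoC 0) lam.
Proof.
intros Hal Hq Hab Hbc Hch.
destruct (potential_bounded al q Hq) as (A & HA).
assert (HQ := fun t => potential_cont al q t Hal Hq).
destruct (SL_spec _ A lam (RtoC a) (RtoC b) HQ HA) as (Y & Z & y0 & z0).
unfold charf in Hch.
set (u := SLy (potential al q) lam (RtoC a) (RtoC b)) in *.
set (v := SLz (potential al q) lam (RtoC a) (RtoC b)) in *.
clearbody u v.
assert (Cu : forall x, Ccont (fun s => u (tvar al s)) x).
{ intros x; apply Ccont_comp; [eapply Cd_cont, Y|now apply tvar_cont]. }
assert (Cv : forall x, Ccont (fun s => v (tvar al s)) x).
{ intros x; apply Ccont_comp; [eapply Cd_cont, Z|now apply tvar_cont]. }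
assert (Du : forall x, 0 < x ->
  Cd (fun s => u (tvar al s)) x (RtoC (/ Rpower x (1 - al)) * v (tvar al x))%C).
{ intros x Hx; apply Cd_comp; [apply Y|now apply tvar_derive]. }
assert (P := PI_RGT_0).
assert (U0 : u (tvar al 0) = RtoC a) by (rewrite tvar_0; exact y0).
assert (V0 : v (tvar al 0) = RtoC b) by (rewrite tvar_0; exact z0).
exists (fun x => u (tvar al x)), (fun x => v (tvar al x)), (RtoC b), (v (tvar al PI)).
split; [|split; [|split; [|split; [|split; [|split; [|split]]]]]].
- intros x Hx; split; [now apply conf_deriv_Cd, Du|].
  exists (pot (potential al q) lam (tvar al x) * u (tvar al x))%C; split.
  + apply conf_deriv_Cd, Cd_comp; [apply Z|now apply tvar_derive].
  + unfold pot; rewrite potential_tvar by assumption; ring.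
- eapply filterlim_filter_le_1; [|apply (Ccont_filterlim (fun x => u (tvar al x)) 0), Cu].
  apply filter_le_within.
- eapply filterlim_filter_le_1; [|apply (Ccont_filterlim (fun x => u (tvar al x)) PI), Cu].
  apply filter_le_within.
- rewrite <- V0.
  eapply filterlim_filter_le_1; [|apply (Ccont_filterlim (fun x => v (tvar al x)) 0), Cv].
  apply filter_le_within.
- eapply filterlim_filter_le_1; [|apply (Ccont_filterlim (fun x => v (tvar al x)) PI), Cv].
  apply filter_le_within.
- rewrite U0; exact Hbc.
- exact Hch.
(* If the eigenfunction vanished inside, so would its derivative, and continuity at 0 would make
   both initial data 0. *)
- apply NNPP; intros N.
  assert (uz : forall x, 0 < x < PI -> u (tvar al x) = 0).
  { intros x Hx; apply NNPP; intros Nx; apply N; now exists x. }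
  assert (vz : forall x, 0 < x < PI -> v (tvar al x) = 0).
  { intros x Hx; apply NNPP; intros Nx.
    apply (Cmult_neq_0 (RtoC (/ Rpower x (1 - al))) (v (tvar al x))); trivial.
    - intros E; apply RtoC_inj in E; revert E; apply Rinv_neq_0_compat.
      assert (0 < Rpower x (1 - al)) by apply exp_pos; lra.
    - apply (Cd_zero_open (fun s => u (tvar al s)) 0 PI x); trivial; apply Du; lra. }
  apply Hab; split; apply RtoC_inj.
  + rewrite <- U0.
    apply (Ccont_zero_closed (fun s => u (tvar al s)) PI); trivial; lra.
  + rewrite <- V0.
    apply (Ccont_zero_closed (fun s => v (tvar al s)) PI); trivial; lra.
Qed.

(** The change of variable degenerates at 0 when [al < 1], so the eigenfunction is compared with the
    solutions through Wronskians. Its Wronskian with the solution of data [(a, b)] vanishes at 0,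
    which reads [y PI * charf = 0] at the other end. If [charf] were nonzero, [y PI] and [dpi] would
    both be 0 and all Wronskians would vanish, forcing [y = 0]. *)
Lemma charf_zero_of_eigenvalue al q (bc0 : C -> C -> Prop) (a b H : R) lam :
  0 < al -> continuous_on_0pi q ->
  (forall y0 d0, bc0 y0 d0 -> (y0 * RtoC b - d0 * RtoC a)%C = 0) ->
  is_eigenvalue al q bc0
    (fun ypi dpi => Cplus dpi (Cmult (RtoC H) ypi) = RtoC 0) lam ->
  charf (potential al q) (tvar al PI) H (RtoC a) (RtoC b) lam = 0.
Proof.
intros Hal Hq Hbc (y & y1 & d0 & dpi & Hode & L1 & L2 & L3 & L4 & B0 & Bpi & (xn & Hxn & Nxn)).
assert (P := PI_RGT_0).
destruct (potential_bounded al q Hq) as (A & HA).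
assert (HQ := fun t => potential_cont al q t Hal Hq).
assert (Dy : forall x, 0 < x < PI -> Cd y x (RtoC (/ Rpower x (1 - al)) * y1 x)%C).
{ intros x Hx; apply conf_deriv_Cd; now apply Hode. }
assert (Dy1 : forall x, 0 < x < PI ->
  Cd y1 x (RtoC (/ Rpower x (1 - al)) * ((RtoC (q x) - lam) * y x))%C).
{ intros x Hx; destruct (Hode x Hx) as (_ & y2 & C2 & E).
  apply conf_deriv_Cd in C2; eapply Cd_val; [exact C2|].
  f_equal; replace ((RtoC (q x) - lam) * y x)%C with (RtoC (q x) * y x - lam * y x)%C by ring.
  rewrite <- E; ring. }
set (ye := extend y (y 0) (y PI)); set (y1e := extend y1 d0 dpi).
assert (Cye : forall x, 0 <= x <= PI -> Ccont ye x).
{ intros x Hx; apply extend_Ccont; trivial; intros s Hs; eapply Cd_cont, Dy, Hs. }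
assert (Cy1e : forall x, 0 <= x <= PI -> Ccont y1e x).
{ intros x Hx; apply extend_Ccont; trivial; intros s Hs; eapply Cd_cont, Dy1, Hs. }
(* The Wronskian of the eigenfunction with any solution is constant up to the endpoints. *)
assert (wr : forall a b : C,
  let u := SLy (potential al q) lam a b in
  let v := SLz (potential al q) lam a b in
  (forall x, 0 < x < PI -> (y x * v (tvar al x) - y1 x * u (tvar al x))%C
    = (y PI * v (tvar al PI) - dpi * u (tvar al PI))%C) /\
  (y 0 * b - d0 * a)%C = (y PI * v (tvar al PI) - dpi * u (tvar al PI))%C).
{ intros a' b' u v.
  destruct (SL_spec _ A lam a' b' HQ HA) as (Y & Z & u0 & v0).
  fold u in Y, Z, u0; fold v in Y, Z, v0; clearbody u v.
  set (W := fun x => (ye x * v (tvar al x) - y1e x * u (tvar al x))%C).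
  assert (CW : forall x, 0 <= x <= PI -> Ccont W x).
  { intros x Hx; apply Ccont_plus; [|apply Ccont_opp]; apply Ccont_mult.
    - now apply Cye.
    - apply Ccont_comp; [eapply Cd_cont, Z|now apply tvar_cont].
    - now apply Cy1e.
    - apply Ccont_comp; [eapply Cd_cont, Y|now apply tvar_cont]. }
  assert (DW : forall x, 0 < x < PI -> Cd (fun x => y x * v (tvar al x) - y1 x * u (tvar al x))%C x 0).
  { intros x Hx; eapply Cd_val.
    - apply Cd_minus; apply Cd_mult.
      + now apply Dy.
      + apply (Cd_comp v (tvar al)); [apply Z|apply tvar_derive; lra].
      + now apply Dy1.
      + apply (Cd_comp u (tvar al)); [apply Y|apply tvar_derive; lra].
    - unfold pot; rewrite potential_tvar by assumption; ring. }
  assert (cst : forall p r, 0 < p < PI -> 0 < r < PI ->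
     (y p * v (tvar al p) - y1 p * u (tvar al p))%C = (y r * v (tvar al r) - y1 r * u (tvar al r))%C).
  { intros p r Hp Hr; destruct (Rle_dec p r).
    - symmetry; apply (Cd_zero_const (fun x => y x * v (tvar al x) - y1 x * u (tvar al x))%C); trivial.
      intros s Hs; apply DW; lra.
    - apply (Cd_zero_const (fun x => y x * v (tvar al x) - y1 x * u (tvar al x))%C); [lra|].
      intros s Hs; apply DW; lra. }
  assert (all : forall r, 0 < r < PI -> forall x, 0 <= x <= PI ->
     (W x - (y r * v (tvar al r) - y1 r * u (tvar al r)))%C = 0).
  { intros r Hr; apply (Ccont_zero_closed
      (fun x => W x - (y r * v (tvar al r) - y1 r * u (tvar al r)))%C PI P).
    - intros x Hx; apply Ccont_plus; [now apply CW|apply Ccont_const].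
    - intros x Hx; unfold W, ye, y1e; rewrite !extend_in by assumption.
      rewrite (cst x r Hx Hr); ring. }
  assert (eq0 : forall a b : C, (a - b)%C = 0 -> a = b).
  { intros p r E; replace p with (p - r + r)%C by ring; rewrite E; ring. }
  assert (WPI : W PI = (y PI * v (tvar al PI) - dpi * u (tvar al PI))%C).
  { unfold W, ye, y1e; now rewrite !extend_PI. }
  assert (W0 : W 0 = (y 0 * b' - d0 * a')%C).
  { unfold W, ye, y1e; now rewrite !extend_0, tvar_0, u0, v0. }
  rewrite <- WPI, <- W0; split.
  - intros x Hx; symmetry; apply eq0, all; lra.
  - rewrite (eq0 _ _ (all xn Hxn 0 ltac:(lra))), (eq0 _ _ (all xn Hxn PI ltac:(lra))); reflexivity. }
unfold charf; apply NNPP; intros N.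
assert (Edpi : dpi = (- (RtoC H * y PI))%C).
{ replace dpi with (dpi + RtoC H * y PI - RtoC H * y PI)%C by ring; rewrite Bpi; ring. }
destruct (wr (RtoC a) (RtoC b)) as [_ E]; cbv zeta in E.
rewrite (Hbc _ _ B0), Edpi in E.
assert (Ypi : y PI = 0).
{ apply NNPP; intros Ny; apply (Cmult_neq_0 _ _ Ny N); rewrite E; ring. }
rewrite Ypi in Edpi.
assert (Zpi : dpi = 0) by (rewrite Edpi; ring).
(* Two solutions with Wronskian 1 recover [y xn] from its Wronskians with them, both of which are
   0. *)
destruct (wr (RtoC 1) (RtoC 0)) as [E1 _]; destruct (wr (RtoC 0) (RtoC 1)) as [E2 _].
specialize (E1 xn Hxn); specialize (E2 xn Hxn); cbv zeta in E1, E2.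
assert (Wc := SL_wronskian (potential al q) A lam 0 (tvar al xn) HQ HA
  ltac:(left; now apply tvar_bounds)).
rewrite Ypi, Zpi, !Cmult_0_l in E1, E2.
apply Nxn.
set (c := SLy (potential al q) lam (RtoC 1) (RtoC 0) (tvar al xn)) in *.
set (c' := SLz (potential al q) lam (RtoC 1) (RtoC 0) (tvar al xn)) in *.
set (s := SLy (potential al q) lam (RtoC 0) (RtoC 1) (tvar al xn)) in *.
set (s' := SLz (potential al q) lam (RtoC 0) (RtoC 1) (tvar al xn)) in *.
replace (y xn) with (y xn * 1)%C by ring; rewrite <- Wc.
replace (y xn * (c * s' - c' * s))%C with
  (c * (y xn * s' - y1 xn * s) - s * (y xn * c' - y1 xn * c))%C by ring.
rewrite E1, E2; ring.
Qed.

Lemma eig_L_charf al q h H lam :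
  0 < al -> continuous_on_0pi q ->
  (eig_L al q h H lam <-> charf (potential al q) (tvar al PI) H (RtoC 1) (RtoC h) lam = 0).
Proof.
intros Hal Hq; split.
- apply charf_zero_of_eigenvalue; trivial.
  intros y0 d0 E; replace (y0 * RtoC h - d0 * RtoC 1)%C with (- (d0 - RtoC h * y0))%C by ring.
  rewrite E; ring.
- apply eigenvalue_of_charf_zero; trivial; [lra|ring].
Qed.

Lemma eig_L1_charf al q H lam :
  0 < al -> continuous_on_0pi q ->
  (eig_L1 al q H lam <-> charf (potential al q) (tvar al PI) H (RtoC 0) (RtoC 1) lam = 0).
Proof.
intros Hal Hq; split.
- apply charf_zero_of_eigenvalue; trivial.
  intros y0 d0 ->; ring.
- apply eigenvalue_of_charf_zero; trivial; lra.
Qed.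

Lemma lebesgue_null_endpoints : lebesgue_null (fun x => x = 0 \/ x = PI).
Proof.
intros eps Heps.
exists (fun k => match k with O => 0 | S _ => PI end), (fun k => match k with O => 0 | S _ => PI end).
split; [|split].
- intros [|k]; lra.
- intros x [->| ->]; [exists O|exists 1%nat]; lra.
- intros n; rewrite (sum_eq _ (fun _ => 0)) by (intros; ring).
  rewrite sum_cte; lra.
Qed.

Theorem theorem2 (al : R) (q qt : R -> R) (h H ht Ht : R)
  (lam xi lamt xit : nat -> R) :
  0 < al <= 1 ->
  continuous_on_0pi q -> continuous_on_0pi qt ->
  enumerates_spectrum (eig_L al q h H) lam ->
  enumerates_spectrum (eig_L1 al q H) xi ->
  enumerates_spectrum (eig_L al qt ht Ht) lamt ->
  enumerates_spectrum (eig_L1 al qt Ht) xit ->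
  (forall n, lam n = lamt n) ->
  (forall n, xi n = xit n) ->
  ae_eq_0pi q qt /\ h = ht /\ H = Ht.
Proof.
intros [Hal _] Hq Hqt [_ SL] [_ SX] [_ SLt] [_ SXt] El Ex.
destruct (potential_bounded al q Hq) as (A1 & HA1).
destruct (potential_bounded al qt Hqt) as (A2 & HA2).
assert (HQ := fun t => potential_cont al q t Hal Hq).
assert (HQt := fun t => potential_cont al qt t Hal Hqt).
set (A := Rmax A1 A2).
assert (HA : forall t, Rabs (potential al q t) <= A)
  by (intros t; eapply Rle_trans; [apply HA1|apply Rmax_l]).
assert (HAt : forall t, Rabs (potential al qt t) <= A)
  by (intros t; eapply Rle_trans; [apply HA2|apply Rmax_r]).
assert (P := PI_RGT_0).
assert (HT : 0 < tvar al PI) by (destruct (tvar_bounds al (PI / 2) Hal); lra).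
destruct (inverse_two_spectra (potential al q) (potential al qt) A (tvar al PI) h H ht Ht)
  as (EQ & Eh & EH); trivial.
(* The enumerations yield both inputs: the zeros are real, and they are zeros of the other
   characteristic function. *)
- apply charf_robin_eq with A; trivial; intros z Hz; apply eig_L_charf in Hz; trivial;
    apply SL in Hz as [n ->].
  + now exists (lam n).
  + apply eig_L_charf; trivial; apply SLt; exists n; now rewrite El.
- apply charf_dirichlet_eq with A; trivial; intros z Hz; apply eig_L1_charf in Hz; trivial;
    apply SX in Hz as [n ->].
  + now exists (xi n).
  + apply eig_L1_charf; trivial; apply SXt; exists n; now rewrite Ex.
- split; [|split; assumption].
  (* The equation holds only in the open interval, so the two endpoints form the exceptional set. *)
  exists (fun x => x = 0 \/ x = PI); split; [apply lebesgue_null_endpoints|].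
  intros x Hx N.
  assert (Hx' : 0 < x < PI).
  { split; [destruct (Req_dec x 0)|destruct (Req_dec x PI)]; try tauto; lra. }
  rewrite <- (potential_tvar al q x), <- (potential_tvar al qt x) by assumption.
  apply EQ; now apply tvar_bounds.
Qed.
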